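(* Let $m \leq N$ be positive integers, let $B = (b_{ji})$ be an $m\times N$ random matrix whose entries $b_{ji}$ are independent, symmetric, unit-variance random variables all distributed as a random variable $X$, and let $A = \frac{1}{\sqrt{m}} B$. Let $s_* = m/\log(eN/m)$. For $\eta \geq 0$ and $y \in \mathbb{R}^m$ let $\Delta_{1,\eta}(y)$ denote a minimizer of $\|z\|_1$ over $z \in \mathbb{R}^N$ subject to $\|Az - y\|_2 \leq \eta$ (for $\eta = 0$ this is the constraint $Az = y$). Let $\eta \geq 0$. \begin{enumerate} \item[(a)] Assume $X$ fulfills the weak moment assumption of order $\max\{4,\log(N)\}$ with constants $\kappa_1$ and $\gamma \geq 1/2$. Then there exist constants $\widetilde{c}_1, \widetilde{c}_2, \widetilde{c}_3, \widetilde{C}, C, D, E > 0$ depending only on $\kappa_1$ and $\gamma$ such that if $N \geq \widetilde{C} m$, $m \geq \widetilde{c}_3 \log^{\max\{2\gamma-1,1\}}(N)$ and $s \in \mathbb{N}$ with $s \leq \widetilde{c}_2 s_*$, then with probability at least $1 - 3\exp(-\widetilde{c}_1 m)$, for all $1 \leq p \leq 2$, all $x \in \mathbb{R}^N$ and all $w \in \mathbb{R}^m$, \[ \|x - \Delta_{1,\eta}(Ax+w)\|_p \leq \frac{C}{s^{1-1/p}} \sigma_s(x)_1 + s_*^{1/p-1/2}\Big( D\eta + E \frac{\|w\|^{(\sqrt{\log(eN/m)})}}{\|w\|_2} \max\{\|w\|_2 - \eta, 0\}\Big). \] \item[(b)] Assume $X$ fulfills the weak moment assumption of order $\max\{4,\log(N)\}$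 with constants $\kappa_1$ and $\gamma \geq 1/2$ and is additionally super-Gaussian with parameter $0 < \sigma \leq 1$. Then there exist constants $\widetilde{c}_1, \widetilde{c}_2, \widetilde{C}, C, D, E > 0$ depending only on $\kappa_1, \gamma, \sigma$ such that if $N \geq \widetilde{C} m$, $m \geq \log^{\max\{2\gamma-1,1\}}(N)$ and $s \in \mathbb{N}$ with $s \leq \widetilde{c}_2 s_*$, then with probability at least $1 - 3\exp(-\widetilde{c}_1 m)$, for all $1 \leq p \leq 2$, all $x \in \mathbb{R}^N$ and all $w \in \mathbb{R}^m$, \[ \|x - \Delta_{1,\eta}(Ax+w)\|_p \leq \frac{C}{s^{1-1/p}} \sigma_s(x)_1 + s_*^{1/p-1/2}\big( D\eta + E \max\{\|w\|_2 - \eta, 0\}\big). \] \end{enumerate}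
   Context: All logarithms are natural. For $x \in \mathbb{R}^N$ and $s\in\mathbb{N}$, $\sigma_s(x)_1 = \inf\{\|x - z\|_1 : z \in \mathbb{R}^N, \|z\|_0 \leq s\}$, where $\|z\|_0$ is the number of nonzero entries of $z$. The clipped $\ell_2$-norm with parameter $\alpha$ on $\mathbb{R}^m$ is $\|y\|^{(\alpha)} = \max\{\|y\|_2, \alpha\|y\|_\infty\}$. For a random variable $X$, $\|X\|_{L_p} = (\mathbb{E}|X|^p)^{1/p}$. Let $X$ be a random variable with $\mathbb{E}[X]=0$ and $\mathbb{E}[X^2]=1$. $X$ is super-Gaussian with parameter $\sigma>0$ if $\mathbb{P}(|\sigma g| > t) \leq \mathbb{P}(|X| > t)$ for all $t>0$, where $g$ is a standard normal random variable. $X$ fulfills the weak moment assumption of order $k$ with constants $\kappa_1$ and $\gamma \geq 1/2$ if $\|X\|_{L_p} \leq \kappa_1 p^{\gamma}$ for all $4 \leq p \leq k$. *)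

(* Defs.v *)
From HB Require Import structures.
From mathcomp Require Import all_boot all_order all_algebra.
From mathcomp Require Import all_classical all_reals all_analysis.
Set Implicit Arguments. Unset Strict Implicit. Unset Printing Implicit Defensive.
Import Order.TTheory GRing.Theory Num.Theory.
Import numFieldNormedType.Exports.
Local Open Scope classical_set_scope.
Local Open Scope ring_scope.

Section Norms.
Context {R : realType}.

Definition lpnorm (N : nat) (p : R) (v : 'I_N -> R) : R :=
  (\sum_(i < N) `|v i| `^ p) `^ p^-1.

Definition linfnorm (N : nat) (v : 'I_N -> R) : R :=
  \big[Num.max/0]_(i < N) `|v i|.

Definition l0norm (N : nat) (v : 'I_N -> R) : nat := #|[set i | v i != 0]|.

Definition sigma_s1 (N s : nat) (x : 'I_N -> R) : R :=
  inf [set lpnorm 1 (fun i => x i - z i) | z in [set z : 'I_N -> R | (l0norm z <= s)%N]].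

Definition clipped_norm (m : nat) (alpha : R) (y : 'I_m -> R) : R :=
  Num.max (lpnorm 2 y) (alpha * linfnorm y).

Definition matvec (m N : nat) (A : 'I_m -> 'I_N -> R) (z : 'I_N -> R) : 'I_m -> R :=
  fun j => \sum_(i < N) A j i * z i.

Definition is_l1_min (m N : nat) (A : 'I_m -> 'I_N -> R) (eta : R)
    (y : 'I_m -> R) (z : 'I_N -> R) : Prop :=
  lpnorm 2 (fun j => matvec A z j - y j) <= eta /\
  forall z' : 'I_N -> R, lpnorm 2 (fun j => matvec A z' j - y j) <= eta ->
    lpnorm 1 z <= lpnorm 1 z'.

Definition sstar (m N : nat) : R := m%:R / ln (expR 1 * N%:R / m%:R).

End Norms.

Section Prob.
Context {d : measure_display} {T : measurableType d} {R : realType}.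
Variable P : probability T R.

Definition mutually_independent (I : finType) (Y : I -> {RV P >-> R}) : Prop :=
  forall (J : {set I}) (B : I -> set R), (forall i, measurable (B i)) ->
  P (\big[setI/setT]_(i in J) (Y i @^-1` B i)) =
  (\prod_(i in J) P (Y i @^-1` B i))%E.

Definition same_distribution (Y X : {RV P >-> R}) : Prop :=
  forall B : set R, measurable B -> P (Y @^-1` B) = P (X @^-1` B).

Definition symmetric_rv (X : {RV P >-> R}) : Prop :=
  forall B : set R, measurable B ->
  P (X @^-1` B) = P ((fun w => - X w) @^-1` B).

Definition centered_unit_variance (X : {RV P >-> R}) : Prop :=
  ('E_P[X] = 0)%E /\ ('E_P[(fun w => (X w ^+ 2)%R)] = 1)%E.

Definition weak_moment (X : {RV P >-> R}) (k kappa1 gamma : R) : Prop :=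
  forall p : R, 4 <= p -> p <= k ->
  ('N[P]_(p%:E)[EFin \o X] <= (kappa1 * p `^ gamma)%:E)%E.

Definition super_gaussian (X : {RV P >-> R}) (sigma : R) : Prop :=
  forall t : R, 0 < t ->
  (normal_prob 0 1 [set x : R | (t < `|sigma * x|)%R] <= P [set w | (t < `|X w|)%R])%E.

End Prob.

(* Main.v *)
Require Import Defs.
From HB Require Import structures.
From mathcomp Require Import all_boot all_order all_algebra.
From mathcomp Require Import all_classical all_reals all_analysis.
From mathcomp Require Import measurable_realfun.
From mathcomp Require Import ring lra zify.
Set Implicit Arguments. Unset Strict Implicit. Unset Printing Implicit Defensive.
Import Order.TTheory GRing.Theory Num.Theory.
Import numFieldNormedType.Exports.
Local Open Scope ring_scope.

(** Write L = ln(eN/m), so that sstar L = m. Deterministically, the recovery bound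
    follows from two properties of A: the robust width property
    |u|_2 <= rho |u|_1 / sqrt(sstar) + tau |A u|_2, and the quotient property that every
    w is A u with |u|_1 <= C sqrt(sstar) q(w), where q is the clipped norm in (a) and the
    Euclidean norm in (b).

    Both properties are stable under small perturbations of the entries, so the entries
    may be truncated and rounded to a finite grid, and all probabilistic estimates become
    finite sums over a product measure.

    Width: each row gives |<X_j, z>| >= |z|_2 / 4 with probability bounded below
    (Paley-Zygmund), hence so do a proportion of the rows, uniformly over the integer
    vectors z with |z|_1 <= 5k, where k is of order sstar. A vector with |u|_1 small compared
    to sqrt(k) |u|_2 is randomly rounded to such a z; the rounding error in a typical row
    is controlled because few columns are heavy, which is where the weak moment assumption
    and the lower bound on m are used.

    Quotient: by duality (projection onto the image of the l1-ball) it suffices that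
    <y, w> <= C max_i |<b_i, y>| / sqrt(L) for all y and all w in the unit ball of q, where
    b_i are the columns of B. For fixed y, tilting
    the law of a column by a density correlated with a near-maximiser w shows, through
    Cauchy-Schwarz, that |<b_i, y>| is large with probability at least exp(-L/4) up to a
    constant; among N = m exp(L - 1) independent columns this fails with probability
    small enough for a union bound over a grid of directions y. *)

(** * Finite product measures *)

(** Moments are controlled only up to order max(4, ln N), so no exponential moment of an entry is
    available. Lower bounds for the width come from second and fourth moments, and uniformity is
    bought by counting integer vectors of small l1-norm. Rounding to them need only be accurate in
    most rows (width) or in one useful column (quotient), so a bound on the mean rounding error
    suffices. The clipped norm of part (a) has this origin: tilting an entry by the density 1 + a
    sg(val) costs about exp(-a^2) and needs |a| <= 1/2; with a = c sqrt(L) w_j this limits |w_j| to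
    order 1/sqrt(L). Super-Gaussian tails also allow larger |a|, by conditioning on a large signed
    value at cost exp(-C1 a^2), and the restriction disappears. In both cases c is chosen so that
    the total cost leaves a probability of order exp(-L/4). The finite model also settles
    measurability: the good outcomes are described by quantifying over all vectors, but the event
    used is the complement of a finite union of measurable sets. *)

Lemma eq_lexx (disp : Order.disp_t) (T : porderType disp) (x y : T) : x = y -> (x <= y)%O.
Proof. by move->. Qed.

Section FiniteProducts.
Context {R : realType}.

(** The law may vary with the coordinate: the tilted laws and the laws of the rounding bits do,
    whereas the entries of the matrix use a constant family. *)
Definition fdist (I V : finType) (p : I -> V -> R) : Prop :=
  (forall i v, 0 <= p i v) /\ (forall i, \sum_v p i v = 1).

Definition Ex (I V : finType) (p : I -> V -> R) (f : {ffun I -> V} -> R) : R :=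
  \sum_(x : {ffun I -> V}) (\prod_i p i (x i)) * f x.

Definition Pr (I V : finType) (p : I -> V -> R) (A : {ffun I -> V} -> bool) : R :=
  Ex p (fun x => (A x)%:R).

Section Basic.
Variables (I V : finType) (p : I -> V -> R).
Implicit Types f g : {ffun I -> V} -> R.

Lemma Ex_prod (F : I -> V -> R) :
  Ex p (fun x => \prod_i F i (x i)) = \prod_i \sum_v p i v * F i v.
Proof.
rewrite /Ex bigA_distr_bigA /=; apply: eq_bigr => x _.
by rewrite big_split.
Qed.

Lemma eq_Ex f g : f =1 g -> Ex p f = Ex p g.
Proof. by move=> e; apply: eq_bigr => x _; rewrite e. Qed.

Lemma ExD f g : Ex p (fun x => f x + g x) = Ex p f + Ex p g.
Proof. by rewrite /Ex -big_split; apply: eq_bigr => x _; rewrite mulrDr. Qed.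

Lemma ExZ c f : Ex p (fun x => c * f x) = c * Ex p f.
Proof. by rewrite /Ex big_distrr; apply: eq_bigr => x _ /=; rewrite mulrCA. Qed.

Lemma ExB f g : Ex p (fun x => f x - g x) = Ex p f - Ex p g.
Proof.
rewrite -[- Ex p g]mulN1r -ExZ -ExD; apply: eq_Ex => x.
by rewrite mulN1r.
Qed.

Lemma Ex_sum (J : Type) (r : seq J) (P : pred J) (F : J -> {ffun I -> V} -> R) :
  Ex p (fun x => \sum_(j <- r | P j) F j x) = \sum_(j <- r | P j) Ex p (F j).
Proof. by rewrite /Ex exchange_big; apply: eq_bigr => x _; rewrite mulr_sumr. Qed.

Hypothesis pP : fdist p.

Lemma Ex_weight_ge0 (x : {ffun I -> V}) : 0 <= \prod_i p i (x i).
Proof. by apply: prodr_ge0 => i _; case: pP. Qed.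

Lemma Ex_cst c : Ex p (fun=> c) = c.
Proof.
rewrite /Ex -mulr_suml -[RHS]mul1r; congr (_ * _).
rewrite -(bigA_distr_bigA (fun i v => p i v)) /=.
by rewrite big1// => i _; case: pP => _ ->.
Qed.

Lemma Ex_le f g : (forall x, f x <= g x) -> Ex p f <= Ex p g.
Proof.
by move=> fg; apply: ler_sum => x _; apply: ler_wpM2l => //; exact: Ex_weight_ge0.
Qed.

Lemma Ex_ge0 f : (forall x, 0 <= f x) -> 0 <= Ex p f.
Proof. by move=> f0; apply: sumr_ge0 => x _; rewrite mulr_ge0// Ex_weight_ge0. Qed.

(** A function cannot exceed its mean everywhere. This turns a random rounding into a single
    rounding with small total error. *)
Lemma Ex_exists_le f c : Ex p f <= c -> exists x, f x <= c.
Proof.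
move=> fc; apply: contrapT => /forallNP nf.
have lt x : 0 < f x - c by rewrite subr_gt0 ltNge; apply/negP; exact: nf.
have ge (x : {ffun I -> V}) : true -> 0 <= (\prod_i p i (x i)) * (f x - c).
  by move=> _; rewrite mulr_ge0 ?Ex_weight_ge0// ltW.
have e0 : \sum_(x : {ffun I -> V}) (\prod_i p i (x i)) * (f x - c) = 0.
  apply/le_anti/andP; split; last exact: sumr_ge0.
  by rewrite -[X in X <= _]/(Ex p (fun x => f x - c)) ExB Ex_cst subr_le0.
have := Ex_cst 1; rewrite /Ex big1 => [/eqP|x _]; first by rewrite eq_sym oner_eq0.
have /eqP := @psumr_eq0P _ _ _ _ ge e0 x isT.
by rewrite mulf_eq0 (gt_eqF (lt x)) orbF mulr1 => /eqP.
Qed.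

Lemma Pr_ge0 A : 0 <= Pr p A.
Proof. by apply: Ex_ge0 => x; rewrite ler0n. Qed.

Lemma Pr_le (A B : {ffun I -> V} -> bool) : (forall x, A x -> B x) -> Pr p A <= Pr p B.
Proof.
move=> AB; apply: Ex_le => x; have := AB x.
by case: (A x) => [->|]// _; case: (B x); rewrite ?ler01.
Qed.

Lemma PrU (A B : {ffun I -> V} -> bool) :
  Pr p (fun x => A x || B x) <= Pr p A + Pr p B.
Proof.
rewrite /Pr -ExD; apply: Ex_le => x.
by case: (A x); case: (B x); rewrite /= ?addr0 ?add0r// lerDl.
Qed.

Lemma Pr_exists_le (J : finType) (S : pred J) (A : J -> {ffun I -> V} -> bool) q :
  (forall j, S j -> Pr p (A j) <= q) ->
  Pr p (fun x => [exists j, S j && A j x]) <= #|S|%:R * q.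
Proof.
move=> Aq; apply: (@le_trans _ _ (\sum_(j | S j) Pr p (A j))); last first.
  apply: (@le_trans _ _ (\sum_(j | S j) q)); first exact: ler_sum.
  by rewrite sumr_const mulr_natl.
rewrite /Pr -Ex_sum; apply: Ex_le => x.
case: existsP => [[j /andP[Sj Aj]]|_]; last by rewrite sumr_ge0// => j _; rewrite ler0n.
by rewrite (bigD1 j)//= Aj lerDl sumr_ge0// => k _; rewrite ler0n.
Qed.

Lemma markov_Pr f c : 0 < c -> (forall x, 0 <= f x) ->
  Pr p (fun x => c < f x) <= Ex p f / c.
Proof.
move=> c0 f0; rewrite ler_pdivlMr// mulrC /Pr -ExZ; apply: Ex_le => x.
by case: ltP => [/ltW|]; rewrite ?mulr1 ?mulr0.
Qed.

Definition upd (x : {ffun I -> V}) (i : I) (v : V) : {ffun I -> V} :=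
  [ffun k => if k == i then v else x k].

(** Exchanging a coordinate with a fresh sample is an involution that preserves the product weight.
    Independence of a coordinate can then be expressed as invariance under [upd]. *)
Lemma Ex_resample i f : Ex p f = Ex p (fun x => \sum_v p i v * f (upd x i v)).
Proof.
pose phi (y : {ffun I -> V} * V) := (upd y.1 i y.2, y.1 i).
have phiK : involutive phi.
  case=> x v; rewrite /phi /=; congr pair; last by rewrite ffunE eqxx.
  by apply/ffunP => k; rewrite !ffunE; case: eqP => // ->.
have -> : Ex p (fun x => \sum_v p i v * f (upd x i v)) =
    \sum_(y : {ffun I -> V} * V) (\prod_k p k (y.1 k)) * (p i y.2 * f (upd y.1 i y.2)).
  rewrite /Ex (eq_bigr (fun x : {ffun I -> V} => \sum_v (\prod_k p k (x k)) * (p i v * f (upd x i v)))).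
    by rewrite pair_big.
  by move=> x _; rewrite mulr_sumr.
rewrite (reindex_inj (inv_inj phiK)) /=.
have -> : \sum_(y : {ffun I -> V} * V) (\prod_k p k (upd y.1 i y.2 k)) *
    (p i (y.1 i) * f (upd (upd y.1 i y.2) i (y.1 i))) =
    \sum_(y : {ffun I -> V} * V) (\prod_k p k (y.1 k)) * f y.1 * p i y.2.
  apply: eq_bigr => -[x v] _ /=.
  rewrite (_ : upd (upd x i v) i (x i) = x); last first.
    by apply/ffunP => k; rewrite !ffunE; case: eqP => // ->.
  rewrite mulrA [RHS]mulrAC; congr (_ * _).
  rewrite (bigD1 i)//= [in RHS](bigD1 i)//= ffunE eqxx.
  rewrite (eq_bigr (fun k => p k (x k))); first ring.
  by move=> k /negbTE ki; rewrite ffunE ki.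
rewrite -(pair_big predT predT (fun (x : {ffun I -> V}) v => (\prod_k p k (x k)) * f x * p i v)) /=.
by apply: eq_bigr => x _; rewrite -mulr_sumr; case: pP => _ ->; rewrite mulr1.
Qed.

Lemma Ex_indep i g (f : V -> R) : (forall x v, g (upd x i v) = g x) ->
  Ex p (fun x => g x * f (x i)) = Ex p g * \sum_v p i v * f v.
Proof.
move=> gi; rewrite (Ex_resample i) [RHS]mulrC -ExZ; apply: eq_Ex => x.
rewrite mulr_suml; apply: eq_bigr => v _.
by rewrite gi ffunE eqxx; ring.
Qed.

Lemma Ex_coord i (f : V -> R) : Ex p (fun x => f (x i)) = \sum_v p i v * f v.
Proof.
rewrite -[RHS]mul1r -[X in X * _](Ex_cst 1) -Ex_indep//.
by apply: eq_Ex => x; rewrite mul1r.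
Qed.

Lemma Ex_sum_coord (y : I -> V -> R) :
  Ex p (fun x => \sum_i y i (x i)) = \sum_i \sum_v p i v * y i v.
Proof. by rewrite Ex_sum; apply: eq_bigr => i _; rewrite Ex_coord. Qed.

Section CenteredSums.
Variable y : I -> V -> R.
Hypothesis y0 : forall i, \sum_v p i v * y i v = 0.
Let s (r : seq I) (x : {ffun I -> V}) := \sum_(i <- r) y i (x i).

(** When a summand is added, every mixed term containing a first power of the summand or of the
    partial sum has mean zero; only the product of the two variances survives. *)
Lemma centered_partial_moments (r : seq I) : uniq r ->
  [/\ Ex p (s r) = 0,
      Ex p (fun x => s r x ^+ 2) = \sum_(i <- r) \sum_v p i v * y i v ^+ 2 &
      Ex p (fun x => s r x ^+ 4) <=
        3 * (\sum_(i <- r) \sum_v p i v * y i v ^+ 2) ^+ 2 +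
        \sum_(i <- r) \sum_v p i v * y i v ^+ 4].
Proof.
elim: r => [_|i r IH /= /andP[ir /IH[IH1 IH2 IH4]]].
  rewrite !big_nil; split; rewrite -[RHS](Ex_cst 0)||idtac; last first.
  - apply: le_trans (_ : Ex p (fun=> 0) <= _); last by rewrite Ex_cst; lra.
    by apply: Ex_le => x; rewrite /s big_nil expr0n.
  - by apply: eq_Ex => x; rewrite /s big_nil expr0n.
  - by apply: eq_Ex => x; rewrite /s big_nil.
have su x v : s r (upd x i v) = s r x.
  rewrite /s big_seq [RHS]big_seq; apply: eq_bigr => k kr.
  by rewrite ffunE; case: eqP => // ki; rewrite -ki kr in ir.
have ind a b : Ex p (fun x => s r x ^+ a * y i (x i) ^+ b) =
    Ex p (fun x => s r x ^+ a) * \sum_v p i v * y i v ^+ b.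
  by rewrite (Ex_indep (fun v => y i v ^+ b))// => x v; rewrite su.
have ind1 a : Ex p (fun x => s r x ^+ a * y i (x i)) = 0.
  by rewrite (Ex_indep (fun v => y i v)) ?y0 ?mulr0// => x v; rewrite su.
have e0 : Ex p (fun x => s r x ^+ 0) = 1 by rewrite -[RHS]Ex_cst.
have sE x : s (i :: r) x = s r x + y i (x i) by rewrite /s big_cons addrC.
split.
- rewrite (eq_Ex sE) ExD IH1 add0r.
  by rewrite Ex_coord y0.
- rewrite (eq_Ex (g := fun x => s r x ^+ 2 +
     (2 * (s r x ^+ 1 * y i (x i)) + s r x ^+ 0 * y i (x i) ^+ 2))); last first.
    by move=> x; rewrite sE; ring.
  rewrite !ExD (ExZ 2) ind1 (ind 0%N 2%N) e0 IH2 big_cons; ring.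
- rewrite (eq_Ex (g := fun x => s r x ^+ 4 + (4 * (s r x ^+ 3 * y i (x i)) +
     (6 * (s r x ^+ 2 * y i (x i) ^+ 2) + (4 * (s r x ^+ 1 * y i (x i) ^+ 3)
      + s r x ^+ 0 * y i (x i) ^+ 4))))); last first.
    by move=> x; rewrite sE; ring.
  rewrite !ExD !(ExZ 4) (ExZ 6) ind1 (ind 2%N 2%N) (ind 1%N 3%N) (ind 0%N 4%N) e0 IH2 !big_cons.
  rewrite (eq_Ex (g := s r) (f := fun x => s r x ^+ 1)) => [|x]; last by rewrite expr1.
  rewrite IH1; set a := \sum_(i <- r) _ in IH4 *; set b := \sum_v p i v * y i v ^+ 2.
  (* What remains is [3 a^2 + 6 a b <= 3 (b + a)^2]. *)
  nra.
Qed.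

Lemma Ex_sqr_centered :
  Ex p (fun x => (\sum_i y i (x i)) ^+ 2) = \sum_i \sum_v p i v * y i v ^+ 2.
Proof. by have [_ -> _] := centered_partial_moments (index_enum_uniq I). Qed.

Lemma Ex_fourth_centered :
  Ex p (fun x => (\sum_i y i (x i)) ^+ 4) <=
   3 * (\sum_i \sum_v p i v * y i v ^+ 2) ^+ 2 + \sum_i \sum_v p i v * y i v ^+ 4.
Proof. by have [_ _] := centered_partial_moments (index_enum_uniq I). Qed.

End CenteredSums.
End Basic.
End FiniteProducts.

Arguments eq_Ex {R I V p f g}.

(** * Second and fourth moment lower bounds, Chernoff bounds *)

Section Tails.
Context {R : realType}.

(** The constants come from the pointwise bound [Z <= a/4 + (a/(2b)) Z^2 + (b/(2a)) 1{a/4 <= Z}], an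
    arithmetic-geometric mean inequality; in expectation the first two terms use up at most 3/4 of
    [a]. *)
Lemma paley_zygmund (I V : finType) (p : I -> V -> R) (Z : {ffun I -> V} -> R) (a b : R) :
  fdist p -> 0 < a -> 0 < b -> (forall x, 0 <= Z x) -> a <= Ex p Z ->
  Ex p (fun x => Z x ^+ 2) <= b ->
  a ^+ 2 / (2 * b) <= Pr p (fun x => a / 4 <= Z x).
Proof.
move=> pP a0 b0 Z0 aZ Zb.
have : Ex p Z <= Ex p (fun x => a / 4 + (a / (2 * b) * Z x ^+ 2 +
    b / (2 * a) * (a / 4 <= Z x)%R%:R)).
  apply: Ex_le => // x; case: (leP (a / 4) (Z x)) => h /=; rewrite ?mulr1 ?mulr0; last first.
    have : 0 <= a / (2 * b) * Z x ^+ 2 by rewrite mulr_ge0 ?divr_ge0 ?sqr_ge0//; lra.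
    lra.
  have : 0 <= (a * Z x - b) ^+ 2 / (2 * a * b).
    by rewrite divr_ge0 ?sqr_ge0// !mulr_ge0 ?ltW.
  have -> : (a * Z x - b) ^+ 2 / (2 * a * b) =
     a / (2 * b) * Z x ^+ 2 + b / (2 * a) - Z x by field; apply/andP; split; lra.
  lra.
rewrite !ExD !ExZ Ex_cst// -/(Pr p (fun x => a / 4 <= Z x)).
set P := Pr p _; set e2 := Ex p _ in Zb *; move=> h.
have h2 : a / (2 * b) * e2 <= a / 2.
  apply: (@le_trans _ _ (a / (2 * b) * b)); first by rewrite ler_wpM2l// divr_ge0; lra.
  by apply: eq_lexx; field; lra.
have h3 : a / 4 <= b / (2 * a) * P by lra.
rewrite ler_pdivrMr; last lra.
have := ler_wpM2r (ltW a0) h3.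
have -> : b / (2 * a) * P * a = b * P / 2 by field; lra.
nra.
Qed.

(* The polynomial [(C y + y^2 - y^4/(2C)) / (6C^2)] minorises [1{y >= 0}]; its linear part
   disappears in expectation. *)
Lemma centered_nonneg_prob (I V : finType) (p : I -> V -> R) (Y : {ffun I -> V} -> R) (v C : R) :
  fdist p -> 0 < v -> 2 <= C -> Ex p Y = 0 -> Ex p (fun x => Y x ^+ 2) = v ->
  Ex p (fun x => Y x ^+ 4) <= C * v ^+ 2 ->
  (12 * C ^+ 2)^-1 <= Pr p (fun x => 0 <= Y x).
Proof.
move=> pP v0 C2 Y1 Y2 Y4.
(* Dividing by the standard deviation makes the variance 1 and the fourth moment at most [C]. *)
pose w := Num.sqrt v; have w0 : 0 < w by rewrite sqrtr_gt0.
have wE : w ^+ 2 = v by rewrite sqr_sqrtr// ltW.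
have key y : C * y + y ^+ 2 - y ^+ 4 / (2 * C) <= 6 * C ^+ 2 * (0 <= y)%R%:R.
  have -> : C * y + y ^+ 2 - y ^+ 4 / (2 * C) =
     (2 * C ^+ 2 * y + 2 * C * y ^+ 2 - y ^+ 4) / (2 * C) by field; lra.
  rewrite ler_pdivrMr; last lra.
  have [y0|y0] := leP 0 y; rewrite /= ?mulr1 ?mulr0 ?mul0r.
    have [h|h] := leP y (2 * C); last first.
      have : 0 <= C ^+ 2 * (y * C) by rewrite !mulr_ge0; nra.
      have : 2 * C * y ^+ 2 + 2 * C ^+ 2 * y <= y ^+ 4.
        have h1 : 2 * C * (2 * C) <= y ^+ 2 by rewrite expr2 ler_pM//; lra.
        have h2 : C * y * (2 * C) <= C * y * y by rewrite ler_wpM2l ?mulr_ge0//; lra.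
        have h3 : C * 2 <= C * C by rewrite ler_wpM2l//; lra.
        have h4 : 0 <= (y ^+ 2 - 3 * C) * y ^+ 2 by rewrite mulr_ge0 ?sqr_ge0//; lra.
        have -> : y ^+ 4 = y ^+ 2 * y ^+ 2 by ring.
        lra.
      have : 0 <= 6 * C ^+ 2 * (2 * C) by rewrite !mulr_ge0 ?sqr_ge0; lra.
      lra.
    have : 2 * C ^+ 2 * y <= 2 * C ^+ 2 * (2 * C) by rewrite ler_wpM2l// mulr_ge0 ?sqr_ge0//.
    have : 2 * C * y ^+ 2 <= 2 * C * (2 * C) ^+ 2.
      by rewrite ler_wpM2l; [|lra|]; rewrite // lerXn2r// nnegrE; lra.
    have : 0 <= y ^+ 4 by rewrite exprn_ge0.
    have -> : 2 * C * (2 * C) ^+ 2 = 8 * C ^+ 3 by ring.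
    have -> : 2 * C ^+ 2 * (2 * C) = 4 * C ^+ 3 by ring.
    have -> : 6 * C ^+ 2 * (2 * C) = 12 * C ^+ 3 by ring.
    lra.
  set t := - y; have t0 : 0 < t by rewrite oppr_gt0.
  have -> : 2 * C ^+ 2 * y + 2 * C * y ^+ 2 - y ^+ 4 =
     t * (- (2 * C ^+ 2) + 2 * C * t - t ^+ 3) by rewrite /t; ring.
  rewrite pmulr_rle0//.
  have [h|h] := leP t C; first by have := exprn_ge0 3 (ltW t0); nra.
  have : 2 * C <= t ^+ 2 by nra.
  have -> : t ^+ 3 = t * t ^+ 2 by ring.
  have := sqr_ge0 C.
  nra.
have : Ex p (fun x => C / w * Y x + (v^-1 * Y x ^+ 2 - (2 * C * v ^+ 2)^-1 * Y x ^+ 4)) <=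
    Ex p (fun x => 6 * C ^+ 2 * (0 <= Y x)%R%:R).
  apply: Ex_le => // x.
  have := key (Y x / w); rewrite pmulr_lge0 ?invr_gt0//.
  apply: le_trans; apply: eq_lexx.
  by rewrite -wE; field; lra.
rewrite ExD ExB !ExZ Y1 Y2 -/(Pr p (fun x => 0 <= Y x)).
set P := Pr p _; set e4 := Ex p _ in Y4 *; move=> h.
have h4 : (2 * C * v ^+ 2)^-1 * e4 <= 1 / 2.
  rewrite mulrC ler_pdivrMr; last by rewrite !mulr_gt0//; lra.
  by lra.
rewrite mulVf ?gt_eqF// in h.
rewrite -[leLHS]mul1r ler_pdivrMr; last by rewrite mulr_gt0// exprn_gt0//; lra.
lra.
Qed.

Section Blocks.
Variables (A B K V : finType) (e : A * B -> K) (p : K -> V -> R).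
Hypothesis e_bij : bijective e.
Hypothesis pP : fdist p.

(** [e] arranges the index set into blocks: the identity gives the rows of the matrix and [swapK]
    its columns, so independence of rows and of columns have one proof. *)
Definition blockf (x : {ffun K -> V}) (a : A) : {ffun B -> V} := [ffun b => x (e (a, b))].

Lemma Ex_blocks (F : A -> {ffun B -> V} -> R) :
  Ex p (fun x => \prod_a F a (blockf x a)) =
  \prod_a Ex (fun b => p (e (a, b))) (F a).
Proof.
have [e' eK e'K] := e_bij.
rewrite /Ex bigA_distr_bigA /=.
pose unc (r : {ffun A -> {ffun B -> V}}) : {ffun K -> V} := [ffun k => r (e' k).1 (e' k).2].
pose cur (x : {ffun K -> V}) : {ffun A -> {ffun B -> V}} := [ffun a => blockf x a].
rewrite (reindex unc) /=; last first.
  exists cur => [r _|x _].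
    by apply/ffunP => a; apply/ffunP => b; rewrite !ffunE eK.
  by apply/ffunP => k; rewrite !ffunE -surjective_pairing e'K.
apply: eq_bigr => r _; rewrite big_split /=; congr (_ * _).
  rewrite pair_big /= (reindex e) /=; last by exists e' => k _.
  by apply: eq_bigr => -[a b] _; rewrite ffunE eK.
apply: eq_bigr => a _; congr (F a _).
by apply/ffunP => b; rewrite !ffunE eK.
Qed.

Variable E : A -> {ffun B -> V} -> bool.

Let pa a := fun b => p (e (a, b)).

Lemma fdist_block a : fdist (pa a).
Proof. by split=> *; case: pP => ? ?; rewrite /pa. Qed.

(** Markov's inequality for the exponential of minus the count: since [exp(-1) <= 1/2], each block
    contributes at most [1 - q/2 <= exp(-q/2)], and half of this gain pays for the threshold. *)
Lemma chernoff_lower (q : R) :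
  (forall a, q <= Pr (pa a) (E a)) ->
  Pr p (fun x => \sum_a (E a (blockf x a))%:R < q * #|A|%:R / 4) <= expR (- (q * #|A|%:R / 4)).
Proof.
move=> qE; set n := q * #|A|%:R / 4.
apply: (@le_trans _ _ (expR n * Ex p (fun x => \prod_a expR (- (E a (blockf x a))%:R)))).
  rewrite -ExZ; apply: Ex_le => // x.
  rewrite -expR_sum -expRD; case: ltP => h /=; last exact: expR_ge0.
  rewrite -[leLHS]expR0 ler_expR sumrN; lra.
rewrite (Ex_blocks (fun a y => expR (- (E a y)%:R))).
have h a : true -> 0 <= Ex (pa a) (fun y => expR (- (E a y)%:R)) <= expR (- (q / 2)).
  move=> _; apply/andP; split.
    by apply: Ex_ge0; [exact: fdist_block|move=> y; exact: expR_ge0].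
  rewrite (eq_Ex (g := fun y => 1 - (1 - expR (-1)) * (E a y)%:R)); last first.
    by move=> y; case: (E a y); rewrite /= ?mulr1 ?mulr0 ?oppr0 ?expR0; lra.
  rewrite ExB ExZ Ex_cst; last exact: fdist_block.
  rewrite -/(Pr _ _).
  have e2 : expR (-1) <= 2^-1 :> R.
    rewrite expRN lef_pV2 ?posrE ?expR_gt0//.
    by have := @expR_ge1Dx R 1; lra.
  have := qE a; have := Pr_ge0 (fdist_block a) (E a); set P := Pr _ _ => P0 qP.
  have := @expR_ge1Dx R (- (q / 2)); nra.
apply: (@le_trans _ _ (expR n * \prod_(a : A) expR (- (q / 2)))).
  by rewrite ler_wpM2l ?expR_ge0// ler_prod.
rewrite -expR_sum -expRD ler_expR sumr_const -mulr_natr /n; lra.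
Qed.

(** The weight [q^-1] raised to the count has mean at most 2 per block. This form suits rare events
    whose count is far above its mean. *)
Lemma chernoff_upper (q : R) (n : nat) : 0 < q -> q <= 1 ->
  (forall a, Pr (pa a) (E a) <= q) ->
  Pr p (fun x => (n <= \sum_a (E a (blockf x a) : nat))%N) <= q ^+ n * 2 ^+ #|A|.
Proof.
move=> q0 q1 Eq.
apply: (@le_trans _ _ (q ^+ n * Ex p (fun x => \prod_a q^-1 ^+ (E a (blockf x a))))).
  rewrite -ExZ; apply: Ex_le => // x; rewrite -expr_sum.
  case: leqP => h /=; last by rewrite mulr_ge0// exprn_ge0// ?invr_ge0 ltW.
  set s := (\sum_a _)%N in h *.
  rewrite -(subnKC h) exprD mulrA -exprMn mulfV ?gt_eqF// expr1n mul1r.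
  by apply: exprn_ege1; rewrite invf_ge1.
rewrite (Ex_blocks (fun a y => q^-1 ^+ (E a y))).
apply: ler_wpM2l; first by rewrite exprn_ge0// ltW.
apply: (@le_trans _ _ (\prod_(a : A) 2)); last by rewrite prodr_const.
apply: ler_prod => a _; apply/andP; split.
  by apply: Ex_ge0; [exact: fdist_block|move=> y; rewrite exprn_ge0// invr_ge0 ltW].
apply: (@le_trans _ _ (Ex (pa a) (fun y => 1 + q^-1 * (E a y)%:R))).
  apply: Ex_le; first exact: fdist_block.
  by move=> y; case: (E a y); rewrite /= ?expr1 ?expr0 ?mulr1 ?mulr0; lra.
rewrite ExD ExZ Ex_cst; last exact: fdist_block.
rewrite -/(Pr _ _).
have : q^-1 * Pr (pa a) (E a) <= q^-1 * q by rewrite ler_wpM2l ?Eq// invr_ge0 ltW.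
rewrite mulVf ?gt_eqF//; lra.
Qed.

Lemma Pr_all_blocks (q : R) (S : {set A}) : 0 <= q ->
  (forall a, Pr (pa a) (E a) <= q) ->
  Pr p (fun x => [forall a in S, E a (blockf x a)]) <= q ^+ #|S|.
Proof.
move=> q0 Eq.
rewrite /Pr (eq_Ex (g := fun x => \prod_a (if a \in S then (E a (blockf x a))%:R else 1))); last first.
  move=> x; rewrite -big_mkcond /=.
  case: (boolP [forall a in S, _]) => [/forall_inP h|/forall_inPn[a aS /negbTE h]].
    by rewrite big1// => a /h ->.
  by rewrite (bigD1 a)//= h mul0r.
rewrite (Ex_blocks (fun a y => if a \in S then (E a y)%:R else 1)).
rewrite -prodr_const [leRHS]big_mkcond /=; apply: ler_prod => a _.
case: ifP => _; last by rewrite Ex_cst ?ler01 ?lexx//; exact: fdist_block.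
by apply/andP; split; [apply: Pr_ge0; exact: fdist_block|exact: Eq].
Qed.

End Blocks.
End Tails.

(** * Integer grids and random rounding *)

Section Rounding.
Context {R : realType}.

(* The integers of magnitude at most [n]: [Some (a, s)] stands for [(-1)^s (a + 1)]. *)
Definition gint (n : nat) : finType := option ('I_n * bool).

Definition gmag n (g : gint n) : nat := if g is Some a then (a.1 : nat).+1 else 0%N.

Definition gval n (g : gint n) : R :=
  if g is Some a then (-1) ^+ a.2 * (a.1 : nat).+1%:R else 0.

Lemma geometric_tail_le (x : R) n : 0 <= x -> x <= 1 / 2 -> \sum_(a < n) x ^+ a.+1 <= 2 * x.
Proof.
move=> x0 x2.
have e : (1 - x) * \sum_(a < n) x ^+ a.+1 = x - x ^+ n.+1.
  elim: n => [|n IH]; first by rewrite big_ord0 mulr0 expr1 subrr.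
  by rewrite big_ord_recr /= mulrDr IH (exprS _ n.+1); ring.
have := exprn_ge0 n.+1 x0; have : 0 <= \sum_(a < n) x ^+ a.+1.
  by apply: sumr_ge0 => i _; rewrite exprn_ge0.
set s := \sum_(a < n) _ in e *; nra.
Qed.

(** Weighting a grid vector by [x] to the power of its l1-norm makes the sum factor over
    coordinates, and each factor is at most [1 + 4 x]. The free parameter [x] is tuned to the ratio
    of [n] to the dimension. *)
Lemma grid_count (I : finType) (n : nat) (x : R) : 0 < x -> x <= 1 / 2 ->
  #|[pred z : {ffun I -> gint n} | (\sum_i gmag (z i) <= n)%N]|%:R
   <= x^-1 ^+ n * expR (4 * x * #|I|%:R).
Proof.
move=> x0 x2; rewrite -sum1_card natr_sum.
apply: (@le_trans _ _ (x^-1 ^+ n * \sum_(z : {ffun I -> gint n}) \prod_i x ^+ gmag (z i))).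
  rewrite mulr_sumr [leLHS]big_mkcond /=; apply: ler_sum => z _.
  rewrite -expr_sum inE; case: ifP => [h|_]; last first.
    by rewrite mulr_ge0// exprn_ge0// ?invr_ge0 ltW.
  move: (\sum_i _)%N h => s h.
  rewrite -[in leRHS](subnK h) exprD -mulrA -exprMn mulVf ?gt_eqF// expr1n mulr1.
  by apply: exprn_ege1; rewrite invf_ge1//; lra.
apply: ler_wpM2l; first by rewrite exprn_ge0// invr_ge0 ltW.
rewrite -(bigA_distr_bigA (fun _ g => x ^+ gmag g)) /=.
apply: (@le_trans _ _ (\prod_(i : I) expR (4 * x))); last first.
  by rewrite prodr_const -expRM_natr.
apply: ler_prod => i _; apply/andP; split.
  by apply: sumr_ge0 => g _; rewrite exprn_ge0// ltW.
apply: le_trans (expR_ge1Dx _).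
rewrite (bigD1 None)//= expr0 lerD2l (reindex_omap Some id) => [|[]//].
rewrite (eq_bigl predT) /= => [|a]; last by rewrite eqxx.
rewrite -(pair_big predT predT (fun (a : 'I_n) (b : bool) => x ^+ a.+1)) /=.
under eq_bigr do rewrite big_bool /=.
rewrite big_split /=.
have := geometric_tail_le n (ltW x0) x2; lra.
Qed.

Section Round.
Variables (I : finType) (u : I -> R) (h : R).
Hypothesis h0 : 0 < h.

Definition rfloor (i : I) : nat := Num.truncn (`|u i| / h).
Definition rfrac (i : I) : R := `|u i| / h - (rfloor i)%:R.
(** The bit rounds up with probability equal to the fractional part, which makes the rounding
    unbiased. *)
Definition rdist (i : I) (b : bool) : R := if b then rfrac i else 1 - rfrac i.
Definition rnd (B : {ffun I -> bool}) (i : I) : R :=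
  Num.sg (u i) * h * ((rfloor i)%:R + (B i)%:R).

Lemma rfrac_itv i : 0 <= rfrac i <= 1.
Proof.
have /truncn_itv := divr_ge0 (normr_ge0 (u i)) (ltW h0).
rewrite /rfrac /rfloor => /andP[a b]; rewrite subr_ge0 a /=.
by rewrite -natr1 in b; lra.
Qed.

Lemma rfrac_le i : rfrac i <= `|u i| / h.
Proof. by rewrite /rfrac gerBl. Qed.

Lemma fdist_rdist : fdist rdist.
Proof.
split=> [i [|]|i] /=; have := rfrac_itv i; first by case/andP.
  by case/andP => _; rewrite subr_ge0.
by move=> _; rewrite big_bool /rdist /=; lra.
Qed.

Lemma rnd_err B i : rnd B i - u i = Num.sg (u i) * h * ((B i)%:R - rfrac i).
Proof.
rewrite /rnd /rfrac {2}[u i]numEsg.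
by field; rewrite gt_eqF.
Qed.

Lemma Ex_rdist_bit i : Ex rdist (fun B => (B i)%:R) = rfrac i.
Proof.
rewrite (Ex_coord fdist_rdist i (fun b => b%:R)) big_bool /rdist /=.
by rewrite mulr1 mulr0 addr0.
Qed.

(** The variance [f (1 - f)] of a bit is bounded by [f], hence by [|u i| / h]; this allows the error
    to be charged to the l1-norm of [u] instead of the dimension. *)
Lemma Ex_rdist_sqr (c : I -> R) :
  Ex rdist (fun B => (\sum_i c i * ((B i)%:R - rfrac i)) ^+ 2) <=
  \sum_i c i ^+ 2 * rfrac i.
Proof.
rewrite (Ex_sqr_centered fdist_rdist (y := fun i b => c i * (b%:R - rfrac i))).
  apply: ler_sum => i _; rewrite big_bool /rdist /=.
  have /andP[] := rfrac_itv i; set f := rfrac i => f0 f1.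
  have -> : f * (c i * (1 - f)) ^+ 2 + (1 - f) * (c i * (0 - f)) ^+ 2 =
    c i ^+ 2 * (f * (1 - f)) by ring.
  by rewrite ler_wpM2l ?sqr_ge0//; nra.
by move=> i; rewrite big_bool /rdist /=; ring.
Qed.

Lemma rfloor_sum_le (n : nat) : \sum_i `|u i| <= n%:R * h -> (\sum_i rfloor i <= n)%N.
Proof.
move=> un; rewrite -(ler_nat R) natr_sum.
apply: (@le_trans _ _ (\sum_i `|u i| / h)); last by rewrite -mulr_suml ler_pdivrMr.
by apply: ler_sum => i _; have /andP[+ _] := rfrac_itv i; rewrite subr_ge0.
Qed.

Lemma rnd_grid (n : nat) (B : {ffun I -> bool}) : (\sum_i (rfloor i + B i) <= n)%N ->
  exists2 z : {ffun I -> gint n}, (\sum_i gmag (z i) <= n)%N &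
    forall i, rnd B i = h * gval (z i).
Proof.
move=> sn; pose a i := (rfloor i + B i)%N.
have an i : (a i <= n)%N by apply: leq_trans sn; rewrite (bigD1 i)//= leq_addr.
(* A zero of [u] has to be sent to [None] separately: its bit may be set, while [rnd] vanishes there
   through the sign. *)
pose z := [ffun i => (if u i == 0 then None else
   if insub (a i).-1 is Some k then (if a i == 0%N then None else Some (k, u i < 0))
   else None) : gint n].
have zE i : u i != 0 -> z i = if a i == 0%N then None else
    omap (fun k : 'I_n => (k, u i < 0)) (insub (a i).-1).
  move=> ui; rewrite ffunE (negbTE ui); case: insubP => [k _ _|] /=; first by case: ifP.
  by case: ifP.
have zS i : gmag (z i) = if u i == 0 then 0%N else a i.
  case: (eqVneq (u i) 0) => [ui|ui]; first by rewrite ffunE ui eqxx.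
  rewrite zE//; case: (a i) (an i) => [|k] //= kn.
  by rewrite insubT.
exists z => [|i].
  apply: leq_trans sn; apply: leq_sum => i _; rewrite zS; by case: ifP.
have [ui|ui] := eqVneq (u i) 0.
  by rewrite /rnd ui sgr0 !mul0r ffunE ui eqxx mulr0.
rewrite zE// /rnd -natrD -/(a i) [_ * h]mulrC -mulrA; congr (_ * _).
case: (a i) (an i) => [|k] /= kn; first by rewrite mulr0.
by rewrite insubT /= neqr0_sign.
Qed.

End Round.
End Rounding.

(** * Norms of finite families *)

Section Norms.
Context {R : realType}.

Definition n1 (I : finType) (v : I -> R) : R := \sum_i `|v i|.
Definition n2 (I : finType) (v : I -> R) : R := Num.sqrt (\sum_i v i ^+ 2).

Section Vectors.
Variable I : finType.
Implicit Types u v : I -> R.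

Lemma sum_sqr_ge0 v : 0 <= \sum_i v i ^+ 2.
Proof. by apply: sumr_ge0 => i _; exact: sqr_ge0. Qed.

Lemma n1_ge0 v : 0 <= n1 v.
Proof. by apply: sumr_ge0 => i _; exact: normr_ge0. Qed.

Lemma n2_ge0 v : 0 <= n2 v.
Proof. exact: sqrtr_ge0. Qed.

Lemma n2_sqr v : n2 v ^+ 2 = \sum_i v i ^+ 2.
Proof. by rewrite sqr_sqrtr// sum_sqr_ge0. Qed.

Lemma eq_n1 u v : u =1 v -> n1 u = n1 v.
Proof. by move=> uv; apply: eq_bigr => i _; rewrite uv. Qed.

Lemma eq_n2 u v : u =1 v -> n2 u = n2 v.
Proof. by move=> uv; congr Num.sqrt; apply: eq_bigr => i _; rewrite uv. Qed.

Lemma n1D u v : n1 (fun i => u i + v i) <= n1 u + n1 v.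
Proof. by rewrite /n1 -big_split; apply: ler_sum => i _; exact: ler_normD. Qed.

Lemma n1N v : n1 (fun i => - v i) = n1 v.
Proof. by apply: eq_bigr => i _; rewrite normrN. Qed.

Lemma n2N v : n2 (fun i => - v i) = n2 v.
Proof. by congr Num.sqrt; apply: eq_bigr => i _; rewrite sqrrN. Qed.

Lemma n2Z c v : n2 (fun i => c * v i) = `|c| * n2 v.
Proof.
rewrite /n2 -sqrtr_sqr -sqrtrM ?sqr_ge0//; congr Num.sqrt.
by rewrite mulr_sumr; apply: eq_bigr => i _; rewrite exprMn.
Qed.

Lemma n2_eq0 v : n2 v = 0 -> forall i, v i = 0.
Proof.
move=> v0 i; have := n2_sqr v; rewrite v0 expr0n /= => /esym e.
have /eqP := @psumr_eq0P _ _ _ _ (fun i _ => sqr_ge0 (v i)) e i isT.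
by rewrite sqrf_eq0 => /eqP.
Qed.

Lemma dot_sqr_le u v : (\sum_i u i * v i) ^+ 2 <= (\sum_i u i ^+ 2) * \sum_i v i ^+ 2.
Proof.
have key x y : \sum_i (y * u i - x * v i) ^+ 2 =
    y ^+ 2 * (\sum_i u i ^+ 2) - 2 * y * x * (\sum_i u i * v i) + x ^+ 2 * \sum_i v i ^+ 2.
  by rewrite !mulr_sumr -sumrB -big_split; apply: eq_bigr => i _ /=; ring.
set c := \sum_i u i * v i; set a := \sum_i u i ^+ 2; set b := \sum_i v i ^+ 2.
have b0 : 0 <= b := sum_sqr_ge0 v.
have : 0 <= \sum_i (b * u i - c * v i) ^+ 2 by exact: sum_sqr_ge0.
rewrite key -/a -/b -/c.
have -> : b ^+ 2 * a - 2 * b * c * c + c ^+ 2 * b = b * (a * b - c ^+ 2) by ring.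
have [bp|] := ltP 0 b; first by rewrite pmulr_rge0// subr_ge0.
move=> b0' _; have /eqP e : b == 0 by rewrite eq_le b0 b0'.
have vi i : v i = 0.
  have /eqP := @psumr_eq0P _ _ _ _ (fun i _ => sqr_ge0 (v i)) e i isT.
  by rewrite sqrf_eq0 => /eqP.
have -> : c = 0 by rewrite /c big1// => i _; rewrite vi mulr0.
by rewrite expr0n mulr_ge0// sum_sqr_ge0.
Qed.

Lemma dot_le u v : \sum_i u i * v i <= n2 u * n2 v.
Proof.
rewrite /n2 -sqrtrM ?sum_sqr_ge0//.
by apply: le_trans (ler_norm _) _; rewrite -sqrtr_sqr ler_wsqrtr// dot_sqr_le.
Qed.

Lemma n2D u v : n2 (fun i => u i + v i) <= n2 u + n2 v.
Proof.
rewrite -(@ler_pXn2r _ 2)// ?nnegrE ?n2_ge0 ?addr_ge0 ?n2_ge0//.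
rewrite n2_sqr sqrrD !n2_sqr.
have -> : \sum_i (u i + v i) ^+ 2 =
    \sum_i u i ^+ 2 + 2 * (\sum_i u i * v i) + \sum_i v i ^+ 2.
  by rewrite mulr_sumr -!big_split; apply: eq_bigr => i _ /=; ring.
have := dot_le u v; rewrite -mulr_natl; lra.
Qed.

Lemma n2B u v : n2 u <= n2 v + n2 (fun i => v i - u i).
Proof.
apply: le_trans (_ : n2 (fun i => v i + (- (v i - u i))) <= _).
  by apply: eq_lexx; apply: eq_n2 => i; ring.
by apply: le_trans (n2D _ _) _; rewrite n2N.
Qed.

Lemma n1_on_le (S : {set I}) v : \sum_(i in S) `|v i| <= Num.sqrt #|S|%:R * n2 v.
Proof.
have -> : \sum_(i in S) `|v i| = \sum_i (i \in S)%:R * `|v i|.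
  rewrite big_mkcond; apply: eq_bigr => i _.
  by case: (i \in S); rewrite ?mul1r ?mul0r.
apply: le_trans (dot_le _ _) _.
rewrite /n2 (eq_bigr (fun i => if i \in S then 1 else 0)).
  rewrite -big_mkcond sumr_const ler_wpM2l ?sqrtr_ge0//.
  by rewrite ler_wsqrtr// ler_sum// => i _; rewrite real_normK// num_real.
by move=> i _; case: (i \in S); rewrite ?expr1n ?expr0n.
Qed.

Lemma n1_le_n2 v : n1 v <= Num.sqrt #|I|%:R * n2 v.
Proof.
by have := n1_on_le [set: I] v; rewrite cardsT big_mkcond /=; under eq_bigr do rewrite inE.
Qed.

Lemma coord_le_n2 v i : `|v i| <= n2 v.
Proof.
rewrite -sqrtr_sqr ler_wsqrtr// (bigD1 i)//= lerDl.
by apply: sumr_ge0 => k _; exact: sqr_ge0.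
Qed.

End Vectors.
End Norms.

(** * Symmetric laws and tilting *)

Section SymmetricLaw.
Context {R : realType}.

(** What a discretised entry retains. The variance is only kept between 1/4 and 1 because truncation
    and rounding towards 0 decrease absolute values. *)
Record symlaw (V : finType) (p val : V -> R) (neg : V -> V) (k4 : R) : Prop := SymLaw {
  sl_ge0 : forall v, 0 <= p v;
  sl_sum1 : \sum_v p v = 1;
  sl_negK : involutive neg;
  sl_val : forall v, val (neg v) = - val v;
  sl_p : forall v, p (neg v) = p v;
  sl_m2_ge : 1 / 4 <= \sum_v p v * val v ^+ 2;
  sl_m2_le : \sum_v p v * val v ^+ 2 <= 1;
  sl_m4 : \sum_v p v * val v ^+ 4 <= k4;
  sl_k4 : 1 <= k4 }.

Section Law.
Variables (V : finType) (p val : V -> R) (neg : V -> V) (k4 : R).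
Hypothesis P : symlaw p val neg k4.

Lemma fdist_law (I : finType) : fdist (fun _ : I => p).
Proof. by split=> *; [exact: (sl_ge0 P)|exact: (sl_sum1 P)]. Qed.

Lemma odd_mean0 (f : V -> R) : (forall v, f (neg v) = - f v) -> \sum_v p v * f v = 0.
Proof.
move=> fo; have e : \sum_v p v * f v = - \sum_v p v * f v.
  rewrite {1}(reindex_inj (inv_inj (sl_negK P))) /= -sumrN.
  by apply: eq_bigr => v _; rewrite (sl_p P) fo mulrN.
lra.
Qed.

(** The correlation of an entry with its own sign: under the density [1 + a sg(val)] the mean of
    [val] becomes [a * beta]. *)
Definition beta : R := \sum_v p v * `|val v|.

Lemma beta_ge0 : 0 <= beta.
Proof. by apply: sumr_ge0 => v _; rewrite mulr_ge0// (sl_ge0 P). Qed.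

Lemma beta_sqr_le : beta ^+ 2 <= \sum_v p v * val v ^+ 2.
Proof.
have : 0 <= \sum_v p v * (`|val v| - beta) ^+ 2.
  by apply: sumr_ge0 => v _; rewrite mulr_ge0 ?sqr_ge0// (sl_ge0 P).
have key b : \sum_v p v * (`|val v| - b) ^+ 2 =
  \sum_v p v * val v ^+ 2 - 2 * b * (\sum_v p v * `|val v|) + b ^+ 2 * \sum_v p v.
  rewrite !mulr_sumr -sumrB -big_split; apply: eq_bigr => v _ /=.
  by rewrite -[val v ^+ 2]real_normK ?num_real//; ring.
rewrite key -/beta.
by rewrite (sl_sum1 P) -/beta; lra.
Qed.

Lemma beta_le1 : beta <= 1.
Proof. have := beta_sqr_le; have := sl_m2_le P; have := beta_ge0; nra. Qed.

(* From [x^2 <= t|x| + x^4/t^2] with [t = 4 k4]. *)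
Lemma beta_ge : (32 * k4)^-1 <= beta.
Proof.
have k1 := sl_k4 P; set t := 4 * k4.
have t0 : 0 < t by rewrite /t; lra.
have : \sum_v p v * val v ^+ 2 <= t * beta + (\sum_v p v * val v ^+ 4) / t ^+ 2.
  rewrite mulr_suml mulr_sumr -big_split; apply: ler_sum => v _ /=.
  have -> : t * (p v * `|val v|) + p v * val v ^+ 4 / t ^+ 2 =
     p v * (t * `|val v| + val v ^+ 4 / t ^+ 2) by ring.
  rewrite ler_wpM2l ?(sl_ge0 P)//.
  have -> : val v ^+ 4 = (`|val v| ^+ 2) ^+ 2 by rewrite real_normK ?num_real//; ring.
  rewrite -[val v ^+ 2]real_normK ?num_real//.
  have := normr_ge0 (val v); set x := `|val v| => x0.
  have [xt|tx] := leP x t.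
    have : 0 <= (x ^+ 2) ^+ 2 / t ^+ 2 by rewrite divr_ge0 ?sqr_ge0.
    nra.
  have : x ^+ 2 <= (x ^+ 2) ^+ 2 / t ^+ 2.
    rewrite ler_pdivlMr ?exprn_gt0// [leRHS]expr2 ler_wpM2l ?sqr_ge0//.
    by rewrite lerXn2r ?nnegrE//; lra.
  have : 0 <= t * x by rewrite mulr_ge0// ltW.
  lra.
have := sl_m2_ge P; set m2 := \sum_v p v * val v ^+ 2 => m2ge h.
have : (\sum_v p v * val v ^+ 4) / t ^+ 2 <= 1 / 16.
  rewrite ler_pdivrMr ?exprn_gt0//; apply: le_trans (sl_m4 P) _.
  by rewrite /t; nra.
move=> h2; have h3 : 1 / 8 <= t * beta by lra.
rewrite -[leLHS]mul1r ler_pdivrMr; last lra.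
by move: h3; rewrite /t; lra.
Qed.

Section Tilt.
Variables (m : nat) (theta a : 'I_m -> R) (C1 B : R).
Hypotheses (m0 : (0 < m)%N) (C11 : 1 <= C1) (aB : \sum_j a j ^+ 2 <= B).
Hypothesis atheta : forall j, 0 <= a j * theta j.
Definition utail (t : R) : R := \sum_(v | t <= val v) p v.
Hypothesis tail_ge : forall j, `|a j| <= 1 / 2 \/ expR (- (C1 * a j ^+ 2)) <= utail `|a j|.

(* Each coordinate is tilted towards the sign of [a j]: by a bounded density when [a j] is
   small, and by conditioning on [|a j| <= sg (a j) * val] otherwise. *)
Let small j := `|a j| <= 1 / 2.
Let inbig j v := `|a j| <= Num.sg (a j) * val v.
Let dn j v : R := if small j then 1 + a j * Num.sg (val v) else (inbig j v)%:R / utail `|a j|.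
Let pt j v := p v * dn j v.

Let bigP j : ~~ small j -> expR (- (C1 * a j ^+ 2)) <= utail `|a j| /\ a j != 0.
Proof.
move=> ns; have [h|h] := tail_ge j; first by rewrite /small h in ns.
by split=> //; apply: contraNN ns => /eqP h0; rewrite /small h0 normr0.
Qed.

Let utail_gt0 j : ~~ small j -> 0 < utail `|a j|.
Proof. by case/bigP => h _; apply: lt_le_trans h; exact: expR_gt0. Qed.

Let inbig_tail j : ~~ small j -> \sum_v p v * (inbig j v)%:R = utail `|a j|.
Proof.
case/bigP => _ aj; rewrite /utail.
rewrite [RHS]big_mkcond /=.
have [ap|an] : 0 < a j \/ a j < 0 by case: (ltgtP (a j) 0) aj => //; [right|left].
  apply: eq_bigr => v _; rewrite /inbig gtr0_sg// mul1r.
  by case: ifP; rewrite ?mulr1 ?mulr0.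
rewrite (reindex_inj (inv_inj (sl_negK P))) /=; apply: eq_bigr => v _.
rewrite /inbig ltr0_sg// mulN1r (sl_val P) opprK (sl_p P).
by case: ifP; rewrite ?mulr1 ?mulr0.
Qed.

Let sg_odd v : Num.sg (val (neg v)) = - Num.sg (val v).
Proof. by rewrite (sl_val P) sgrN. Qed.

Let dn_ge0 j v : 0 <= dn j v.
Proof.
rewrite /dn; case: ifPn => [s|/utail_gt0 h]; last by rewrite divr_ge0// ltW.
have : `|a j * Num.sg (val v)| <= 1 / 2.
  rewrite normrM; apply: le_trans s; rewrite ler_piMr// normr_sg.
  by case: (val v != 0).
by rewrite ler_norml; lra.
Qed.

Let pt_dist : fdist pt.
Proof.
split=> [j v|j]; first by rewrite mulr_ge0// (sl_ge0 P).
rewrite /pt; have [s|b] := boolP (small j).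
  under eq_bigr do rewrite /dn s mulrDr mulr1.
  rewrite big_split /= (sl_sum1 P) odd_mean0 ?addr0// => v.
  by rewrite sg_odd mulrN.
under eq_bigr do rewrite /dn (negbTE b) mulrA.
by rewrite -mulr_suml inbig_tail// mulfV// gt_eqF// utail_gt0.
Qed.

Let m2 := \sum_v p v * val v ^+ 2.

Let E_small j (f : V -> R) : small j -> \sum_v pt j v * f v =
   \sum_v p v * f v + a j * \sum_v p v * (Num.sg (val v) * f v).
Proof.
move=> s; rewrite mulr_sumr -big_split; apply: eq_bigr => v _ /=.
by rewrite /pt /dn s; ring.
Qed.

(** The centred fluctuation of [val * theta] under the tilted law. A conditioned coordinate
    contributes none, since conditioning already forces [val * theta] to be at least [a * theta]. *)
Let y j v : R := if small j then theta j * (val v - beta * a j) else 0.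

Let sgE v : Num.sg (val v) * val v = `|val v|. Proof. by rewrite -normrEsg. Qed.

Let y_mean j : \sum_v pt j v * y j v = 0.
Proof.
have [s|/negbTE s] := boolP (small j); last by rewrite big1// => v _; rewrite /y s mulr0.
rewrite E_small//.
under eq_bigr do rewrite /y s.
under [X in _ + _ * X]eq_bigr do rewrite /y s.
have e1 : \sum_v p v * (theta j * (val v - beta * a j)) = - theta j * beta * a j.
  rewrite (eq_bigr (fun v => theta j * (p v * val v) - (theta j * beta * a j) * p v)).
    rewrite sumrB -!mulr_sumr (sl_sum1 P) (@odd_mean0 val (sl_val P)).
    by ring.
  by move=> v _; ring.
have e2 : \sum_v p v * (Num.sg (val v) * (theta j * (val v - beta * a j))) = theta j * beta.
  rewrite (eq_bigr (fun v => theta j * (p v * `|val v|) -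
     (theta j * beta * a j) * (p v * Num.sg (val v)))).
    rewrite sumrB -!mulr_sumr -/beta odd_mean0 ?mulr0 ?subr0//.
  by move=> v _; rewrite -sgE; ring.
by rewrite e1 e2; ring.
Qed.

Let y_m2 j : small j -> \sum_v pt j v * y j v ^+ 2 = theta j ^+ 2 * (m2 - beta ^+ 2 * a j ^+ 2).
Proof.
move=> s; rewrite E_small//.
under eq_bigr do rewrite /y s.
under [X in _ + _ * X]eq_bigr do rewrite /y s.
have e1 : \sum_v p v * (theta j * (val v - beta * a j)) ^+ 2 =
    theta j ^+ 2 * (m2 + beta ^+ 2 * a j ^+ 2).
  rewrite (eq_bigr (fun v => theta j ^+ 2 * (p v * val v ^+ 2) +
     (theta j ^+ 2 * beta ^+ 2 * a j ^+ 2) * p v - 2 * theta j ^+ 2 * beta * a j * (p v * val v))).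
    rewrite sumrB big_split /= -!mulr_sumr (sl_sum1 P) (@odd_mean0 val (sl_val P)).
    by rewrite -/m2; ring.
  by move=> v _; ring.
have e2 : \sum_v p v * (Num.sg (val v) * (theta j * (val v - beta * a j)) ^+ 2) =
    - 2 * theta j ^+ 2 * beta ^+ 2 * a j.
  rewrite (eq_bigr (fun v => theta j ^+ 2 * (p v * (Num.sg (val v) * (val v ^+ 2 + beta ^+ 2 * a j ^+ 2)))
     - (2 * theta j ^+ 2 * beta * a j) * (p v * `|val v|))).
    rewrite sumrB -!mulr_sumr -/beta odd_mean0 ?mulr0.
      by ring.
    by move=> v; rewrite sg_odd (sl_val P) sqrrN mulNr.
  by move=> v _; rewrite -sgE; ring.
by rewrite e1 e2; ring.
Qed.

Let a_sqr j : small j -> a j ^+ 2 <= 1 / 4.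
Proof.
rewrite /small => h; rewrite -[a j ^+ 2]real_normK ?num_real//.
have := normr_ge0 (a j); nra.
Qed.

(** Since [beta ^+ 2 <= m2] and [a j ^+ 2 <= 1/4], the variance factor is at least [(3/4) m2], and
    [m2 >= 1/4]. *)
Let y_m2_ge j : small j -> 3 / 16 * theta j ^+ 2 <= \sum_v pt j v * y j v ^+ 2.
Proof.
move=> s; rewrite y_m2// mulrC ler_wpM2l ?sqr_ge0//.
have := beta_sqr_le; have := a_sqr s; have := sl_m2_ge P; rewrite -/m2.
have := sqr_ge0 beta; have := sqr_ge0 (a j); nra.
Qed.

Let y_m4_le j : small j -> \sum_v pt j v * y j v ^+ 4 <= 8 * (k4 + 1) * theta j ^+ 4.
Proof.
move=> s; apply: (@le_trans _ _ (\sum_v pt j v * (8 * theta j ^+ 4 * (val v ^+ 4 + 1)))).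
  apply: ler_sum => v _; rewrite ler_wpM2l ?(pt_dist.1)// /y s.
  have -> : 8 * theta j ^+ 4 * (val v ^+ 4 + 1) = theta j ^+ 4 * (8 * (val v ^+ 4 + 1)) by ring.
  rewrite exprMn ler_wpM2l//.
    exact: exprn_even_ge0.
  have : (beta * a j) ^+ 2 <= 1.
    rewrite exprMn; have := a_sqr s; have := beta_le1; have := beta_ge0.
    by have := sqr_ge0 (a j); nra.
  set t := beta * a j; set x := val v => t1.
  have : (x - t) ^+ 2 <= 2 * x ^+ 2 + 2 * t ^+ 2 by have := sqr_ge0 (x + t); lra.
  have -> : (x - t) ^+ 4 = ((x - t) ^+ 2) ^+ 2 by ring.
  have -> : x ^+ 4 = (x ^+ 2) ^+ 2 by ring.
  have := sqr_ge0 (x - t); have := sqr_ge0 x; have := sqr_ge0 t.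
  set X := (x - t) ^+ 2; set Y := x ^+ 2; set Z := t ^+ 2 in t1 *.
  move=> Z0 Y0 X0 h.
  have : X ^+ 2 <= (2 * Y + 2) ^+ 2 by rewrite lerXn2r ?nnegrE//; lra.
  have := sqr_ge0 (Y - 1); nra.
rewrite E_small// [X in _ + a j * X]odd_mean0 ?mulr0 ?addr0; last first.
  by move=> v; rewrite sg_odd (sl_val P) mulNr; congr (- (_ * (_ * (_ + _)))); ring.
rewrite (eq_bigr (fun v => 8 * theta j ^+ 4 * (p v * val v ^+ 4) + 8 * theta j ^+ 4 * p v)); last first.
  by move=> v _; ring.
rewrite big_split /= -!mulr_sumr (sl_sum1 P) mulr1.
have t4 : 0 <= 8 * theta j ^+ 4.
  by rewrite mulr_ge0// exprn_even_ge0.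
have := ler_wpM2l t4 (sl_m4 P); lra.
Qed.

(** A kurtosis bound for the tilted sum: 3 comes from the squared variance, the rest from the fourth
    moments, where 16/3 converts the sum of [theta j ^+ 2] over small coordinates into the variance.
    [c0] is the resulting probability of a nonnegative fluctuation. *)
Definition C4 : R := 3 + 8 * (k4 + 1) * (16 / 3) ^+ 2.
Definition c0 : R := (12 * C4 ^+ 2)^-1.

Lemma C4_ge2 : 2 <= C4.
Proof. by have := sl_k4 P; rewrite /C4; nra. Qed.

Lemma c0_gt0 : 0 < c0.
Proof.
have := C4_ge2; rewrite /c0 => h; rewrite invr_gt0 mulr_gt0// exprn_gt0//; lra.
Qed.

Lemma c0_le1 : c0 <= 1.
Proof.
have := C4_ge2; rewrite /c0 => h; rewrite invf_le1; first by nra.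
by rewrite mulr_gt0// exprn_gt0//; lra.
Qed.

Let Y (x : {ffun 'I_m -> V}) := \sum_j y j (x j).

Let Y_nonneg : c0 <= Pr pt (fun x => 0 <= Y x).
Proof.
pose v2 := \sum_j \sum_v pt j v * y j v ^+ 2.
have ge0 j : 0 <= \sum_v pt j v * y j v ^+ 2.
  by apply: sumr_ge0 => v _; rewrite mulr_ge0 ?sqr_ge0// (pt_dist.1).
have v20 : 0 <= v2 by apply: sumr_ge0 => j _.
have [v2p|v2n] := ltP 0 v2; last first.
  have /eqP ve : v2 == 0 by rewrite eq_le v20 v2n.
  have Y0 x : Y x = 0.
    apply: big1 => j _; rewrite /y; case: ifPn => // s.
    have h0 := @psumr_eq0P _ _ _ _ (fun j _ => ge0 j) ve j isT.
    have := y_m2_ge s; rewrite h0 => h.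
    have /eqP : theta j ^+ 2 == 0 by rewrite eq_le sqr_ge0 andbT; lra.
    by move/eqP; rewrite sqrf_eq0 => /eqP ->; rewrite mul0r.
  apply: le_trans c0_le1 _; rewrite -[leLHS](Ex_cst pt_dist 1); apply: Ex_le => // x.
  by rewrite Y0 lexx.
apply: (centered_nonneg_prob pt_dist v2p C4_ge2).
- by rewrite (Ex_sum_coord pt_dist y) big1// => j _; rewrite y_mean.
- exact: (Ex_sqr_centered pt_dist y_mean).
apply: le_trans (Ex_fourth_centered pt_dist y_mean) _; rewrite -/v2.
pose T := \sum_(j | small j) theta j ^+ 2.
have T0 : 0 <= T by apply: sumr_ge0 => j _; exact: sqr_ge0.
have T2 : \sum_(j | small j) theta j ^+ 4 <= T ^+ 2.
  rewrite expr2 /T mulr_suml; apply: ler_sum => j s.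
  have -> : theta j ^+ 4 = theta j ^+ 2 * theta j ^+ 2 by ring.
  rewrite ler_wpM2l ?sqr_ge0// (bigD1 j)//= lerDl.
  by apply: sumr_ge0 => k _; exact: sqr_ge0.
have vT : 3 / 16 * T <= v2.
  rewrite /T /v2 mulr_sumr [leLHS]big_mkcond /=; apply: ler_sum => j _.
  by case: ifP => // s; exact: y_m2_ge.
have y4 : \sum_j \sum_v pt j v * y j v ^+ 4 <= 8 * (k4 + 1) * T ^+ 2.
  have k0 : 0 <= 8 * (k4 + 1) by have := sl_k4 P; lra.
  apply: le_trans (ler_wpM2l k0 T2).
  rewrite mulr_sumr [leRHS]big_mkcond /=; apply: ler_sum => j _.
  case: ifPn => [s|/negbTE s]; first exact: y_m4_le.
  by rewrite big1// => v _; rewrite /y s expr0n mulr0.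
have TV : T <= 16 / 3 * v2 by lra.
have : T ^+ 2 <= (16 / 3 * v2) ^+ 2 by rewrite lerXn2r ?nnegrE//; lra.
rewrite exprMn => TV2.
have k0 : 0 <= 8 * (k4 + 1) by have := sl_k4 P; lra.
have := ler_wpM2l k0 TV2; rewrite /C4; lra.
Qed.

(** For a small coordinate the perturbation of the density is odd and leaves the second moment
    unchanged. For a conditioned one, Cauchy-Schwarz in arithmetic-geometric form yields [k4 / t],
    where [t] is a lower bound for the square root of the tail. *)
Let E_big_m2 j : \sum_v pt j v * val v ^+ 2 <= k4 * expR (C1 * B / 2).
Proof.
have k1 := sl_k4 P.
have aj : a j ^+ 2 <= B.
  apply: le_trans aB; rewrite (bigD1 j)//= lerDl.
  by apply: sumr_ge0 => k _; exact: sqr_ge0.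
have [s|b] := boolP (small j).
  rewrite E_small// [X in _ + a j * X]odd_mean0 => [|v]; last by rewrite sg_odd (sl_val P) sqrrN mulNr.
  rewrite mulr0 addr0; apply: le_trans (sl_m2_le P) _; rewrite -[leLHS]mul1r ler_pM//.
  have B0 : 0 <= B := le_trans (sqr_ge0 _) aj.
  by rewrite -[leLHS]expR0 ler_expR divr_ge0// mulr_ge0//; have := C11; lra.
have [hQ _] := bigP b; have Q0 := utail_gt0 b; set Q := utail _ in hQ Q0.
pose t := expR (- (C1 * a j ^+ 2 / 2)); have t0 : 0 < t := expR_gt0 _.
have ttQ : t * t <= Q by rewrite /t -expRD (_ : _ + _ = - (C1 * a j ^+ 2))//; lra.
apply: (@le_trans _ _ (k4 / t)); last first.
  rewrite ler_wpM2l; [|lra|]; rewrite // /t -expRN opprK ler_expR ler_pM2r// ler_wpM2l//; have := C11; lra.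
have : \sum_v pt j v * val v ^+ 2 <= Q^-1 * (t / 2 * \sum_v p v * val v ^+ 4) + t^-1 / 2.
  have -> : t^-1 / 2 = \sum_v (Q * t)^-1 / 2 * (p v * (inbig j v)%:R).
    by rewrite -mulr_sumr inbig_tail// -/Q; field; rewrite !gt_eqF.
  rewrite !mulr_sumr -big_split; apply: ler_sum => v _ /=.
  rewrite /pt /dn (negbTE b) -/Q.
  case: (inbig j v); rewrite /= ?mulr1 ?mulr0 ?mul0r ?mulr0 ?mul0r ?addr0; last first.
    apply: mulr_ge0; first by rewrite invr_ge0 ltW.
    apply: mulr_ge0; first by rewrite divr_ge0// ltW.
    by apply: mulr_ge0; [exact: (sl_ge0 P)|exact: exprn_even_ge0].
  have : 0 <= p v / Q * ((t * val v ^+ 2 - 1) ^+ 2 / (2 * t)).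
    apply: mulr_ge0; first by rewrite divr_ge0 ?(sl_ge0 P)// ltW.
    by rewrite divr_ge0 ?sqr_ge0// mulr_ge0// ltW.
  have -> : p v / Q * ((t * val v ^+ 2 - 1) ^+ 2 / (2 * t)) =
    (Q^-1 * (t / 2 * (p v * val v ^+ 4)) + (Q * t)^-1 / 2 * p v) - p v * (1 / Q) * val v ^+ 2.
    by field; rewrite !gt_eqF.
  by rewrite mul1r; lra.
move/le_trans; apply.
have h1 : t / Q <= t^-1 by rewrite ler_pdivrMr// mulrC -ler_pdivrMr ?invr_gt0// invrK.
have : Q^-1 * (t / 2 * \sum_v p v * val v ^+ 4) <= k4 * t^-1 / 2.
  have -> : Q^-1 * (t / 2 * \sum_v p v * val v ^+ 4) = (t / Q) * (\sum_v p v * val v ^+ 4) / 2 by ring.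
  rewrite ler_pM2r// mulrC ler_pM//.
  - apply: sumr_ge0 => v _; rewrite mulr_ge0 ?(sl_ge0 P)//.
    exact: exprn_even_ge0.
  - by rewrite divr_ge0// ltW.
  - exact: (sl_m4 P).
have : t^-1 <= k4 * t^-1 by rewrite ler_peMl// invr_ge0 ltW.
lra.
Qed.

(** The Markov threshold at which a long column has tilted probability at most [c0 / 2]. *)
Definition Lam : R := 2 / c0 * k4 * expR (C1 * B / 2).

(** Under the tilted law both requirements hold together with probability at least [c0 / 2], and the
    second moment of the density is at most [exp(C1 B)]; this transfers the bound to the original
    law. The length requirement later keeps the effect of rounding the direction small. *)
Lemma tilt_lower :
  (c0 / 2) ^+ 2 * expR (- (C1 * B)) <=
  Pr (fun _ : 'I_m => p) (fun x => (\sum_j val (x j) ^+ 2 <= Lam * m%:R) &&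
    (beta * \sum_j a j * theta j <= \sum_j val (x j) * theta j)).
Proof.
set ev := (fun x => _ && _).
have k1 := sl_k4 P; have cp := c0_gt0; have pd := fdist_law 'I_m.
have mp : 0 < m%:R :> R by rewrite ltr0n.
have k0 : 0 < k4 by lra.
have Lp : 0 < Lam.
  by rewrite /Lam mulr_gt0 ?expR_gt0// mulr_gt0// divr_gt0.
have bad : Pr pt (fun x => Lam * m%:R < \sum_j val (x j) ^+ 2) <= c0 / 2.
  have e : Ex pt (fun x => \sum_j val (x j) ^+ 2) = \sum_j \sum_v pt j v * val v ^+ 2.
    exact: (Ex_sum_coord pt_dist (fun _ v => val v ^+ 2)).
  have LM : 0 < Lam * m%:R by rewrite mulr_gt0.
  have := @markov_Pr _ _ _ pt pt_dist (fun x => \sum_j val (x j) ^+ 2) _ LM.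
  have f0 (x : {ffun 'I_m -> V}) : 0 <= \sum_j val (x j) ^+ 2.
    by apply: sumr_ge0 => j _; exact: sqr_ge0.
  move=> /(_ f0) /le_trans; apply; rewrite e ler_pdivrMr//.
  apply: (@le_trans _ _ (\sum_(j < m) k4 * expR (C1 * B / 2))).
    by apply: ler_sum => j _; exact: E_big_m2.
  rewrite sumr_const card_ord -[leLHS]mulr_natr /Lam; apply: eq_lexx.
  by field; rewrite gt_eqF.
have p_ev : c0 / 2 <= Pr pt ev.
  suff : Pr pt (fun x => 0 <= Y x) <= Pr pt (fun x => Lam * m%:R < \sum_j val (x j) ^+ 2) + Pr pt ev.
    have := Y_nonneg; lra.
  rewrite /Pr -ExD; apply: ler_sum => x _.
  (* The inequality for conditioned coordinates holds only on the conditioning event, so points of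
     zero tilted weight are discarded beforehand. *)
  have [pz|pz] := boolP [exists j, pt j (x j) == 0].
    have [j /eqP pj] := existsP pz.
    by rewrite (bigD1 j)//= pj !mul0r.
  rewrite negb_exists in pz; have {}pz j : pt j (x j) != 0 by exact: (forallP pz).
  apply: ler_wpM2l; first exact: (Ex_weight_ge0 pt_dist).
  have [Yx|Yx] := leP 0 (Y x); last by rewrite addr_ge0 ?ler0n.
  rewrite /ev; case: (leP (\sum_j val (x j) ^+ 2) _) => /= g; last by rewrite lerDl ler0n.
  rewrite add0r; suff -> : beta * (\sum_j a j * theta j) <= \sum_j val (x j) * theta j by [].
  suff h : Y x <= \sum_j val (x j) * theta j - beta * (\sum_j a j * theta j) by lra.
  rewrite mulr_sumr -sumrB; apply: ler_sum => j _.
  rewrite /y; case: ifPn => s.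
    by apply: eq_lexx; ring.
  have := pz j; rewrite /pt /dn (negbTE s).
  case: (boolP (inbig j (x j))) => [ib _|_]; last by rewrite mul0r mulr0 eqxx.
  have h1 : a j * theta j <= val (x j) * theta j.
    move: ib; rewrite /inbig; have [_ aj] := bigP s; have := atheta j.
    have [ap|an] : 0 < a j \/ a j < 0 by case: (ltgtP (a j) 0) aj => //; [right|left].
      by rewrite pmulr_rge0// gtr0_sg// mul1r gtr0_norm// => *; rewrite ler_wpM2r.
    rewrite nmulr_rge0// ltr0_sg// mulN1r ltr0_norm// lerN2 => *.
    by rewrite ler_wnM2r.
  have : beta * (a j * theta j) <= a j * theta j by rewrite ler_piMl ?beta_le1.
  lra.
(* A small coordinate contributes at most [1 + a^2], a conditioned one the inverse of its tail; both
   are at most [exp(C1 a^2)]. *)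
have E2 : Ex (fun _ : 'I_m => p) (fun x => \prod_j dn j (x j) ^+ 2) <= expR (C1 * B).
  have -> : Ex (fun _ : 'I_m => p) (fun x => \prod_j dn j (x j) ^+ 2) =
      \prod_j \sum_v p v * dn j v ^+ 2.
    exact: (Ex_prod (fun _ => p) (fun j v => dn j v ^+ 2)).
  apply: (@le_trans _ _ (\prod_j expR (C1 * a j ^+ 2))); last first.
    by rewrite -expR_sum ler_expR -mulr_sumr ler_wpM2l//; have := C11; lra.
  apply: ler_prod => j _; apply/andP; split.
    by apply: sumr_ge0 => v _; rewrite mulr_ge0 ?sqr_ge0 ?(sl_ge0 P).
  have [s|b] := boolP (small j).
    apply: le_trans (expR_ge1Dx _); rewrite /dn s.
    apply: (@le_trans _ _ (1 + a j ^+ 2)); last by rewrite lerD2l ler_peMl ?sqr_ge0//; have := C11; lra.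
    have -> : \sum_v p v * (1 + a j * Num.sg (val v)) ^+ 2 = 1 +
       a j ^+ 2 * (\sum_v p v * Num.sg (val v) ^+ 2) + 2 * a j * \sum_v p v * Num.sg (val v).
      by rewrite -[X in X + _ + _](sl_sum1 P) !mulr_sumr -!big_split; apply: eq_bigr => v _ /=; ring.
    rewrite [X in _ + 2 * a j * X]odd_mean0// mulr0 addr0 lerD2l ler_piMr ?sqr_ge0//.
    rewrite -(sl_sum1 P); apply: ler_sum => v _; rewrite ler_piMr ?(sl_ge0 P)//.
    by rewrite sqr_sg; case: (val v != 0).
  have [hQ _] := bigP b; have Q0 := utail_gt0 b; set Q := utail _ in hQ Q0.
  have -> : \sum_v p v * dn j v ^+ 2 = Q^-1.
    rewrite (eq_bigr (fun v => Q^-1 ^+ 2 * (p v * (inbig j v)%:R))).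
      by rewrite -mulr_sumr inbig_tail// -/Q; field; rewrite gt_eqF.
    move=> v _; rewrite /dn (negbTE b) -/Q.
    by case: (inbig j v); rewrite /= ?mul0r ?mulr0 ?expr0n ?mulr0//; ring.
  by rewrite -[leRHS]invrK lef_pV2 ?posrE ?invr_gt0 ?expR_gt0// -expRN.
(* Cauchy-Schwarz for the density, in AM-GM form. *)
have PE : Pr pt ev = Ex (fun _ => p) (fun x => (\prod_j dn j (x j)) * (ev x)%:R).
  by apply: eq_bigr => x _; rewrite big_split /= mulrA.
(* Chosen so that the density term equals [c0 / 4], half of the available [c0 / 2]. *)
pose t := 2 / c0 * expR (C1 * B).
have t0 : 0 < t by rewrite /t mulr_gt0 ?expR_gt0// divr_gt0.
have : Pr pt ev <= (2 * t)^-1 * expR (C1 * B) + t / 2 * Pr (fun _ => p) ev.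
  apply: le_trans (_ : (2 * t)^-1 * Ex (fun _ : 'I_m => p) (fun x => \prod_j dn j (x j) ^+ 2)
    + t / 2 * Pr (fun _ => p) ev <= _); last first.
    by rewrite lerD2r ler_wpM2l// invr_ge0 mulr_ge0// ltW.
  rewrite PE -!ExZ -ExD; apply: Ex_le => // x; rewrite prodrXl.
  set D := \prod_j _; case: (ev x); rewrite /= ?mulr1 ?mulr0 ?addr0; last first.
    by rewrite mulr_ge0 ?sqr_ge0// invr_ge0 mulr_ge0// ltW.
  have : 0 <= (D - t) ^+ 2 / (2 * t) by rewrite divr_ge0 ?sqr_ge0// mulr_ge0// ltW.
  have -> : (D - t) ^+ 2 / (2 * t) = (2 * t)^-1 * D ^+ 2 + t / 2 - D by field; rewrite gt_eqF.
  lra.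
have -> : (2 * t)^-1 * expR (C1 * B) = c0 / 4.
  by rewrite /t; field; rewrite !gt_eqF ?expR_gt0.
move=> h; have h2 : c0 / 4 <= t / 2 * Pr (fun _ => p) ev by lra.
rewrite expRN ler_pdivrMr ?expR_gt0//.
have := ler_wpM2r (ltW cp) h2.
have -> : t / 2 * Pr (fun _ => p) ev * c0 = Pr (fun _ => p) ev * expR (C1 * B).
  by rewrite /t; field; rewrite gt_eqF.
lra.
Qed.

End Tilt.
End Law.
End SymmetricLaw.

(** * The quotient property *)

Section Quotient.
Open Scope classical_set_scope.
Open Scope ring_scope.
Context {R : realType}.

(** [W] is not assumed closed, so the supremum is replaced by a point reaching half of it. Giving
    its coordinates the signs of [theta] keeps it in [W] and provides the sign condition required
    for tilting. *)
Lemma near_maximizer (m : nat) (W : ('I_m -> R) -> Prop) (theta : 'I_m -> R) :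
  W (fun=> 0) -> (forall w, W w -> n2 w <= 1) ->
  (forall w, W w -> W (fun j => Num.sg (theta j) * `|w j|)) ->
  exists w, [/\ W w, forall j, 0 <= w j * theta j &
    forall w', W w' -> \sum_j theta j * w' j <= 2 * \sum_j theta j * w j].
Proof.
move=> W0 W1 Wsg.
pose S := [set \sum_j theta j * w j | w in W].
have S0 : S !=set0 by exists (\sum_j theta j * 0), (fun=> 0).
have Sle x : S x -> x <= n2 theta.
  move=> [w Ww <-]; apply: le_trans (dot_le _ _) _.
  by rewrite ler_piMr ?n2_ge0// W1.
have Sub : has_ubound S by exists (n2 theta); exact: Sle.
have Ssup : has_sup S by split.
have inS w : W w -> S (\sum_j theta j * w j) by exists w.
have s_ge0 : 0 <= sup S.
  have := ub_le_sup Sub (inS _ W0).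
  by under eq_bigr do rewrite mulr0; rewrite sumr_const mul0rn.
suff [w Ww ww] : exists2 w, W w & sup S <= 2 * \sum_j theta j * w j.
  exists (fun j => Num.sg (theta j) * `|w j|); split; first exact: Wsg.
    by move=> j; rewrite mulrAC -normrEsg mulr_ge0.
  move=> w' Ww'; apply: le_trans (ub_le_sup Sub (inS _ Ww')) _.
  apply: le_trans ww _; rewrite ler_pM2l//; apply: ler_sum => j _.
  by rewrite [leRHS]mulrA [theta j * Num.sg _]mulrC -normrEsg -normrM ler_norm.
have [s0|sp] := leP (sup S) 0.
  by exists (fun=> 0) => //; under eq_bigr do rewrite mulr0; rewrite sumr_const mul0rn mulr0.
have s2 : 0 < sup S / 2 by lra.
have [_ [w Ww <-] h] := sup_adherent s2 Ssup.
by exists w => //; lra.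
Qed.

Definition swapK (m N : nat) (ij : 'I_N * 'I_m) : 'I_m * 'I_N := (ij.2, ij.1).

Lemma swapK_bij (m N : nat) : bijective (@swapK m N).
Proof. by exists (fun ij => (ij.2, ij.1)) => -[]. Qed.

Section Law.
Variables (V : finType) (p val : V -> R) (neg : V -> V) (k4 : R).
Hypothesis P : symlaw p val neg k4.
Variables (m N : nat) (c C1 L : R) (W : ('I_m -> R) -> Prop).
Hypotheses (m0 : (0 < m)%N) (L1 : 1 <= L) (LN : expR L * m%:R = expR 1 * N%:R).
Hypotheses (c0p : 0 < c) (C11 : 1 <= C1) (cC1 : C1 * c ^+ 2 <= 1 / 4).
Hypothesis W_n2 : forall w, W w -> n2 w <= 1.
Hypothesis W_small : forall w, n2 w <= (Num.sqrt L)^-1 -> W w.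
Hypothesis W_sg : forall (th w : 'I_m -> R), W w -> W (fun j => Num.sg (th j) * `|w j|).
Hypothesis W_tail : forall w j, W w -> `|c * Num.sqrt L * w j| <= 1 / 2 \/
  expR (- (C1 * (c * Num.sqrt L * w j) ^+ 2)) <= utail p val `|c * Num.sqrt L * w j|.

Let e0 := c0 k4.
Let c5 := c / (32 * k4).
(* Beyond this value of [Y = (eN/m)^(1/8)] the factors polynomial in [Y] absorb the constants. *)
Definition Y0 : R :=
   (4 * 32) + (12 * 32) / c0 k4 ^+ 2 + (3 * 32 * 32) * k4 / (c0 k4 ^+ 3 * (c / (32 * k4)) ^+ 2).
(** All sizes are powers of [Y]: a column is useful with probability of order [Y^-2], [N] is at
    least [m Y^8 / 4], and the grid of directions has logarithmic size of order [m Y^2]. The [m Y^6]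
    useful columns to be expected dominate. *)
Let Y := expR (L / 8).
Hypothesis YY0 : Y0 <= Y.

Definition quotient_prop (M : {ffun 'I_m * 'I_N -> V}) : Prop :=
  forall (y w : 'I_m -> R) (B : R), W w ->
  (forall i, `|\sum_j val (M (j, i)) * y j| <= B) ->
  \sum_j y j * w j <= (4 * 32) * k4 / c / Num.sqrt L * B.

Let q1 := (e0 / 2) ^+ 2 / Y ^+ 2.
Let Lam1 := 2 / e0 * k4 * Y.

Let k40 : 0 < k4. Proof. by have := sl_k4 P; lra. Qed.
Let e0p : 0 < e0. Proof. exact: c0_gt0 P. Qed.
Let c5p : 0 < c5. Proof. by rewrite /c5 divr_gt0// mulr_gt0. Qed.
Let Y_gt0 : 0 < Y. Proof. exact: expR_gt0. Qed.
Let Lp : 0 < L. Proof. by have := L1; lra. Qed.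
Let sLp : 0 < Num.sqrt L. Proof. by rewrite sqrtr_gt0. Qed.
Let k4_ge0 : 0 <= k4 := ltW k40.
Let e0_ge0 : 0 <= e0 := ltW e0p.
Let c_ge0 : 0 <= c := ltW c0p.
Let c5_ge0 : 0 <= c5 := ltW c5p.
Let Y_ge0 : 0 <= Y := ltW Y_gt0.
Let sLE : Num.sqrt L ^+ 2 = L. Proof. by rewrite sqr_sqrtr// ltW. Qed.

Let Y_bounds : [/\ (4 * 32) <= Y, (12 * 32) <= e0 ^+ 2 * Y & (3 * 32 * 32) * k4 <= e0 ^+ 3 * c5 ^+ 2 * Y].
Proof.
have h1 : 0 <= (12 * 32) / c0 k4 ^+ 2 by rewrite divr_ge0 ?sqr_ge0 ?mulr_ge0 ?ler0n.
have h2 : 0 <= (3 * 32 * 32) * k4 / (c0 k4 ^+ 3 * (c / (32 * k4)) ^+ 2).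
  apply: divr_ge0; first by rewrite mulr_ge0 ?mulr_ge0 ?ler0n// ltW.
  by rewrite mulr_ge0 ?sqr_ge0// exprn_ge0// ltW.
have h := YY0; rewrite /Y0 in h; split; first by lra.
  by rewrite [leRHS]mulrC -ler_pdivrMr ?exprn_gt0// /e0; lra.
rewrite [leRHS]mulrC -ler_pdivrMr; first by rewrite /e0 /c5; lra.
by rewrite mulr_gt0// exprn_gt0.
Qed.

Let c5_le : c5 <= c * beta p val.
Proof. by rewrite /c5 ler_wpM2l ?(beta_ge P)// ltW. Qed.

Let colev (theta w : 'I_m -> R) (x : {ffun 'I_m -> V}) : bool :=
  (\sum_j val (x j) ^+ 2 <= Lam1 * m%:R) &&
  (c5 * Num.sqrt L * (\sum_j theta j * w j) <= \sum_j val (x j) * theta j).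

(** With [a = c sqrt(L) w] the total squared tilt is at most [c^2 L], so the cost [exp(C1 c^2 L)]
    stays below [exp(L/4) = Y^2]. *)
Let colev_prob theta w : W w -> (forall j, 0 <= w j * theta j) ->
  q1 <= Pr (fun _ : 'I_m => p) (colev theta w).
Proof.
move=> Ww wt; pose a j := c * Num.sqrt L * w j.
have cs0 : 0 <= c * Num.sqrt L by rewrite mulr_ge0 ?ltW.
have aB : \sum_j a j ^+ 2 <= c ^+ 2 * L.
  rewrite (eq_bigr (fun j => c ^+ 2 * L * w j ^+ 2)) => [|j _]; last by rewrite /a !exprMn sLE.
  rewrite -mulr_sumr -n2_sqr; apply: ler_piMr; first by rewrite mulr_ge0 ?sqr_ge0// ltW.
  by rewrite expr_le1 ?n2_ge0// W_n2.
have at0 j : 0 <= a j * theta j by rewrite /a -mulrA mulr_ge0.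
have := tilt_lower P m0 C11 aB at0 (fun j => W_tail j Ww).
have cL : C1 * (c ^+ 2 * L) <= L / 4.
  by rewrite mulrA mulrC [L / 4]mulrC mulrC ler_pM2r// -[4^-1]mul1r.
have Y2 : Y ^+ 2 = expR (L / 4) by rewrite expr2 -expRD; congr expR; lra.
move=> h; apply: le_trans (le_trans _ h) _.
  rewrite /q1 ler_wpM2l ?sqr_ge0// Y2 -expRN ler_expR; lra.
apply: (Pr_le (fdist_law P _)) => x /andP[g s]; apply/andP; split.
  apply: le_trans g _; rewrite ler_pM2r ?ltr0n// /Lam /Lam1.
  apply: ler_wpM2l; first by rewrite mulr_ge0 ?divr_ge0.
  by rewrite ler_expR; lra.
apply: le_trans s.
have -> : \sum_j a j * theta j = c * Num.sqrt L * \sum_j theta j * w j.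
  by rewrite mulr_sumr; apply: eq_bigr => j _; rewrite /a; ring.
have cb := c5_le; set b := beta p val in cb *; set S := \sum_j theta j * w j.
have -> : b * (c * Num.sqrt L * S) = c * b * Num.sqrt L * S by ring.
rewrite ler_wpM2r//; first by apply: sumr_ge0 => j _; rewrite mulrC.
by rewrite ler_wpM2r.
Qed.

(** A unit vector has l1-norm at most [sqrt(m)]; at mesh [1 / (Y^2 sqrt(m))] its floors sum to at
    most [m Y^2 <= m (K - 1)], and the bits add at most [m]. *)
Let K := (Num.truncn (Y ^+ 2)).+2.
Let n1g := (m * K)%N.

Let wz_ex (z : {ffun 'I_m -> gint n1g}) : exists w,
  [/\ W w, forall j, 0 <= w j * gval (z j) &
    forall w', W w' -> \sum_j gval (z j) * w' j <= 2 * \sum_j gval (z j) * w j].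
Proof.
apply: near_maximizer => // [|w]; last exact: W_sg.
by apply: W_small; rewrite /n2 big1 ?sqrtr0 ?invr_ge0// => j _; rewrite expr0n.
Qed.

Let wz z := sval (cid (wz_ex z)).
Let wzP z := svalP (cid (wz_ex z)).

Let gz (z : {ffun 'I_m -> gint n1g}) (j : 'I_m) : R := gval (z j).

(** A whole proportion of useful columns is demanded for each grid direction, not just one, to leave
    room for discarding those spoiled by rounding. *)
Let F4 (M : {ffun 'I_m * 'I_N -> V}) : bool :=
  [exists z : {ffun 'I_m -> gint n1g}, (\sum_j gmag (z j) <= n1g)%N &&
    (\sum_i (colev (gz z) (wz z) (blockf (@swapK m N) M i))%:R < q1 * #|'I_N|%:R / 4)].

Let mp : 0 < m%:R :> R. Proof. by rewrite ltr0n. Qed.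

Let e4 : expR 1 <= 4 :> R.
Proof.
have := @expR_ge1Dx R (- (1 / 2)); rewrite expRN => h.
have ep : 0 < expR (1 / 2) :> R := expR_gt0 _.
have : expR (1 / 2) <= 2 :> R.
  have : (1 - 1 / 2) * expR (1 / 2) <= (expR (1 / 2))^-1 * expR (1 / 2) :> R.
    by rewrite ler_wpM2r// ltW.
  by rewrite mulVf ?gt_eqF//; lra.
have -> : expR 1 = expR (1 / 2) * expR (1 / 2) :> R by rewrite -expRD; congr expR; lra.
by set x := expR _ in ep *; nra.
Qed.

Let NmY : m%:R * Y ^+ 8 <= 4 * N%:R.
Proof.
have -> : Y ^+ 8 = expR L by rewrite -expRM_natl; congr expR; lra.
by rewrite mulrC LN ler_wpM2r.
Qed.

Let Y21 : Y ^+ 2 <= K%:R - 1.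
Proof.
have /truncn_itv/andP[_ h] : 0 <= Y ^+ 2 by exact: sqr_ge0.
by rewrite /K -natr1 addrK ltW.
Qed.

Let K_le : K%:R <= Y ^+ 2 + 2.
Proof.
have /truncn_itv/andP[h _] : 0 <= Y ^+ 2 by exact: sqr_ge0.
by rewrite /K -addn2 natrD lerD2r.
Qed.

(** The grid has at most [exp(m (Y^2 + 4))] points, whereas the Chernoff exponent is at least
    [e0^2 m Y^6 / 64], which the lower bound on [Y] makes at least [6 m Y^2]. *)
Let F4_prob : Pr (fun _ : 'I_m * 'I_N => p) F4 <= expR (- m%:R).
Proof.
have [Y1 Y2 _] := Y_bounds.
apply: (@le_trans _ _ (#|[pred z : {ffun 'I_m -> gint n1g} | (\sum_j gmag (z j) <= n1g)%N]|%:R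
   * expR (- (q1 * N%:R / 4)))).
  apply: (Pr_exists_le (fdist_law P _)) => z _.
  rewrite -[X in expR (- (_ * X%:R / _))](card_ord N).
  have [W1 W2 _] := wzP z.
  exact: (@chernoff_lower _ _ _ _ _ (@swapK m N) (fun=> p) (swapK_bij m N) (fdist_law P _)
    (fun _ => colev (gz z) (wz z)) q1 (fun _ => colev_prob W1 W2)).
have h2 : 0 < 1 / 2 :> R by lra.
apply: (@le_trans _ _ ((1 / 2)^-1 ^+ n1g * expR (4 * (1 / 2) * #|'I_m|%:R) *
    expR (- (q1 * N%:R / 4)))).
  by rewrite ler_wpM2r ?expR_ge0// (grid_count _ _ h2).
have two : (1 / 2)^-1 <= expR 1 :> R.
  by have := @expR_ge1Dx R 1; rewrite mul1r invrK; lra.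
apply: (@le_trans _ _ (expR (n1g%:R) * expR (2 * m%:R) * expR (- (q1 * N%:R / 4)))).
  rewrite ler_wpM2r ?expR_ge0// card_ord; have -> : 4 * (1 / 2) = 2 :> R by lra.
  rewrite ler_wpM2r ?expR_ge0// -[n1g%:R]mulr1 expRM_natl.
  by rewrite lerXn2r ?nnegrE ?invr_ge0 ?expR_ge0//; lra.
rewrite -!expRD ler_expR /n1g natrM.
have mK := ler_wpM2l (ltW mp) K_le.
have qN : e0 ^+ 2 * Y ^+ 6 * m%:R / 64 <= q1 * N%:R / 4.
  rewrite /q1; have : m%:R * Y ^+ 8 / 4 <= N%:R by have := NmY; lra.
  have q0 : 0 <= (e0 / 2) ^+ 2 / Y ^+ 2 / 4 by rewrite divr_ge0 ?divr_ge0 ?sqr_ge0.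
  move=> /(ler_wpM2l q0).
  have -> : (e0 / 2) ^+ 2 / Y ^+ 2 / 4 * (m%:R * Y ^+ 8 / 4) = e0 ^+ 2 * Y ^+ 6 * m%:R / 64.
    by field; rewrite gt_eqF.
  by move/le_trans; apply; apply: eq_lexx; ring.
have key : 6 * Y ^+ 2 <= e0 ^+ 2 * Y ^+ 6 / 64.
  have -> : e0 ^+ 2 * Y ^+ 6 / 64 = Y ^+ 2 * (e0 ^+ 2 * Y * Y ^+ 3 / 64) by ring.
  rewrite mulrC ler_wpM2l ?sqr_ge0//.
  have : 1 <= Y ^+ 3 by apply: exprn_ege1; lra.
  have : 0 <= Y ^+ 3 by rewrite exprn_ge0// ltW.
  by move: Y2; set y2 := e0 ^+ 2 * Y; set y3 := Y ^+ 3; nra.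
have Ysq : 1 <= Y ^+ 2 by apply: exprn_ege1; lra.
have : m%:R * (6 * Y ^+ 2) <= m%:R * (e0 ^+ 2 * Y ^+ 6 / 64) by rewrite ler_wpM2l// ltW.
have : m%:R * 1 <= m%:R * Y ^+ 2 by rewrite ler_wpM2l// ltW.
lra.
Qed.

Let Np : 0 < N%:R :> R.
Proof. by have := NmY; have : 0 < m%:R * Y ^+ 8 by [rewrite mulr_gt0// exprn_gt0]; lra. Qed.

Let sm := Num.sqrt (m%:R : R).
Let smp : 0 < sm. Proof. by rewrite sqrtr_gt0. Qed.
Let sm_ge0 : 0 <= sm := ltW smp.
Let smE : sm ^+ 2 = m%:R. Proof. by rewrite sqr_sqrtr// ltW. Qed.
Let h := (Y ^+ 2 * sm)^-1.
Let hp : 0 < h. Proof. by rewrite invr_gt0 mulr_gt0// exprn_gt0. Qed.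
Let h_ge0 : 0 <= h := ltW hp.
Let hsm : h * sm = (Y ^+ 2)^-1.
Proof. by rewrite /h invfM -mulrA mulVf ?mulr1// gt_eqF. Qed.

Let sLY : (Y ^+ 2)^-1 <= (4 * Num.sqrt L)^-1.
Proof.
have [Y1 _ _] := Y_bounds.
rewrite lef_pV2 ?posrE ?exprn_gt0 ?mulr_gt0//.
rewrite -(@ler_pXn2r _ 2)// ?nnegrE ?mulr_ge0 ?sqr_ge0// exprMn sLE.
have := @expR_ge1Dx R (L / 8); rewrite -/Y => hL.
have Y3 : (4 * 32) <= Y ^+ 3.
  have : Y * 1 <= Y * Y ^+ 2.
    by apply: ler_wpM2l => //; apply: exprn_ege1; lra.
  by rewrite mulr1 -exprS; lra.
have : Y * (4 * 32) <= Y * Y ^+ 3 by rewrite ler_wpM2l// ltW.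
have -> : (Y ^+ 2) ^+ 2 = Y * Y ^+ 3 by ring.
lra.
Qed.

(** Rounding the direction has mean square error at most [Lam1 / Y^4], of order [Y^-3], in each
    short column, while the useful columns have density of order [Y^-2]. Hence one of them keeps its
    correlation with [wz z], and near-maximality of [wz z] makes this correlation comparable to any
    pairing with [W]. *)
Lemma unit_dual_bound M (y w : 'I_m -> R) : ~~ F4 M -> n2 y = 1 -> W w ->
  exists i, c5 / 4 * Num.sqrt L * (\sum_j y j * w j) <= `|\sum_j val (M (j, i)) * y j|.
Proof.
move=> nF y1 Ww; have [Yge _ Y3] := Y_bounds.
pose good i := \sum_j val (M (j, i)) ^+ 2 <= Lam1 * m%:R.
pose er (B : {ffun 'I_m -> bool}) i := \sum_j val (M (j, i)) * (rnd y h B j - y j).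
have [B BF] : exists B, \sum_(i | good i) er B i ^+ 2 <= N%:R * (Lam1 / Y ^+ 4).
  apply: (Ex_exists_le (fdist_rdist y hp)); rewrite Ex_sum.
  apply: (@le_trans _ _ (\sum_(i | good i) Lam1 / Y ^+ 4)); last first.
    rewrite sumr_const -[leLHS]mulr_natl ler_wpM2r//.
      by rewrite divr_ge0 ?exprn_ge0// /Lam1 mulr_ge0// mulr_ge0// divr_ge0.
    by rewrite ler_nat -[leqRHS]card_ord max_card.
  apply: ler_sum => i gi.
  apply: (@le_trans _ _ (Ex (rdist y h) (fun B => (\sum_j
      (val (M (j, i)) * Num.sg (y j) * h) * ((B j)%:R - rfrac y h j)) ^+ 2))).
    apply: Ex_le; first exact: fdist_rdist.
    move=> B; apply: eq_lexx; congr (_ ^+ 2).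
    by apply: eq_bigr => j _; rewrite rnd_err//; ring.
  apply: le_trans (@Ex_rdist_sqr R _ y h hp (fun j => val (M (j, i)) * Num.sg (y j) * h)) _.
  apply: (@le_trans _ _ (\sum_j h ^+ 2 * val (M (j, i)) ^+ 2)).
    apply: ler_sum => j _; have /andP[f0 f1] := rfrac_itv y hp j.
    have -> : (val (M (j, i)) * Num.sg (y j) * h) ^+ 2 =
      (h ^+ 2 * val (M (j, i)) ^+ 2) * Num.sg (y j) ^+ 2 by ring.
    have hv : 0 <= h ^+ 2 * val (M (j, i)) ^+ 2 by rewrite mulr_ge0 ?sqr_ge0.
    move: hv; set a := h ^+ 2 * _ ^+ 2 => hv; rewrite -mulrA ler_piMr// sqr_sg; case: (y j != 0); rewrite /= ?mul1r ?mul0r ?ler01//.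
  rewrite -mulr_sumr; apply: le_trans (ler_wpM2l (sqr_ge0 _) gi) _.
  have -> : h ^+ 2 = (Y ^+ 4 * m%:R)^-1 by rewrite /h exprVn exprMn smE -exprM.
  apply: eq_lexx; field.
  by rewrite !gt_eqF.
have yn1 : \sum_j `|y j| <= sm.
  have := n1_le_n2 y; rewrite y1 mulr1 card_ord; exact.
have [z zn zE] : exists2 z : {ffun 'I_m -> gint n1g}, (\sum_i gmag (z i) <= n1g)%N &
    forall i, rnd y h B i = h * gval (z i).
  apply: rnd_grid; rewrite big_split /=.
  have s1 : (\sum_i rfloor y h i <= m * K.-1)%N.
    apply: (rfloor_sum_le hp); apply: le_trans yn1 _.
    have -> : sm = sm * Y ^+ 2 * (h * sm).
      by rewrite hsm; field; rewrite gt_eqF.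
    rewrite natrM -smE (_ : sm ^+ 2 * K.-1%:R * h = sm * K.-1%:R * (h * sm)); last by ring.
    rewrite ler_wpM2r ?mulr_ge0// ler_wpM2l//.
    by have := Y21; rewrite /K /= -natr1 addrK.
  have s2 : (\sum_(i < m) (B i : nat) <= m)%N.
    apply: (@leq_trans (\sum_(i < m) 1)%N); last by rewrite sum1_card card_ord.
    by apply: leq_sum => i _; case: (B i).
  by rewrite /n1g /K /= (mulnS m (Num.truncn (Y ^+ 2)).+1) addnC leq_add.
(* Otherwise the useful columns alone would carry more than the total squared rounding error. *)
have [i [iE ier]] : exists i, colev (gz z) (wz z) (blockf (@swapK m N) M i) /\ `|er B i| < c5 / 8.
  apply: contrapT => /forallNP no.
  have no' i : colev (gz z) (wz z) (blockf (@swapK m N) M i) -> c5 / 8 <= `|er B i|.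
    by move=> ci; rewrite leNgt; apply/negP => lt; apply: (no i); split.
  have cnt : q1 * N%:R / 4 <= \sum_i (colev (gz z) (wz z) (blockf (@swapK m N) M i))%:R.
    rewrite leNgt; apply: contraNN nF => lt; apply/existsP; exists z.
    by rewrite zn card_ord.
  have : (c5 / 8) ^+ 2 * \sum_i (colev (gz z) (wz z) (blockf (@swapK m N) M i))%:R <=
      \sum_(i | good i) er B i ^+ 2.
    rewrite mulr_sumr [leRHS]big_mkcond /=; apply: ler_sum => i _.
    case: (boolP (colev _ _ _)) => ci /=; last by rewrite mulr0; case: ifP => // _; exact: sqr_ge0.
    have gi : good i.
      have /andP[+ _] := ci; rewrite /good; apply: le_trans.
      by apply: eq_lexx; apply: eq_bigr => j _; rewrite ffunE.
    rewrite gi mulr1 -[er B i ^+ 2]real_normK ?num_real//.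
    by rewrite lerXn2r ?nnegrE ?no'// divr_ge0// ltW.
  apply/negP; rewrite -ltNge; apply: le_lt_trans BF _.
  apply: (@lt_le_trans _ _ ((c5 / 8) ^+ 2 * (q1 * N%:R / 4))); last first.
    by rewrite ler_wpM2l ?sqr_ge0.
  have -> : (c5 / 8) ^+ 2 * (q1 * N%:R / 4) = N%:R * (c5 ^+ 2 * e0 ^+ 2 / ((32 * 32) * Y ^+ 2)).
    by rewrite /q1; field; rewrite gt_eqF.
  rewrite ltr_pM2l// /Lam1.
  have -> : 2 / e0 * k4 * Y / Y ^+ 4 = ((2 * 32 * 32) * k4) / ((32 * 32) * e0 * Y ^+ 3).
    by field; rewrite !gt_eqF.
  have -> : c5 ^+ 2 * e0 ^+ 2 / ((32 * 32) * Y ^+ 2) = (e0 ^+ 3 * c5 ^+ 2 * Y) / ((32 * 32) * e0 * Y ^+ 3).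
    by field; rewrite !gt_eqF.
  rewrite ltr_pM2r; first by have := k40; lra.
  by rewrite invr_gt0 !mulr_gt0// exprn_gt0.
exists i; have [Wz _ zmax] := wzP z.
have /andP[_] := iE.
have -> : \sum_j val (blockf (@swapK m N) M i j) * gz z j = \sum_j val (M (j, i)) * gz z j.
  by apply: eq_bigr => j _; rewrite ffunE.
move=> /(ler_wpM2l (ltW hp)) big_.
pose th := rnd y h B.
have thy : n2 (fun j => th j - y j) <= (4 * Num.sqrt L)^-1.
  apply: le_trans sLY; rewrite -hsm -[leRHS](@ger0_norm _ (h * sm)) ?mulr_ge0//.
  rewrite -sqrtr_sqr ler_wsqrtr// exprMn smE.
  apply: (@le_trans _ _ (\sum_(j < m) h ^+ 2)); last by rewrite sumr_const card_ord mulr_natr.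
  apply: ler_sum => j _; rewrite rnd_err//.
  have /andP[f0 f1] := rfrac_itv y hp j.
  have -> : (Num.sg (y j) * h * ((B j)%:R - rfrac y h j)) ^+ 2 =
     h ^+ 2 * (Num.sg (y j) ^+ 2 * ((B j)%:R - rfrac y h j) ^+ 2) by ring.
  rewrite ler_piMr ?sqr_ge0// mulr_ile1 ?sqr_ge0//.
    by rewrite sqr_sg; case: (y j != 0).
  by case: (B j) => /=; nra.
have dotW w' : W w' -> \sum_j y j * w' j - (4 * Num.sqrt L)^-1 <= \sum_j th j * w' j.
  move=> Ww'; rewrite lerBlDr.
  have -> : \sum_j y j * w' j = \sum_j th j * w' j + \sum_j (- (th j - y j)) * w' j.
    by rewrite -big_split; apply: eq_bigr => j _ /=; ring.
  rewrite lerD2l; apply: le_trans (dot_le _ _) _; rewrite n2N.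
  apply: le_trans thy; rewrite ler_piMr ?n2_ge0//; exact: W_n2.
have thz w' : \sum_j th j * w' j = h * \sum_j gz z j * w' j.
  by rewrite mulr_sumr; apply: eq_bigr => j _; rewrite /th zE mulrA.
have mx w' : W w' -> \sum_j th j * w' j <= 2 * (h * \sum_j gz z j * wz z j).
  move=> Ww'; rewrite thz mulrCA ler_wpM2l//; exact: zmax.
(* Since [y / sqrt(L)] lies in [W], the value [T] below is at least [3 / (8 sqrt(L))], which makes
   additive errors of order [1 / sqrt(L)] harmless. *)
pose w0 j := (Num.sqrt L)^-1 * y j.
have Ww0 : W w0.
  by apply: W_small; rewrite n2Z y1 mulr1 ger0_norm// invr_ge0 ltW.
have d0 : \sum_j y j * w0 j = (Num.sqrt L)^-1.
  rewrite /w0; under eq_bigr do rewrite mulrCA -expr2.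
  by rewrite -mulr_sumr -n2_sqr y1 expr1n mulr1.
have a1 := le_trans (dotW _ Ww0) (mx _ Ww0); rewrite d0 in a1.
have a2 := le_trans (dotW _ Ww) (mx _ Ww).
set T := h * \sum_j gz z j * wz z j in a1 a2.
set Dw := \sum_j y j * w j in a2 *.
have erE : \sum_j val (M (j, i)) * y j = h * (\sum_j val (M (j, i)) * gz z j) - er B i.
  by rewrite /er mulr_sumr -sumrB; apply: eq_bigr => j _; rewrite zE /gz; ring.
apply: le_trans (ler_norm _); rewrite erE.
have b2 : c5 * Num.sqrt L * T <= h * (\sum_j val (M (j, i)) * gz z j).
  by apply: le_trans big_; apply: eq_lexx; rewrite /T; ring.
have b3 : er B i <= c5 / 8 by apply: le_trans (ler_norm _) (ltW ier).
have iv : (4 * Num.sqrt L)^-1 = (Num.sqrt L)^-1 / 4 by rewrite invfM mulrC.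
rewrite iv in a1 a2.
have b4 : 1 = Num.sqrt L * (Num.sqrt L)^-1 by rewrite mulfV// gt_eqF.
set r := (Num.sqrt L)^-1 in a1 a2 b4.
have b5 : c5 / 4 * Num.sqrt L * Dw <= c5 * Num.sqrt L * (T - r / 8).
  have -> : c5 / 4 * Num.sqrt L * Dw = c5 * Num.sqrt L * (Dw / 4) by ring.
  by apply: ler_wpM2l; [exact: mulr_ge0|lra].
have b6 : c5 * Num.sqrt L * (T - r / 8) = c5 * Num.sqrt L * T - c5 / 8.
  by rewrite -[c5 / 8]mulr1 b4; ring.
lra.
Qed.

Lemma quotient_whp :
  Pr (fun _ : 'I_m * 'I_N => p) (fun M => ~~ `[< quotient_prop M >]) <= expR (- m%:R).
Proof.
apply: le_trans F4_prob; apply: (Pr_le (fdist_law P _)) => M; apply: contraNT => nF.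
apply/asboolP => y w B Ww yB.
have [y0|yn0] := eqVneq (n2 y) 0.
  rewrite big1 => [|j _]; last by rewrite (n2_eq0 y0) mul0r.
  have [i _] : exists i : 'I_N, true.
    by have := Np; rewrite ltr0n => N0; exists (Ordinal N0).
  rewrite mulr_ge0 ?divr_ge0 ?mulr_ge0//.
  exact: le_trans (normr_ge0 _) (yB i).
have yp : 0 < n2 y by rewrite lt_neqAle eq_sym yn0 n2_ge0.
pose y' j := (n2 y)^-1 * y j.
have y'1 : n2 y' = 1 by rewrite n2Z ger0_norm ?invr_ge0 ?n2_ge0// mulVf.
have [i] := unit_dual_bound nF y'1 Ww.
have -> : \sum_j y' j * w j = (n2 y)^-1 * \sum_j y j * w j.
  by rewrite mulr_sumr; apply: eq_bigr => j _; rewrite /y' mulrA.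
have -> : \sum_j val (M (j, i)) * y' j = (n2 y)^-1 * \sum_j val (M (j, i)) * y j.
  by rewrite mulr_sumr; apply: eq_bigr => j _; rewrite /y' mulrCA.
rewrite normrM (@ger0_norm _ (n2 y)^-1) ?invr_ge0 ?n2_ge0// mulrCA ler_pM2l ?invr_gt0//.
move=> /le_trans/(_ (yB i)) hB.
have -> : (4 * 32) * k4 / c / Num.sqrt L * B = (c5 / 4 * Num.sqrt L)^-1 * B.
  by rewrite /c5; field; rewrite !gt_eqF.
rewrite [leRHS]mulrC ler_pdivlMr; first by rewrite mulrC.
by apply: mulr_gt0 => //; exact: divr_gt0.
Qed.

End Law.
End Quotient.

(** * The robust width property *)

Section SmallBall.
Context {R : realType}.
Variables (V : finType) (p val : V -> R) (neg : V -> V) (k4 : R).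
Hypothesis P : symlaw p val neg k4.

(** The ratio [a^2 / (2 b)] of [paley_zygmund] for [a = 1/4] and [b = 3 + k4]. *)
Definition q0 : R := (32 * (3 + k4))^-1.

Lemma q0_gt0 : 0 < q0.
Proof. by have := sl_k4 P => h; rewrite /q0 invr_gt0 mulr_gt0//; lra. Qed.

Lemma q0_le1 : q0 <= 1.
Proof. by have := sl_k4 P => h; rewrite /q0 invf_le1 ?mulr_gt0//; lra. Qed.

(** Paley-Zygmund for the square of the sum, whose second moment is the fourth moment of a centred
    sum. The threshold [n2 theta ^+ 2 / 16] becomes [n2 theta / 4] after the square root. *)
Lemma small_ball (I : finType) (theta : I -> R) :
  q0 <= Pr (fun _ : I => p) (fun x => n2 theta / 4 <= `|\sum_i val (x i) * theta i|).
Proof.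
have k1 := sl_k4 P; have pd := fdist_law P I.
have [t0|tn0] := eqVneq (n2 theta) 0.
  apply: le_trans q0_le1 _; rewrite -[leLHS](Ex_cst pd 1); apply: Ex_le => // x.
  by rewrite t0 mul0r normr_ge0.
have tp : 0 < n2 theta by rewrite lt_neqAle eq_sym tn0 n2_ge0.
set T := n2 theta in tp *.
pose S (x : {ffun I -> V}) := \sum_i val (x i) * theta i.
pose y i v := val v * theta i.
have y0 i : \sum_v p v * y i v = 0.
  by apply: (odd_mean0 P) => v; rewrite /y (sl_val P) mulNr.
have y2 i : \sum_v p v * y i v ^+ 2 = theta i ^+ 2 * \sum_v p v * val v ^+ 2.
  by rewrite mulr_sumr; apply: eq_bigr => v _; rewrite /y; ring.
have y4 i : \sum_v p v * y i v ^+ 4 = theta i ^+ 4 * \sum_v p v * val v ^+ 4.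
  by rewrite mulr_sumr; apply: eq_bigr => v _; rewrite /y; ring.
have e2 : Ex (fun _ : I => p) (fun x => S x ^+ 2) = T ^+ 2 * \sum_v p v * val v ^+ 2.
  have -> := Ex_sqr_centered pd y0.
  by under eq_bigr do rewrite y2; rewrite -mulr_suml -n2_sqr.
have e4 : Ex (fun _ : I => p) (fun x => (S x ^+ 2) ^+ 2) <= (3 + k4) * T ^+ 4.
  have -> : Ex (fun _ : I => p) (fun x => (S x ^+ 2) ^+ 2) = Ex (fun _ : I => p) (fun x => S x ^+ 4).
    by apply: eq_Ex => x; rewrite -exprM.
  apply: le_trans (Ex_fourth_centered pd y0) _.
  under eq_bigr do rewrite y2; rewrite -mulr_suml -n2_sqr -/T.
  rewrite [X in _ + X](eq_bigr _ (fun i _ => y4 i)) -mulr_suml.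
  have t4 : \sum_i theta i ^+ 4 <= T ^+ 4.
    have -> : T ^+ 4 = T ^+ 2 * T ^+ 2 by ring.
    rewrite n2_sqr mulr_suml; apply: ler_sum => i _.
    have -> : theta i ^+ 4 = theta i ^+ 2 * theta i ^+ 2 by ring.
    rewrite ler_wpM2l ?sqr_ge0// (bigD1 i)//= lerDl.
    by apply: sumr_ge0 => k _; exact: sqr_ge0.
  have m20 : 0 <= \sum_v p v * val v ^+ 2 by have := sl_m2_ge P; lra.
  have m40 : 0 <= \sum_v p v * val v ^+ 4.
    by apply: sumr_ge0 => v _; rewrite mulr_ge0 ?(sl_ge0 P)// exprn_even_ge0.
  have h1 : (T ^+ 2 * \sum_v p v * val v ^+ 2) ^+ 2 <= T ^+ 4.
    rewrite exprMn -exprM; apply: ler_piMr; first by rewrite exprn_ge0// ltW.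
    by rewrite expr_le1//; exact: (sl_m2_le P).
  have h2 : (\sum_i theta i ^+ 4) * (\sum_v p v * val v ^+ 4) <= T ^+ 4 * k4.
    apply: ler_pM => //; last exact: (sl_m4 P).
    by apply: sumr_ge0 => i _; exact: exprn_even_ge0.
  lra.
have a0 : 0 < T ^+ 2 / 4 by rewrite divr_gt0// exprn_gt0.
have b0 : 0 < (3 + k4) * T ^+ 4 by rewrite mulr_gt0 ?exprn_gt0//; lra.
have aS : T ^+ 2 / 4 <= Ex (fun _ : I => p) (fun x => S x ^+ 2).
  rewrite e2 ler_pM2l ?exprn_gt0//; have := sl_m2_ge P; lra.
have := paley_zygmund pd a0 b0 (fun x => sqr_ge0 _) aS e4.
have -> : (T ^+ 2 / 4) ^+ 2 / (2 * ((3 + k4) * T ^+ 4)) = q0.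
  by rewrite /q0; field; rewrite !gt_eqF//; lra.
move/le_trans; apply; apply: (Pr_le pd) => x /= h.
rewrite -(@ler_pXn2r _ 2)// ?nnegrE ?divr_ge0 ?n2_ge0// real_normK ?num_real//.
by apply: le_trans h; apply: eq_lexx; field.
Qed.

End SmallBall.

(** * Columns with large truncated weight *)

Section BadColumn.
Context {R : realType}.

Lemma powR_le_exp (x a : R) : 0 <= x -> 0 < a -> x `^ a <= (2 * a) `^ a * expR (x / 2).
Proof.
move=> x0 a0; have a2 : 0 < 2 * a by rewrite mulr_gt0.
have h : x <= (2 * a) * expR (x / (2 * a)).
  rewrite mulrC -ler_pdivrMr//; apply: le_trans (expR_ge1Dx _); lra.
apply: le_trans (_ : ((2 * a) * expR (x / (2 * a))) `^ a <= _).
  by apply: ge0_ler_powR => //; rewrite ?nnegrE ?mulr_ge0 ?expR_ge0//; lra.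
rewrite powRM ?expR_ge0//; last lra.
rewrite ler_wpM2l ?powR_ge0// -[expR _ `^ a]expRM.
by rewrite ler_expR; apply: eq_lexx; field; lra.
Qed.

Lemma geometric_le3 (x : R) n : 0 <= x -> x <= 2 / 3 -> \sum_(r < n) x ^+ r <= 3.
Proof.
move=> x0 x1.
have e : (1 - x) * \sum_(r < n) x ^+ r = 1 - x ^+ n.
  elim: n => [|n IH]; first by rewrite big_ord0 expr0 mulr0 subrr.
  by rewrite big_ord_recr /= mulrDr IH exprS; ring.
have := exprn_ge0 n x0; have : 0 <= \sum_(r < n) x ^+ r.
  by apply: sumr_ge0 => i _; rewrite exprn_ge0.
set s := \sum_(r < n) _ in e *; nra.
Qed.

Lemma level_exists (t : nat -> R) (x : R) (n : nat) : t 0%N < x ->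
  exists r : 'I_n.+1, t r < x /\ ((r : nat) = n \/ x <= t r.+1).
Proof.
move=> t0; elim: n => [|n [r [tr rn]]]; first by exists ord0; split; [|left].
have [xt|tx] := leP x (t n.+1).
  exists (widen_ord (leqnSn _) r); split => //; right => /=.
  by case: rn => // ->.
by exists ord_max; split => //; left.
Qed.

Section Law.
Variables (V : finType) (p val : V -> R) (neg : V -> V) (k4 : R).
Hypothesis P : symlaw p val neg k4.

Definition atail (t : R) : R := \sum_(v | t < `|val v|) p v.

Variables (kap gam lN L dl : R) (m k : nat).
Hypotheses (kap1 : 1 <= kap) (gam1 : 1 <= gam) (lN4 : 4 <= lN).
Hypothesis tailH : forall t q, 0 < t -> 4 <= q -> q <= lN ->
  atail t <= (kap * q `^ gam / t) `^ q.
Hypotheses (m0 : (0 < m)%N) (k0 : (0 < k)%N) (L1 : 1 <= L) (LN : L <= 1 + lN).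
Hypotheses (mN : m%:R <= expR lN) (mlN : lN `^ (2 * gam - 1) <= m%:R).
Hypotheses (kL : k%:R * L <= dl * m%:R).
Hypothesis dlH : 2 * dl * (kap * expR 10 * 2 `^ (gam - 1)) ^+ 2 <= 1.

(* Weighs an entry by its contribution to the rounding error of its row: the variance up to
   size [sqrt k], the first moment beyond. *)
Definition psi (x : R) : R := Num.min (x ^+ 2) (Num.sqrt k%:R * `|x|).

(** The mean of [tpsi * exp(lam * tpsi)] summed over levels: the exponents 20 from [top r ^+ 2],
    [r + 1], [8 - 2 r] from the tail and [(r + 1)/2] from the power of [r + 1] add up to
    [29 + 1/2 - r/2]. The factor 6 is [exp(1/2) <= 2] times a geometric sum of at most 3. *)
Definition C3 : R := 6 * kap ^+ 2 * expR 29 * (4 * gam) `^ (2 * gam).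

Let lam := L / m%:R.
Let M := kap * expR 10 * lN `^ gam.
Let mp : 0 < m%:R :> R. Proof. by rewrite ltr0n. Qed.
Let lamp : 0 < lam. Proof. by rewrite /lam divr_gt0//; have := L1; lra. Qed.
Let kapp : 0 < kap. Proof. by have := kap1; lra. Qed.
Let kap_ge0 : 0 <= kap := ltW kapp.
Let gamp : 0 < gam. Proof. by have := gam1; lra. Qed.
Let lNp : 0 < lN. Proof. by have := lN4; lra. Qed.

Lemma psi_ge0 x : 0 <= psi x.
Proof. by rewrite /psi le_min sqr_ge0 mulr_ge0 ?sqrtr_ge0. Qed.

Lemma atail_le1 t : atail t <= 1.
Proof.
rewrite -(sl_sum1 P) /atail [leLHS]big_mkcond /=; apply: ler_sum => v _.
by case: ifP => // _; exact: (sl_ge0 P).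
Qed.

Let atail_exp (c q : R) : 0 < c -> 4 <= q -> q <= lN ->
  atail (kap * expR c * q `^ gam) <= expR (- (c * q)).
Proof.
move=> c0 q4 qN; have qp : 0 < q `^ gam by rewrite powR_gt0//; lra.
apply: le_trans (tailH _ q4 qN) _; first by rewrite !mulr_gt0 ?expR_gt0.
have -> : kap * q `^ gam / (kap * expR c * q `^ gam) = expR (- c).
  by rewrite expRN; field; rewrite !gt_eqF ?expR_gt0.
by rewrite -expRM mulNr.
Qed.

(** At [lvl r] the moment of order [r] gives a tail [exp(-2 r)]. [top r] bounds the truncated values
    attributed to level [r]; its factor [exp 10] is dictated by the last level, which extends up to
    the truncation point [M]. *)
Let lvl (r : nat) := kap * expR 2 * r%:R `^ gam.
Let top (r : nat) := kap * expR 10 * r.+1%:R `^ gam.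

Let R0 := Num.truncn lN.
Let R0_itv : R0%:R <= lN < R0.+1%:R.
Proof. by have := truncn_itv (ltW lNp). Qed.

(** The offset 8 makes the bound trivial for [r < 4], where the moment assumption says nothing. *)
Let atail_lvl r : (r <= R0)%N -> atail (lvl r) <= expR (8 - 2 * r%:R).
Proof.
move=> rR; have [r4|r4] := leP 4 (r%:R : R).
  apply: le_trans (atail_exp _ r4 _) _ => //.
    by have /andP[h _] := R0_itv; apply: le_trans h; rewrite ler_nat.
  by rewrite ler_expR; lra.
apply: le_trans (atail_le1 _) _; rewrite -[leLHS]expR0 ler_expR; lra.
Qed.

(* This is where [m >= (ln N)^(2 gamma - 1)] enters. *)
Let lam_top r : (r <= R0)%N -> lam * Num.sqrt k%:R * top r <= r.+1%:R.
Proof.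
move=> rR; have rp : 0 < r.+1%:R :> R by rewrite ltr0n.
have -> : top r = kap * expR 10 * r.+1%:R `^ (gam - 1) * r.+1%:R.
  by rewrite /top -(@mulr_powRB1 _ r.+1%:R gam)//; ring.
rewrite mulrA; apply: ler_piMl; first exact: ltW.
have g0 : 0 <= gam - 1 by have := gam1; lra.
have rl : r.+1%:R <= 2 * lN.
  have /andP[h _] := R0_itv; have : r%:R <= R0%:R :> R by rewrite ler_nat.
  by have := lN4; rewrite -natr1; lra.
have rg : r.+1%:R `^ (gam - 1) <= 2 `^ (gam - 1) * lN `^ (gam - 1).
  rewrite -powRM//; last exact: ltW.
  by apply: ge0_ler_powR => //; rewrite nnegrE ?mulr_ge0// ltW.
pose Z := kap * expR 10 * 2 `^ (gam - 1).
have Z0 : 0 <= Z by rewrite !mulr_ge0 ?expR_ge0 ?powR_ge0.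
apply: (@le_trans _ _ (lam * Num.sqrt k%:R * (Z * lN `^ (gam - 1)))).
  rewrite ler_wpM2l//; first by rewrite mulr_ge0 ?sqrtr_ge0// ltW.
  by rewrite /Z -[leRHS]mulrA ler_wpM2l// mulr_ge0// expR_ge0.
have pos : 0 <= lam * Num.sqrt k%:R * (Z * lN `^ (gam - 1)).
  apply: mulr_ge0; first by rewrite mulr_ge0 ?sqrtr_ge0// ltW.
  by apply: mulr_ge0 => //; exact: powR_ge0.
rewrite -(@ler_pXn2r _ 2)// ?nnegrE// expr1n.
pose w := lN `^ (gam - 1).
have wm : w ^+ 2 * lN <= m%:R.
  apply: le_trans mlN; rewrite /w -powR_mulrn ?powR_ge0// -powRrM.
  rewrite -[X in _ * X <= _](powRr1 (ltW lNp)) -powRD ?(gt_eqF lNp) ?implybT//.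
  by apply: eq_lexx; congr (_ `^ _); ring.
have sk : Num.sqrt k%:R ^+ 2 = k%:R :> R by rewrite sqr_sqrtr.
have -> : (lam * Num.sqrt k%:R * (Z * lN `^ (gam - 1))) ^+ 2 =
   (k%:R * L) * (L * w ^+ 2 * Z ^+ 2 / m%:R ^+ 2).
  rewrite -/w -[in RHS]sk; set sq := Num.sqrt _; rewrite /lam; field.
  by rewrite gt_eqF.
have L0 : 0 <= L by have := L1; lra.
have dl0 : 0 <= dl.
  have : 0 <= dl * m%:R by apply: le_trans kL; rewrite mulr_ge0.
  by rewrite pmulr_lge0.
have Lw : L * w ^+ 2 <= 2 * m%:R.
  have : L * w ^+ 2 <= 2 * lN * w ^+ 2.
    by rewrite ler_wpM2r ?sqr_ge0//; have := LN; have := lN4; lra.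
  by move: wm; lra.
have t0 : 0 <= L * w ^+ 2 * Z ^+ 2 / m%:R ^+ 2.
  by apply: divr_ge0; [apply: mulr_ge0; [apply: mulr_ge0|]|]; rewrite ?sqr_ge0.
apply: le_trans (ler_wpM2r t0 kL) _.
have : dl * m%:R * (L * w ^+ 2 * Z ^+ 2 / m%:R ^+ 2) <= dl * m%:R * (2 * m%:R * Z ^+ 2 / m%:R ^+ 2).
  rewrite ler_wpM2l ?mulr_ge0// ler_wpM2r ?invr_ge0 ?sqr_ge0//.
  by rewrite ler_wpM2r ?sqr_ge0.
have -> : dl * m%:R * (2 * m%:R * Z ^+ 2 / m%:R ^+ 2) = 2 * dl * Z ^+ 2.
  by field; rewrite gt_eqF.
by move/le_trans; apply; exact: dlH.
Qed.

Let tpsi v := if `|val v| <= M then psi (val v) else 0.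

Let Cr r := top r ^+ 2 * expR r.+1%:R.

Let Cr_ge0 r : 0 <= Cr r.
Proof. by rewrite /Cr mulr_ge0 ?sqr_ge0 ?expR_ge0. Qed.

(** The two branches of the minimum in [psi] are used separately: the square bounds the factor, the
    linear branch bounds the exponent through [lam_top]. *)
Let tpsi_level v : tpsi v * expR (lam * tpsi v) <=
  \sum_(r < R0.+1) Cr r * (lvl r < `|val v|)%R%:R.
Proof.
have rhs0 : 0 <= \sum_(r < R0.+1) Cr r * (lvl r < `|val v|)%R%:R.
  by apply: sumr_ge0 => r _; rewrite mulr_ge0.
rewrite /tpsi; case: ifP => vM; last by rewrite mul0r.
have [v0|vn0] := eqVneq (val v) 0.
  have -> : psi (val v) = 0 by rewrite v0 /psi expr0n /= normr0 mulr0 minxx.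
  by rewrite mul0r.
have l0 : lvl 0%N < `|val v|.
  by rewrite /lvl powR0 ?mulr0 ?normr_gt0// gt_eqF.
have [r [lr rn]] := level_exists R0 l0.
have rR : (r <= R0)%N by rewrite -ltnS.
have vt : `|val v| <= top r.
  have /andP[_ lNR] := R0_itv.
  case: rn => [->|h].
    apply: le_trans vM _; rewrite /M /top ler_wpM2l ?mulr_ge0 ?expR_ge0//.
    by apply: ge0_ler_powR; rewrite ?nnegrE ?ler0n//; apply: ltW.
  apply: le_trans h _; rewrite /lvl /top ler_wpM2r ?powR_ge0// ler_wpM2l//.
  by rewrite ler_expR; lra.
rewrite (bigD1 r)//= lr mulr1 -[leLHS]addr0 lerD//; last first.
  by apply: sumr_ge0 => i _; rewrite mulr_ge0.
rewrite /Cr ler_pM ?psi_ge0 ?expR_ge0//.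
  rewrite /psi ge_min -[val v ^+ 2]real_normK ?num_real//.
  by rewrite lerXn2r// nnegrE; apply: le_trans vt.
rewrite ler_expR; apply: le_trans (lam_top rR).
rewrite -mulrA; apply: ler_wpM2l; first exact: ltW.
rewrite /psi ge_min; apply/orP; right.
by rewrite ler_wpM2l ?sqrtr_ge0.
Qed.

Let mean_tpsi : \sum_v p v * (tpsi v * expR (lam * tpsi v)) <= C3.
Proof.
apply: (@le_trans _ _ (\sum_v p v * \sum_(r < R0.+1) Cr r * (lvl r < `|val v|)%R%:R)).
  by apply: ler_sum => v _; rewrite ler_wpM2l ?(sl_ge0 P).
have -> : \sum_v p v * (\sum_(r < R0.+1) Cr r * (lvl r < `|val v|)%R%:R) =
    \sum_(r < R0.+1) Cr r * atail (lvl r).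
  under eq_bigr do rewrite mulr_sumr.
  rewrite exchange_big /=; apply: eq_bigr => r _.
  rewrite /atail mulr_sumr [RHS]big_mkcond /=; apply: eq_bigr => v _.
  by case: ltP => _ /=; ring.
have g2 : 0 < 2 * gam by rewrite mulr_gt0.
have e2 : expR (1 / 2) <= 2 :> R.
  have := @expR_ge1Dx R (- (1 / 2)); rewrite expRN => h.
  have ep : 0 < expR (1 / 2) :> R := expR_gt0 _.
  have : (1 - 1 / 2) * expR (1 / 2) <= (expR (1 / 2))^-1 * expR (1 / 2) :> R.
    by rewrite ler_wpM2r// ltW.
  by rewrite mulVf ?gt_eqF//; lra.
pose A := kap ^+ 2 * expR 29 * (4 * gam) `^ (2 * gam).
have A0 : 0 <= A by rewrite !mulr_ge0 ?sqr_ge0 ?expR_ge0 ?powR_ge0.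
have term (r : 'I_R0.+1) : Cr r * atail (lvl r) <= A * 2 * expR (- (1 / 2)) ^+ r.
  have rR : (r <= R0)%N by rewrite -ltnS.
  apply: (@le_trans _ _ (Cr r * expR (8 - 2 * r%:R))).
    by rewrite ler_wpM2l ?atail_lvl.
  have pw : r.+1%:R `^ (2 * gam) <= (4 * gam) `^ (2 * gam) * expR (r.+1%:R / 2).
    have := @powR_le_exp r.+1%:R (2 * gam) (ler0n _ _) g2.
    by rewrite (_ : 2 * (2 * gam) = 4 * gam)//; lra.
  have top2 : top r ^+ 2 = kap ^+ 2 * expR 20 * r.+1%:R `^ (2 * gam).
    rewrite /top !exprMn -expRM_natl; congr (_ * _ * _).
      by congr expR; lra.
    by rewrite -powR_mulrn ?powR_ge0// -powRrM mulrC.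
  rewrite /Cr top2 -expRM_natl.
  apply: (@le_trans _ _ (kap ^+ 2 * expR 20 * ((4 * gam) `^ (2 * gam) * expR (r.+1%:R / 2)) *
     expR r.+1%:R * expR (8 - 2 * r%:R))).
    do 2 (rewrite ler_wpM2r ?expR_ge0//).
    by rewrite ler_wpM2l// mulr_ge0 ?sqr_ge0 ?expR_ge0.
  have -> : kap ^+ 2 * expR 20 * ((4 * gam) `^ (2 * gam) * expR (r.+1%:R / 2)) *
     expR r.+1%:R * expR (8 - 2 * r%:R) = kap ^+ 2 * (4 * gam) `^ (2 * gam) *
     (expR 20 * expR (r.+1%:R / 2) * expR r.+1%:R * expR (8 - 2 * r%:R)) by ring.
  rewrite -!expRD.
  have -> : 20 + r.+1%:R / 2 + r.+1%:R + (8 - 2 * r%:R) = 29 + (1 / 2 + r%:R * - (1 / 2)) :> R.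
    by rewrite -natr1; lra.
  rewrite (expRD 29) (expRD (1 / 2)).
  have -> : kap ^+ 2 * (4 * gam) `^ (2 * gam) * (expR 29 * (expR (1 / 2) * expR (r%:R * - (1 / 2)))) =
    A * expR (1 / 2) * expR (r%:R * - (1 / 2)) by rewrite /A; ring.
  by rewrite ler_wpM2r ?expR_ge0// ler_wpM2l.
apply: (@le_trans _ _ (\sum_(r < R0.+1) A * 2 * expR (- (1 / 2)) ^+ r)).
  by apply: ler_sum => r _; exact: term.
rewrite -mulr_sumr.
have x23 : expR (- (1 / 2)) <= 2 / 3 :> R.
  rewrite expRN -[2 / 3]invf_div lef_pV2 ?posrE ?expR_gt0 ?divr_gt0//.
  by have := @expR_ge1Dx R (1 / 2); lra.
have := geometric_le3 R0.+1 (expR_ge0 _) x23.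
have A2 : 0 <= A * 2 by rewrite mulr_ge0.
move=> /(ler_wpM2l A2) /le_trans; apply.
by rewrite /C3 /A; lra.
Qed.

(** The inequality [exp x <= 1 + x exp x] reduces the exponential moment to the mean just
    bounded. *)
Let mgf : \sum_v p v * expR (lam * tpsi v) <= expR (lam * C3).
Proof.
apply: le_trans (expR_ge1Dx _).
apply: (@le_trans _ _ (\sum_v p v * (1 + lam * (tpsi v * expR (lam * tpsi v))))).
  apply: ler_sum => v _; rewrite ler_wpM2l ?(sl_ge0 P)//.
  have := @expR_ge1Dx R (- (lam * tpsi v)); rewrite expRN => h.
  have := expR_gt0 (lam * tpsi v); set e := expR _ in h *; move=> e0.
  have : (1 - lam * tpsi v) * e <= e^-1 * e by rewrite ler_wpM2r// ltW.
  by rewrite mulVf ?gt_eqF//; lra.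
under eq_bigr do rewrite mulrDr mulr1.
rewrite big_split /= (sl_sum1 P) lerD2l.
have -> : \sum_v p v * (lam * (tpsi v * expR (lam * tpsi v))) =
   lam * \sum_v p v * (tpsi v * expR (lam * tpsi v)).
  by rewrite mulr_sumr; apply: eq_bigr => v _; rewrite mulrCA.
by rewrite ler_wpM2l ?mean_tpsi// ltW.
Qed.

Let sum_tpsi_prob : Pr (fun _ : 'I_m => p)
   (fun x => (C3 + 6) * m%:R < \sum_j tpsi (x j)) <= expR (- (6 * L)).
Proof.
have pd := fdist_law P 'I_m.
apply: (@le_trans _ _ (expR (- (lam * ((C3 + 6) * m%:R))) *
   Ex (fun _ : 'I_m => p) (fun x => \prod_j expR (lam * tpsi (x j))))).
  rewrite -ExZ; apply: Ex_le => // x; rewrite -expR_sum -mulr_sumr -expRD.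
  case: ltP => h /=; last exact: expR_ge0.
  rewrite -[leLHS]expR0 ler_expR.
  have := ler_wpM2l (ltW lamp) (ltW h); lra.
have -> : Ex (fun _ : 'I_m => p) (fun x => \prod_j expR (lam * tpsi (x j))) =
    \prod_(j < m) \sum_v p v * expR (lam * tpsi v).
  exact: (Ex_prod (fun _ => p) (fun _ v => expR (lam * tpsi v))).
apply: (@le_trans _ _ (expR (- (lam * ((C3 + 6) * m%:R))) * \prod_(j < m) expR (lam * C3))).
  rewrite ler_wpM2l ?expR_ge0//; apply: ler_prod => j _; rewrite mgf andbT.
  by apply: sumr_ge0 => v _; rewrite mulr_ge0 ?(sl_ge0 P) ?expR_ge0.
rewrite -expR_sum -expRD ler_expR sumr_const card_ord -[lam * C3 *+ m]mulr_natr.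
have -> : - (lam * ((C3 + 6) * m%:R)) + lam * C3 * m%:R = - (6 * (lam * m%:R)) by ring.
by rewrite /lam divfK ?gt_eqF.
Qed.

(** With the Chernoff parameter [lam = L / m], the surplus [6 m] over the mean bound yields
    [exp(-6 L)]. An entry beyond [M] has probability at most [exp(-10 lN)], small enough for all [m]
    entries. The rate 5 is what later beats the choice of [k] columns. *)
Lemma bad_column_prob : Pr (fun _ : 'I_m => p)
   (fun x => (C3 + 6) * m%:R < \sum_j psi (val (x j))) <= expR (- (5 * L)).
Proof.
have pd := fdist_law P 'I_m.
pose big := (fun x : {ffun 'I_m -> V} => [exists j, predT j && (M < `|val (x j)|)]).
apply: (@le_trans _ _ (Pr (fun _ : 'I_m => p) big + Pr (fun _ : 'I_m => p)
    (fun x => (C3 + 6) * m%:R < \sum_j tpsi (x j)))).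
  apply: le_trans (PrU pd _ _); apply: (Pr_le pd) => x h.
  case: (boolP (big x)) => //= /existsPn nb.
  apply: lt_le_trans h _; apply: ler_sum => j _.
  by rewrite /tpsi; have := nb j; rewrite /= -leNgt => ->.
have h1 : Pr (fun _ : 'I_m => p) big <= expR lN * expR (- (10 * lN)).
  apply: le_trans (@Pr_exists_le _ _ _ _ pd _ predT (fun j x => M < `|val (x j)|)
    (expR (- (10 * lN))) _) _.
    move=> j _; rewrite /Pr (Ex_coord pd j (fun v => (M < `|val v|)%R%:R)).
    apply: le_trans (_ : atail M <= _).
      rewrite /atail [leRHS]big_mkcond /=; apply: eq_lexx.
      by apply: eq_bigr => v _; case: ltP; rewrite ?mulr1 ?mulr0.
    exact: atail_exp.
  rewrite ler_wpM2r ?expR_ge0//; apply: le_trans mN.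
  by rewrite ler_nat -[leqRHS]card_ord max_card.
apply: le_trans (lerD h1 sum_tpsi_prob) _.
have e1 : expR (-1) <= 1 / 2 :> R.
  rewrite expRN -[1 / 2]invf_div lef_pV2 ?posrE ?expR_gt0 ?divr_gt0//.
  by have := @expR_ge1Dx R 1; lra.
have := expR_gt0 (- (5 * L)); set e5 := expR _ => e50.
have b1 : expR lN * expR (- (10 * lN)) <= e5 * expR (-1).
  by rewrite -!expRD ler_expR; have := LN; have := lN4; lra.
have b2 : expR (- (6 * L)) <= e5 * expR (-1).
  by rewrite -!expRD ler_expR; have := L1; lra.
nra.
Qed.

End Law.
End BadColumn.

(** * Rounding a vector of small l1-norm: deterministic width bound *)

Section RoundingWidth.
Context {R : realType}.
Variables (m N k : nat) (b : 'I_m -> 'I_N -> R) (J : {set 'I_N}) (rb : pred 'I_m).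
Variables (u : 'I_N -> R) (C2 Kc K3 e1 q0 : R).
Hypotheses (m0 : (0 < m)%N) (k0 : (0 < k)%N) (q0p : 0 < q0).
Hypotheses (C21 : 1 <= C2) (Kc1 : 1 <= Kc) (K31 : 1 <= K3) (e1p : 0 < e1).
Hypothesis Hb : 64 * C2 <= q0 * Kc.
Hypothesis He2 : 36 * 64 * K3 * e1 ^+ 2 <= q0 / (2 * 64).
Hypothesis He3 : 36 * 64 * e1 ^+ 2 * Kc * C2 <= q0 / (2 * 64).
Hypothesis He5 : 48 * e1 * C2 <= q0 / (2 * 64).
Hypothesis He6 : e1 ^+ 2 / 2 <= 1 / (2 * 64).
Hypothesis rb_count : \sum_j (rb j)%:R <= q0 * m%:R / 64.
Hypothesis rbJ : forall j, ~~ rb j -> \sum_(i in J) b j i ^+ 2 <= K3 * k%:R.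
Hypothesis colJ : forall i, i \notin J -> \sum_j psi k (b j i) <= C2 * m%:R.
Hypotheses (u2 : n2 u = 1) (u1 : n1 u <= e1 * Num.sqrt k%:R).
Hypothesis ball : forall z : {ffun 'I_N -> gint (5 * k)}, (\sum_i gmag (z i) <= 5 * k)%N ->
  q0 * m%:R / 4 <=
  \sum_j (n2 (fun i => gval (z i) : R) / 4 <= `|\sum_i b j i * gval (z i)|)%R%:R.

Let sk := Num.sqrt (k%:R : R).
Let kp : 0 < k%:R :> R. Proof. by rewrite ltr0n. Qed.
Let mp : 0 < m%:R :> R. Proof. by rewrite ltr0n. Qed.
Let skp : 0 < sk. Proof. by rewrite sqrtr_gt0. Qed.
Let skE : sk ^+ 2 = k%:R. Proof. by rewrite sqr_sqrtr// ltW. Qed.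
Let h := e1 / sk.
Let hp : 0 < h. Proof. by rewrite divr_gt0. Qed.
Let e1_ge0 : 0 <= e1 := ltW e1p.
Let sk_ge0 : 0 <= sk := ltW skp.
Let h_ge0 : 0 <= h := ltW hp.
Let h2 : h ^+ 2 * k%:R = e1 ^+ 2.
Proof. by rewrite /h -skE; field; rewrite gt_eqF. Qed.
Let hu : h * n1 u <= e1 ^+ 2.
Proof.
apply: le_trans (ler_wpM2l h_ge0 u1) _; rewrite -/sk /h.
by apply: eq_lexx; field; rewrite gt_eqF.
Qed.

Let f := rfrac u h.
Let f0 i : 0 <= f i. Proof. by have /andP[] := rfrac_itv u hp i. Qed.
Let f1 i : f i <= 1. Proof. by have /andP[] := rfrac_itv u hp i. Qed.
Let hf i : h * f i <= `|u i|.
Proof. by rewrite mulrC -ler_pdivlMr//; exact: rfrac_le. Qed.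

(** Entries too large for a variance bound. Outside [J] the column bound on [psi] makes them so rare
    that in most rows all their bits can be required to be unset. *)
Let big j i := Kc * sk < `|b j i|.

Let psi_small j i : ~~ big j i -> b j i ^+ 2 <= Kc * psi k (b j i).
Proof.
rewrite /big -leNgt => h1; rewrite /psi -[b j i ^+ 2]real_normK ?num_real//.
set x := `|b j i| in h1 *; have x0 : 0 <= x by exact: normr_ge0.
have K0 : 0 <= Kc by have := Kc1; lra.
rewrite -/sk; have [_|_] := leP (x ^+ 2) (sk * x).
  by rewrite ler_peMl ?sqr_ge0.
by rewrite expr2 mulrA ler_wpM2r.
Qed.

Let psi_big j i : big j i -> Kc * k%:R <= psi k (b j i) /\ sk * `|b j i| <= psi k (b j i).
Proof.
rewrite /big => h1; rewrite /psi -[b j i ^+ 2]real_normK ?num_real// -/sk.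
set x := `|b j i| in h1 *; have x0 : 0 <= x by exact: normr_ge0.
have K1 := Kc1; have skx : sk <= x.
  by apply: le_trans (ltW h1); rewrite ler_peMl// ltW.
have s1 : sk * x <= x ^+ 2 by rewrite expr2 ler_wpM2r.
have s2 : Kc * k%:R <= sk * x.
  by rewrite -skE expr2 mulrA mulrC ler_wpM2l ?ltW.
by rewrite !le_min s2 s1 lexx (le_trans s2 s1).
Qed.

Let sgu i := Num.sg (u i) * h.
Let sgu2 i : sgu i ^+ 2 <= h ^+ 2.
Proof.
rewrite /sgu exprMn ler_piMl ?sqr_ge0// sqr_sg.
by case: (u i != 0).
Qed.

Let cJ j i := if (i \in J) && ~~ rb j then b j i * sgu i else 0.
Let cS j i := if (i \notin J) && ~~ big j i then b j i * sgu i else 0.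
Let lin (c : 'I_N -> R) (B : {ffun 'I_N -> bool}) := \sum_i c i * ((B i)%:R - f i).
Let bits j (B : {ffun 'I_N -> bool}) : R := \sum_(i | (i \notin J) && big j i) (B i)%:R.
Let bias j := \sum_(i | (i \notin J) && big j i) `|b j i| * (h * f i).

(** The budget of a row, scaled so that a value below 1 bounds each of three errors by 1/48 (note
    [36 * 64 = 48^2]): the entries in [J], the moderate entries outside [J] and the large ones
    outside [J]. For the last kind a set bit exhausts the budget at once, so only the bias of unset
    bits is left. *)
Let row (B : {ffun 'I_N -> bool}) j := (rb j)%:R + (36 * 64 * lin (cJ j) B ^+ 2 +
  (36 * 64 * lin (cS j) B ^+ 2 + (bits j B + 48 * bias j))).

(** The weights let the single inequality [tot < q0 m / 8] yield three facts: few rows exceed their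
    budget, the rounding moves [u] by less than 1/2 in l2, and fewer than [4 k] bits are set. The
    floors sum to at most [k], whence the grid of size [5 k]. *)
Let tot (B : {ffun 'I_N -> bool}) := \sum_j row B j +
  (q0 * m%:R / 2 * (\sum_i sgu i ^+ 2 * ((B i)%:R - f i) ^+ 2) +
   q0 * m%:R / (32 * k%:R) * \sum_i (B i)%:R).

Let rd := fdist_rdist u hp.

Let Ex_bit_sqr i : Ex (rdist u h) (fun B => ((B i)%:R - f i) ^+ 2) <= f i.
Proof.
rewrite (Ex_coord rd i (fun t : bool => (t%:R - f i) ^+ 2)) big_bool /rdist /= -/f.
have := f0 i; have := f1 i; nra.
Qed.

Let Ex_lin (c : 'I_N -> R) : Ex (rdist u h) (fun B => lin c B ^+ 2) <= \sum_i c i ^+ 2 * f i.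
Proof. exact: (@Ex_rdist_sqr R _ u h hp c). Qed.

(** In units of [q0 m / 128] the means are at most 2 for the heavy rows, 1 and 1 for the linear
    parts, 2 for the bits at large entries, 1 for the bias, 1 for the l2-error and 4 for the number
    of bits: 12 in all, below 16. *)
Let Ex_tot : Ex (rdist u h) tot < q0 * m%:R / 8.
Proof.
have C20 : 0 <= C2 by have := C21; lra.
have Kc0 : 0 < Kc by have := Kc1; lra.
have m_ge0 : 0 <= m%:R :> R by exact: ltW.
have qm : 0 <= q0 * m%:R by rewrite mulr_ge0// ltW.
rewrite /tot ExD Ex_sum.
have E1 j : Ex (rdist u h) (row^~ j) <= (rb j)%:R + (36 * 64 * (\sum_i cJ j i ^+ 2 * f i) +
   (36 * 64 * (\sum_i cS j i ^+ 2 * f i) + (\sum_(i | (i \notin J) && big j i) f i + 48 * bias j))).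
  rewrite /row !ExD !(Ex_cst rd) !(ExZ _ (36 * 64)) lerD2l; apply: lerD.
    by apply: ler_wpM2l; [rewrite mulr_ge0|exact: Ex_lin].
  apply: lerD; first by apply: ler_wpM2l; [rewrite mulr_ge0|exact: Ex_lin].
  rewrite lerD2r /bits Ex_sum ler_sum// => i _.
  by rewrite (Ex_rdist_bit u hp).
have E2 : Ex (rdist u h) (fun B => q0 * m%:R / 2 * (\sum_i sgu i ^+ 2 * ((B i)%:R - f i) ^+ 2)) <=
    q0 * m%:R / 2 * e1 ^+ 2.
  rewrite ExZ ler_wpM2l ?divr_ge0// Ex_sum; apply: le_trans hu.
  rewrite /n1 mulr_sumr; apply: ler_sum => i _; rewrite ExZ.
  apply: (@le_trans _ _ (h ^+ 2 * f i)).
    apply: ler_pM => //; first exact: sqr_ge0.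
    by apply: (Ex_ge0 rd) => B; exact: sqr_ge0.
  by rewrite expr2 -mulrA ler_wpM2l.
have E3 : Ex (rdist u h) (fun B => q0 * m%:R / (32 * k%:R) * \sum_i (B i)%:R) <= q0 * m%:R / 32.
  rewrite ExZ Ex_sum.
  apply: (@le_trans _ _ (q0 * m%:R / (32 * k%:R) * k%:R)).
    apply: ler_wpM2l; first by rewrite divr_ge0// mulr_ge0.
    apply: (@le_trans _ _ (\sum_i `|u i| / h)).
      by apply: ler_sum => i _; rewrite (Ex_rdist_bit u hp); exact: rfrac_le.
    rewrite -mulr_suml -/(n1 u) ler_pdivrMr//; apply: le_trans u1 _.
    by rewrite -/sk /h -skE; apply: eq_lexx; field; rewrite gt_eqF.
  by apply: eq_lexx; field; rewrite gt_eqF.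
have S2 : \sum_j (\sum_i cJ j i ^+ 2 * f i) <= m%:R * (K3 * e1 ^+ 2).
  apply: (@le_trans _ _ (\sum_(j < m) K3 * e1 ^+ 2)); last first.
    by rewrite sumr_const card_ord -[leLHS]mulr_natl.
  apply: ler_sum => j _; have K30 : 0 <= K3 by have := K31; lra.
  case rbj: (rb j).
    rewrite big1 ?mulr_ge0 ?sqr_ge0// => i _.
    by rewrite /cJ rbj andbF expr0n mul0r.
  have := rbJ (negbT rbj) => /(ler_wpM2l (sqr_ge0 h)).
  have -> : h ^+ 2 * (K3 * k%:R) = K3 * (h ^+ 2 * k%:R) by ring.
  rewrite h2; apply: le_trans; rewrite mulr_sumr [leRHS]big_mkcond /=.
  apply: ler_sum => i _; rewrite /cJ rbj andbT; case: ifP => _; last by rewrite expr0n mul0r.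
  have hb : 0 <= h ^+ 2 * b j i ^+ 2 by rewrite mulr_ge0 ?sqr_ge0.
  rewrite exprMn; apply: (@le_trans _ _ (b j i ^+ 2 * sgu i ^+ 2)).
    by apply: ler_piMr => //; apply: mulr_ge0; exact: sqr_ge0.
  by rewrite [leRHS]mulrC ler_wpM2l ?sqr_ge0.
have Kc_ge0 : 0 <= Kc by exact: ltW.
have kcm : 0 <= Kc * (C2 * m%:R) by apply: mulr_ge0 => //; exact: mulr_ge0.
have S3 : \sum_j (\sum_i cS j i ^+ 2 * f i) <= m%:R * (e1 ^+ 2 * Kc * C2).
  rewrite exchange_big /=.
  apply: (@le_trans _ _ (\sum_i (h * `|u i|) * (Kc * (C2 * m%:R)))).
    apply: ler_sum => i _; rewrite -mulr_suml.
    have [iJ|iJ] := boolP (i \in J).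
      rewrite big1 ?mul0r => [|j _]; last by rewrite /cS iJ expr0n.
      by apply: mulr_ge0 => //; exact: mulr_ge0.
    have c1 : \sum_j cS j i ^+ 2 <= h ^+ 2 * (Kc * (C2 * m%:R)).
      have kc0 : 0 <= h ^+ 2 * Kc by apply: mulr_ge0 => //; exact: sqr_ge0.
      rewrite [leRHS]mulrA; apply: le_trans (ler_wpM2l kc0 (colJ iJ)).
      rewrite mulr_sumr; apply: ler_sum => j _; rewrite /cS iJ /=.
      case: ifPn => nb; last by rewrite expr0n; apply: mulr_ge0 => //; exact: psi_ge0.
      have -> : h ^+ 2 * Kc * psi k (b j i) = Kc * psi k (b j i) * h ^+ 2 by ring.
      rewrite exprMn; apply: ler_pM; rewrite ?sqr_ge0//.
      exact: psi_small.
    apply: (@le_trans _ _ (h ^+ 2 * (Kc * (C2 * m%:R)) * f i)); first by rewrite ler_wpM2r.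
    have -> : h ^+ 2 * (Kc * (C2 * m%:R)) * f i = (h * (h * f i)) * (Kc * (C2 * m%:R)) by ring.
    by apply: ler_wpM2r => //; exact: ler_wpM2l.
  rewrite -mulr_suml -mulr_sumr -/(n1 u).
  have -> : m%:R * (e1 ^+ 2 * Kc * C2) = e1 ^+ 2 * (Kc * (C2 * m%:R)) by ring.
  exact: ler_wpM2r.
have S4 : \sum_j (\sum_(i | (i \notin J) && big j i) f i) <= m%:R * (q0 / 64).
  rewrite (eq_bigr (fun j => \sum_(i | i \notin J) f i * (big j i)%:R)); last first.
    by move=> j _; rewrite big_mkcondr /=; apply: eq_bigr => i _; case: ifP; rewrite ?mulr1 ?mulr0.
  rewrite exchange_big /=.
  apply: (@le_trans _ _ (\sum_(i | i \notin J) (`|u i| / h) * (C2 * m%:R / (Kc * k%:R)))).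
    apply: ler_sum => i iJ; rewrite -mulr_sumr; apply: ler_pM => //.
    - by apply: sumr_ge0.
    - exact: rfrac_le.
    rewrite ler_pdivlMr ?mulr_gt0//; apply: le_trans (colJ iJ).
    rewrite mulr_suml; apply: ler_sum => j _; case: (boolP (big j i)) => [/psi_big[bk _]|_].
      by rewrite mul1r.
    by rewrite mul0r psi_ge0.
  rewrite -mulr_suml.
  apply: (@le_trans _ _ (k%:R * (C2 * m%:R / (Kc * k%:R)))).
    apply: ler_wpM2r; first by apply: divr_ge0; exact: mulr_ge0.
    rewrite -mulr_suml ler_pdivrMr//.
    apply: (@le_trans _ _ (n1 u)).
      rewrite /n1 [leRHS](bigID (fun i => i \notin J)) /= lerDl.
      exact: sumr_ge0.
    apply: le_trans u1 _.
    by rewrite -/sk /h -skE; apply: eq_lexx; field; rewrite gt_eqF.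
  have -> : k%:R * (C2 * m%:R / (Kc * k%:R)) = m%:R * (C2 / Kc).
    by field; rewrite !gt_eqF.
  rewrite ler_wpM2l// ler_pdivrMr//; have := Hb; lra.
have S5 : \sum_j bias j <= m%:R * (e1 * C2).
  rewrite /bias (eq_bigr (fun j => \sum_(i | i \notin J) (h * f i) * (`|b j i| * (big j i)%:R))); last first.
    move=> j _; rewrite big_mkcondr /=; apply: eq_bigr => i _.
    by case: ifP; rewrite ?mulr1 ?mulr0// mulrC.
  rewrite exchange_big /=.
  apply: (@le_trans _ _ (\sum_(i | i \notin J) `|u i| * (C2 * m%:R / sk))).
    apply: ler_sum => i iJ; rewrite -mulr_sumr; apply: ler_pM => //.
    - by rewrite mulr_ge0.
    - by apply: sumr_ge0 => j _; rewrite mulr_ge0.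
    rewrite ler_pdivlMr//; apply: le_trans (colJ iJ).
    rewrite mulr_suml; apply: ler_sum => j _; case: (boolP (big j i)) => [/psi_big[_ bk]|_].
      by rewrite mulr1 mulrC.
    by rewrite mulr0 mul0r psi_ge0.
  rewrite -mulr_suml.
  apply: (@le_trans _ _ (n1 u * (C2 * m%:R / sk))).
    apply: ler_wpM2r; first by apply: divr_ge0 => //; exact: mulr_ge0.
    by rewrite /n1 [leRHS](bigID (fun i => i \notin J)) /= lerDl; exact: sumr_ge0.
  have cs : 0 <= C2 * m%:R / sk by rewrite divr_ge0 ?mulr_ge0// ltW.
  apply: le_trans (ler_wpM2r cs u1) _; rewrite -/sk.
  by apply: eq_lexx; field; rewrite gt_eqF.
have Srow : \sum_j Ex (rdist u h) (row^~ j) <= q0 * m%:R / 64 +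
    (36 * 64 * (m%:R * (K3 * e1 ^+ 2)) + (36 * 64 * (m%:R * (e1 ^+ 2 * Kc * C2)) +
      (m%:R * (q0 / 64) + 48 * (m%:R * (e1 * C2))))).
  apply: le_trans (ler_sum _ (fun j _ => E1 j)) _.
  rewrite !big_split /= -!mulr_sumr.
  by rewrite !lerD ?ler_wpM2l ?mulr_ge0.
have g2 := ler_wpM2l m_ge0 He2; have g3 := ler_wpM2l m_ge0 He3.
have g5 := ler_wpM2l m_ge0 He5; have g6 := ler_wpM2l qm He6.
have qmp : 0 < q0 * m%:R by rewrite mulr_gt0.
rewrite ExD; lra.
Qed.

(** At least [q0 m / 4] rows detect the rounded vector and fewer than [q0 m / 8] exceed their
    budget. On the rest the rounded product is at least 1/8 and its error below 1/16. *)
Lemma rounding_width : q0 * m%:R / 8 * (1 / 16) ^+ 2 <= \sum_j (\sum_i b j i * u i) ^+ 2.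
Proof.
have [B BT] : exists B, tot B <= Ex (rdist u h) tot by exact: (Ex_exists_le rd (lexx _)).
have {}BT := le_lt_trans BT Ex_tot.
have qmp : 0 < q0 * m%:R by rewrite mulr_gt0.
have bits0 j : 0 <= bits j B by exact: sumr_ge0.
have bias0 j : 0 <= bias j.
  by apply: sumr_ge0 => i _; rewrite mulr_ge0// mulr_ge0.
have sq0 (c : 'I_N -> R) : 0 <= 36 * 64 * lin c B ^+ 2 by apply: mulr_ge0; [exact: mulr_ge0|exact: sqr_ge0].
have row0 j : 0 <= row B j.
  by rewrite /row !addr_ge0 ?ler0n//; exact: mulr_ge0.
have e20 : 0 <= \sum_i sgu i ^+ 2 * ((B i)%:R - f i) ^+ 2.
  by apply: sumr_ge0 => i _; rewrite mulr_ge0 ?sqr_ge0.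
have B0 : 0 <= \sum_i (B i)%:R :> R by exact: sumr_ge0.
have a1 : 0 <= q0 * m%:R / 2 * (\sum_i sgu i ^+ 2 * ((B i)%:R - f i) ^+ 2).
  by rewrite mulr_ge0// divr_ge0// ltW.
have kq : 0 < q0 * m%:R / (32 * k%:R) by rewrite divr_gt0// mulr_gt0.
have a2 : 0 <= q0 * m%:R / (32 * k%:R) * \sum_i (B i)%:R by rewrite mulr_ge0// ltW.
have a3 : 0 <= \sum_j row B j by exact: sumr_ge0.
have rows_lt : \sum_j row B j < q0 * m%:R / 8 by move: BT; rewrite /tot; lra.
have e2_lt : \sum_i sgu i ^+ 2 * ((B i)%:R - f i) ^+ 2 < 1 / 4.
  rewrite -(ltr_pM2l (_ : 0 < q0 * m%:R / 2)); last by rewrite divr_gt0.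
  by move: BT; rewrite /tot; lra.
have B_lt : (\sum_i (B i : nat) < 4 * k)%N.
  rewrite -(ltr_nat R) natr_sum natrM -(ltr_pM2l kq).
  have -> : q0 * m%:R / (32 * k%:R) * (4 * k%:R) = q0 * m%:R / 8 by field; rewrite gt_eqF.
  by move: BT; rewrite /tot; lra.
have [z zn zE] : exists2 z : {ffun 'I_N -> gint (5 * k)}, (\sum_i gmag (z i) <= 5 * k)%N &
    forall i, rnd u h B i = h * gval (z i).
  apply: rnd_grid; rewrite big_split /=.
  have s1 : (\sum_i rfloor u h i <= k)%N.
    apply: (rfloor_sum_le hp); apply: le_trans u1 _.
    by rewrite -/sk /h -skE; apply: eq_lexx; field; rewrite gt_eqF.
  by rewrite mulSn leq_add// ltnW.
have err i : h * gval (z i) - u i = sgu i * ((B i)%:R - f i).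
  by rewrite -zE rnd_err.
have z_half : 1 / 2 <= h * n2 (fun i => gval (z i)).
  have := n2B u (fun i => h * gval (z i)); rewrite u2 n2Z (ger0_norm h_ge0).
  have : n2 (fun i => h * gval (z i) - u i) <= 1 / 2.
    rewrite -[leRHS]ger0_norm// -sqrtr_sqr ler_wsqrtr//.
    have -> : (1 / 2 : R) ^+ 2 = 1 / 4 by field.
    rewrite (eq_bigr (fun i => sgu i ^+ 2 * ((B i)%:R - f i) ^+ 2)); first exact: ltW.
    by move=> i _; rewrite err exprMn.
  lra.
(* If the budget of row [j] is below 1, its rounding error is below 3/48 = 1/16. *)
have row_err j : row B j < 1 -> `|\sum_i b j i * (h * gval (z i) - u i)| < 1 / 16.
  move=> rlt; have bi0 := bias0 j; have bt0 := bits0 j.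
  have sJ := sq0 (cJ j); have sS := sq0 (cS j).
  have nrb : ~~ rb j.
    by apply/negP => rbj; move: rlt; rewrite /row rbj /=; lra.
  have r0 : (rb j)%:R = 0 :> R by rewrite (negbTE nrb).
  have lt1 (x : R) : 36 * 64 * x ^+ 2 < 1 -> `|x| < 1 / 48.
    rewrite -[x ^+ 2]real_normK ?num_real// => hx; rewrite ltNge; apply/negP => xh.
    have : (1 / 48) ^+ 2 <= `|x| ^+ 2 by rewrite lerXn2r ?nnegrE.
    have -> : (1 / 48 : R) ^+ 2 = 1 / (36 * 64) by field.
    lra.
  have lJ : `|lin (cJ j) B| < 1 / 48 by apply: lt1; move: rlt; rewrite /row; lra.
  have lS : `|lin (cS j) B| < 1 / 48 by apply: lt1; move: rlt; rewrite /row; lra.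
  have bz i : (i \notin J) && big j i -> (B i)%:R = 0 :> R.
    move=> ib; case Bi : (B i) => //; move: rlt; rewrite /row.
    have : 1 <= bits j B.
      rewrite /bits (bigD1 i)//= Bi lerDl; exact: sumr_ge0.
    lra.
  have lB : `|\sum_(i | (i \notin J) && big j i) b j i * (sgu i * ((B i)%:R - f i))| < 1 / 48.
    apply: le_lt_trans (_ : bias j < _); last by move: rlt; rewrite /row; lra.
    apply: le_trans (ler_norm_sum _ _ _) _; apply: ler_sum => i ib.
    rewrite bz// normrM ler_wpM2l// sub0r mulrN normrN normrM (ger0_norm (f0 i)).
    rewrite ler_wpM2r// /sgu normrM (ger0_norm h_ge0) ler_piMl// normr_sg.
    by case: (u i != 0).
  have -> : \sum_i b j i * (h * gval (z i) - u i) = lin (cJ j) B + lin (cS j) B +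
      \sum_(i | (i \notin J) && big j i) b j i * (sgu i * ((B i)%:R - f i)).
    rewrite /lin [X in _ + X]big_mkcond /= -!big_split; apply: eq_bigr => i _ /=.
    rewrite err /cJ /cS nrb andbT; case: (i \in J) => /=; first by ring.
    by case: (big j i) => /=; ring.
  apply: le_lt_trans (ler_normD _ _) _.
  have := ler_normD (lin (cJ j) B) (lin (cS j) B); lra.
have cnt := ball zn.
pose E j : bool := n2 (fun i => gval (z i) : R) / 4 <= `|\sum_i b j i * gval (z i)|.
have good j : E j -> row B j < 1 -> (1 / 16) ^+ 2 <= (\sum_i b j i * u i) ^+ 2.
  move=> Ej /row_err el; rewrite -[leRHS]real_normK ?num_real// lerXn2r ?nnegrE//.
  have e1' : 1 / 8 <= `|\sum_i b j i * (h * gval (z i))|.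
    have -> : \sum_i b j i * (h * gval (z i)) = h * \sum_i b j i * gval (z i).
      by rewrite mulr_sumr; apply: eq_bigr => i _; ring.
    rewrite normrM (ger0_norm h_ge0).
    by have := ler_wpM2l h_ge0 Ej; lra.
  have -> : \sum_i b j i * u i =
      \sum_i b j i * (h * gval (z i)) - \sum_i b j i * (h * gval (z i) - u i).
    by rewrite -sumrB; apply: eq_bigr => i _; ring.
  have := lerB_dist (\sum_i b j i * (h * gval (z i))) (\sum_i b j i * (h * gval (z i) - u i)).
  lra.
(* The factor on the left is at most 1 and is positive only for a row that detects the grid vector
   within its budget, so summation counts these rows. *)
have step j : ((E j)%:R - row B j) * (1 / 16) ^+ 2 <= (\sum_i b j i * u i) ^+ 2.
  have r0 := row0 j; have s0 := sqr_ge0 (\sum_i b j i * u i).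
  case Ej : (E j); last first.
    apply: le_trans s0; rewrite mulr_le0_ge0 ?sqr_ge0//=; lra.
  have [rl|rl] := ltP (row B j) 1.
    apply: le_trans (good j Ej rl); rewrite ler_piMl ?sqr_ge0//=; lra.
  apply: le_trans s0; rewrite mulr_le0_ge0 ?sqr_ge0//=; lra.
apply: le_trans (ler_sum _ (fun j _ => step j)).
rewrite -mulr_suml sumrB ler_wpM2r ?sqr_ge0//.
by move: cnt; rewrite -/(E _); lra.
Qed.

End RoundingWidth.

(** * Width with high probability: union bounds *)

Section Width.
Context {R : realType}.

(** The generating function argument of [grid_count], with a factor [1 + x] per element. *)
Lemma subset_count (I : finType) (n : nat) (x : R) : 0 < x -> x <= 1 ->
  #|[pred S : {set I} | (#|S| <= n)%N]|%:R <= x^-1 ^+ n * expR (x * #|I|%:R).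
Proof.
move=> x0 x1; rewrite -sum1_card natr_sum.
apply: (@le_trans _ _ (x^-1 ^+ n * \sum_(S : {set I}) \prod_i (if i \in S then x else 1))).
  rewrite mulr_sumr [leLHS]big_mkcond /=; apply: ler_sum => S _.
  rewrite -big_mkcond prodr_const inE; case: ifP => [h|_]; last first.
    by rewrite mulr_ge0// exprn_ge0// ?invr_ge0 ltW.
  rewrite -[in leRHS](subnK h) exprD -mulrA -exprMn mulVf ?gt_eqF// expr1n mulr1.
  by apply: exprn_ege1; rewrite invf_ge1.
apply: ler_wpM2l; first by rewrite exprn_ge0// invr_ge0 ltW.
have -> : \sum_(S : {set I}) \prod_i (if i \in S then x else 1) = \prod_(i : I) (x + 1).
  by rewrite (@bigA_distr R 0 1 *%R +%R I (fun=> x) (fun=> 1)); apply: eq_bigl.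
rewrite prodr_const [x * _]mulrC expRM_natl.
rewrite lerXn2r ?nnegrE ?expR_ge0 ?addr_ge0//; first exact: ltW.
by rewrite addrC expR_ge1Dx.
Qed.

Section Law.
Variables (V : finType) (p val : V -> R) (neg : V -> V) (k4 : R).
Hypothesis P : symlaw p val neg k4.
Variables (kap gam lN L dl : R) (m N k : nat).
Hypotheses (kap1 : 1 <= kap) (gam1 : 1 <= gam) (lN4 : 4 <= lN).
Hypothesis tailH : forall t q, 0 < t -> 4 <= q -> q <= lN ->
  atail p val t <= (kap * q `^ gam / t) `^ q.
Hypotheses (m0 : (0 < m)%N) (k0 : (0 < k)%N) (L4 : 4 <= L).
Hypotheses (lNE : expR lN = N%:R) (LN : expR L * m%:R = expR 1 * N%:R).
Hypotheses (mN : (m <= N)%N) (mlN : lN `^ (2 * gam - 1) <= m%:R).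
Hypotheses (kL : k%:R * L <= dl * m%:R) (kL2 : dl * m%:R <= 2 * (k%:R * L)).
Hypothesis dlp : 0 < dl.
Hypothesis dlH : 2 * dl * (kap * expR 10 * 2 `^ (gam - 1)) ^+ 2 <= 1.
Hypothesis dlq : 11 * dl <= q0 k4 / 8.
Hypothesis dlL : 4 / dl <= expR (L / 2).

(** [wC2] is the threshold of a bad column, and [wKc] makes set bits at large entries rare. [wK3] is
    chosen so that its inverse to the power [q0 m / 64] is [exp(-3 m)], which beats the factor [2^m]
    of [chernoff_upper]. [we1] is small enough to beat all of these. *)
Definition wC2 : R := C3 kap gam + 6.
Definition wKc : R := 64 * wC2 / q0 k4.
Definition wK3 : R := expR (3 * 64 / q0 k4).
Definition we1 : R := q0 k4 / (64 * 64 * (64 * 2) * (wK3 * (wKc * wC2))).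

Let q := q0 k4.
Let qp : 0 < q := q0_gt0 P.
Let q_ge0 : 0 <= q := ltW qp.
Let q1 : q <= 1 := q0_le1 P.
Let C21 : 1 <= wC2.
Proof.
have : 0 <= C3 kap gam.
  have := kap1; rewrite /C3 => h; apply: mulr_ge0; last exact: powR_ge0.
  by apply: mulr_ge0; [rewrite mulr_ge0// sqr_ge0|exact: expR_ge0].
by rewrite /wC2; lra.
Qed.
Let C2p : 0 < wC2. Proof. by have := C21; lra. Qed.
Let Kc1 : 1 <= wKc.
Proof. by rewrite /wKc -/q ler_pdivlMr//; have := q1; have := C21; lra. Qed.
Let Kcp : 0 < wKc. Proof. by have := Kc1; lra. Qed.
Let K31 : 1 <= wK3.
Proof. by rewrite -[leLHS]expR0 ler_expR divr_ge0// mulr_ge0. Qed.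
Let K3p : 0 < wK3 := expR_gt0 _.
Let T := wK3 * (wKc * wC2).
Let KC1 : 1 <= wKc * wC2.
Proof. by have := Kc1; have := C21; nra. Qed.
Let T1 : 1 <= T.
Proof. by have := K31; have := KC1; rewrite /T; nra. Qed.
Let Tp : 0 < T. Proof. by have := T1; lra. Qed.

Let D : R := 64 * 64 * (64 * 2).
Let Dp : 0 < D. Proof. by rewrite /D; lra. Qed.

Lemma we1_gt0 : 0 < we1.
Proof. by apply: divr_gt0 => //; exact: mulr_gt0. Qed.

Let e1_mul (x : R) : 0 <= x -> x <= T -> we1 * x <= q / D.
Proof.
move=> x0 xT; rewrite /we1 -/q -/T -/D ler_pdivlMr//.
have -> : q / (D * T) * x * D = q * (x / T) by field; rewrite !gt_eqF.
by rewrite ler_piMr// ler_pdivrMr// mul1r.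
Qed.

Let e1_le1 : we1 <= 1 / 64.
Proof.
have := e1_mul ler01 T1; rewrite mulr1 => /le_trans; apply.
by rewrite ler_pdivrMr//; have := q1; rewrite /D; lra.
Qed.

Let e1_ge0 : 0 <= we1 := ltW we1_gt0.

Let sq_bound (x : R) : 0 <= x -> x <= T -> we1 ^+ 2 * x <= q / D.
Proof.
move=> x0 xT; have h := e1_mul x0 xT; apply: le_trans h.
rewrite expr2 -mulrA ler_piMl//; last by have := e1_le1; lra.
by rewrite mulr_ge0.
Qed.

Let He2 : 36 * 64 * wK3 * we1 ^+ 2 <= q / (2 * 64).
Proof.
have : we1 ^+ 2 * wK3 <= q / D.
  by apply: sq_bound; [exact: ltW|rewrite /T ler_peMr// ltW].
by have := qp; rewrite /D; lra.
Qed.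

Let He3 : 36 * 64 * we1 ^+ 2 * wKc * wC2 <= q / (2 * 64).
Proof.
have : we1 ^+ 2 * (wKc * wC2) <= q / D.
  by apply: sq_bound; [rewrite mulr_ge0// ltW|rewrite /T ler_peMl// mulr_ge0// ltW].
by have := qp; rewrite /D; lra.
Qed.

Let He5 : 48 * we1 * wC2 <= q / (2 * 64).
Proof.
have : we1 * wC2 <= q / D.
  apply: e1_mul; first exact: ltW.
  apply: (@le_trans _ _ (wKc * wC2)); first by rewrite ler_peMl// ltW.
  by rewrite /T ler_peMl// mulr_ge0// ltW.
by have := qp; rewrite /D; lra.
Qed.

Let He6 : we1 ^+ 2 / 2 <= 1 / (2 * 64).
Proof. by have := e1_le1; have := e1_ge0; nra. Qed.

Let Hb : 64 * wC2 <= q * wKc.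
Proof. by rewrite /wKc -/q [q * _]mulrC divfK ?gt_eqF. Qed.

Definition width_prop (M : {ffun 'I_m * 'I_N -> V}) : Prop :=
  forall u : 'I_N -> R, n2 u <= n1 u / (we1 * Num.sqrt k%:R) +
    16 * Num.sqrt (8 / q0 k4) *
      n2 (fun j : 'I_m => (Num.sqrt m%:R)^-1 * \sum_i val (M (j, i)) * u i).

Let mp : 0 < m%:R :> R. Proof. by rewrite ltr0n. Qed.
Let kp : 0 < k%:R :> R. Proof. by rewrite ltr0n. Qed.
Let Np : 0 < N%:R :> R. Proof. by rewrite ltr0n (leq_trans m0). Qed.
Let e1ge : 1 <= expR 1 :> R.
Proof. by have := @expR_ge1Dx R 1; lra. Qed.

(** [N <= e^L m] and [m <= 2 k L / dl]; the factor [2 L / dl] is swallowed by a second [e^L]. *)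
Let Nk : N%:R / k%:R <= expR (2 * L).
Proof.
rewrite ler_pdivrMr//.
have N1 : N%:R <= expR L * m%:R by rewrite LN ler_peMl// ltW.
have mk : m%:R <= 2 * (k%:R * L) / dl by rewrite ler_pdivlMr// mulrC.
have L2 : L <= 2 * expR (L / 2) by have := @expR_ge1Dx R (L / 2); lra.
apply: le_trans N1 _.
have -> : expR (2 * L) * k%:R = expR L * (expR (L / 2) * expR (L / 2) * k%:R).
  by rewrite -expRD mulrA -expRD; congr (expR _ * _); lra.
rewrite ler_wpM2l ?expR_ge0//; apply: le_trans mk _.
have : 2 * (k%:R * L) / dl <= 2 * (k%:R * (2 * expR (L / 2))) / dl.
  apply: ler_wpM2r; first by rewrite invr_ge0 ltW.
  by rewrite ler_wpM2l// ler_wpM2l.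
move/le_trans; apply.
have -> : 2 * (k%:R * (2 * expR (L / 2))) / dl = 4 / dl * (expR (L / 2) * k%:R) by ring.
by rewrite -[leRHS]mulrA ler_wpM2r// mulr_ge0 ?expR_ge0.
Qed.

Let kN2 : k%:R / N%:R <= 1 / 2 :> R.
Proof.
rewrite ler_pdivrMr//.
have N1 : 4 * m%:R <= N%:R :> R.
  have e : expR (L - 1) * m%:R = N%:R.
    have e0 : expR 1 != 0 :> R by rewrite gt_eqF// expR_gt0.
    by apply: (mulfI e0); rewrite -LN mulrA -expRD; congr (expR _ * _); lra.
  rewrite -e; apply: ler_wpM2r; first exact: ltW.
  by have := @expR_ge1Dx R (L - 1); have := L4; lra.
have km : k%:R <= m%:R :> R.
  have k1 : k%:R * 1 <= k%:R * L by rewrite ler_wpM2l ?ler0n//; have := L4; lra.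
  have d1 : dl * m%:R <= 1 * m%:R 
    by apply: ler_wpM2r; [exact: ltW|have := dlq; have := q1; rewrite -/q; lra].
  by have := kL; lra.
by have := mp; lra.
Qed.

Let count_exp (n : nat) : (N%:R / k%:R) ^+ n <= expR (2 * L * n%:R).
Proof.
rewrite expRM_natr lerXn2r// nnegrE ?expR_ge0//.
Qed.

Let xV : (k%:R / N%:R)^-1 = N%:R / k%:R :> R. Proof. by rewrite invf_div. Qed.
Let xp : 0 < k%:R / N%:R :> R. Proof. by rewrite divr_gt0. Qed.

Let k_le : k%:R <= k%:R * L / 4.
Proof. by have := ler_wpM2l (ltW kp) L4; lra. Qed.

Let grid5 : #|[pred z : {ffun 'I_N -> gint (5 * k)} | (\sum_i gmag (z i) <= 5 * k)%N]|%:R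
   <= expR (11 * (k%:R * L)).
Proof.
apply: le_trans (grid_count _ _ xp kN2) _; rewrite xV card_ord.
have -> : 4 * (k%:R / N%:R) * N%:R = 4 * k%:R :> R by field; rewrite gt_eqF.
apply: (@le_trans _ _ (expR (2 * L * (5 * k)%:R) * expR (4 * k%:R))).
  by rewrite ler_wpM2r ?expR_ge0.
by rewrite -expRD ler_expR natrM; have := k_le; lra.
Qed.

Let sets : #|[pred S : {set 'I_N} | (#|S| <= k)%N]|%:R <= expR (3 * (k%:R * L)).
Proof.
have x1 : k%:R / N%:R <= 1 :> R by have := kN2; lra.
apply: le_trans (subset_count _ _ xp x1) _; rewrite xV card_ord divfK ?gt_eqF//.
apply: (@le_trans _ _ (expR (2 * L * k%:R) * expR k%:R)).
  by rewrite ler_wpM2r ?expR_ge0.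
by rewrite -expRD ler_expR; have := k_le; have := kp; lra.
Qed.

Let rowf := @blockf 'I_m 'I_N ('I_m * 'I_N)%type V id.
Let colf := @blockf 'I_N 'I_m ('I_m * 'I_N)%type V (@swapK m N).
Let id_bij : bijective (@id ('I_m * 'I_N)). Proof. by exists id. Qed.

Let ballev (th : 'I_N -> R) (x : {ffun 'I_N -> V}) :=
  n2 th / 4 <= `|\sum_i val (x i) * th i|.
Let badev (x : {ffun 'I_m -> V}) := wC2 * m%:R < \sum_j psi k (val (x j)).
Let heavyev (S : {set 'I_N}) (x : {ffun 'I_N -> V}) := wK3 * k%:R < \sum_(i in S) val (x i) ^+ 2.
Let nh := (Num.truncn (q * m%:R / 64)).+1.

Let F1 (M : {ffun 'I_m * 'I_N -> V}) : bool :=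
  [exists z : {ffun 'I_N -> gint (5 * k)}, (\sum_i gmag (z i) <= 5 * k)%N &&
    (\sum_j (ballev (fun i => gval (z i)) (rowf M j))%:R < q * #|'I_m|%:R / 4)].
Let F2 (M : {ffun 'I_m * 'I_N -> V}) : bool :=
  [exists S : {set 'I_N}, (#|S| == k) && [forall i in S, badev (colf M i)]].
(** The set of bad columns is random, so heavy rows are controlled for all small sets of columns at
    once. *)
Let F3 (M : {ffun 'I_m * 'I_N -> V}) : bool :=
  [exists S : {set 'I_N}, (#|S| <= k)%N &&
    (nh <= \sum_j (heavyev S (rowf M j) : nat))%N].

Let pd := fdist_law P ('I_m * 'I_N)%type.
Let PM := Pr (fun _ : 'I_m * 'I_N => p).

Let F1_prob : PM F1 <= expR (- (q / 8 * m%:R)).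
Proof.
apply: (@le_trans _ _ (#|[pred z : {ffun 'I_N -> gint (5 * k)} |
    (\sum_i gmag (z i) <= 5 * k)%N]|%:R * expR (- (q * m%:R / 4)))).
  apply: (Pr_exists_le pd) => z _; rewrite -[X in expR (- (_ * X%:R / _))](card_ord m).
  exact: (@chernoff_lower _ _ _ _ _ id (fun=> p) id_bij pd
    (fun _ => ballev (fun i => gval (z i))) q (fun _ => small_ball P _)).
apply: (@le_trans _ _ (expR (11 * (k%:R * L)) * expR (- (q * m%:R / 4)))).
  by rewrite ler_wpM2r ?expR_ge0.
rewrite -expRD ler_expR.
by have := ler_wpM2r (ltW mp) dlq; have := kL; rewrite -/q; lra.
Qed.

(** Choosing [k] columns costs [exp(3 k L)] and gains [exp(-5 k L)]; the difference [2 k L] is at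
    least [dl m]. *)
Let F2_prob : PM F2 <= expR (- (dl * m%:R)).
Proof.
have bad (i : 'I_N) : Pr (fun _ : 'I_m => p) badev <= expR (- (5 * L)).
  have LlN : L <= 1 + lN.
    rewrite -ler_expR expRD lNE -LN ler_peMr ?expR_ge0//.
    by rewrite ler1n.
  have mN' : m%:R <= expR lN by rewrite lNE ler_nat.
  have L1 : 1 <= L by have := L4; lra.
  exact: (bad_column_prob P kap1 gam1 lN4 tailH m0 L1 LlN mN' mlN kL dlH).
apply: (@le_trans _ _ (#|[pred S : {set 'I_N} | #|S| == k]|%:R * expR (- (5 * L)) ^+ k)).
  apply: (Pr_exists_le pd) => S /eqP Sk; rewrite -[in leRHS]Sk.
  exact: (@Pr_all_blocks _ _ _ _ _ (@swapK m N) (fun=> p) (swapK_bij m N) pd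
    (fun _ => badev) _ S (expR_ge0 _) bad).
apply: (@le_trans _ _ (expR (3 * (k%:R * L)) * expR (- (5 * L)) ^+ k)).
  rewrite ler_wpM2r ?exprn_ge0 ?expR_ge0//; apply: le_trans sets.
  rewrite ler_nat; apply: subset_leq_card; apply/fintype.subsetP => S.
  by rewrite !inE => /eqP ->.
rewrite -expRM_natl -expRD ler_expR.
by clear bad; have := kL2; lra.
Qed.

Let F3_prob : PM F3 <= expR (- m%:R).
Proof.
have K0 : 0 <= wK3^-1 by rewrite invr_ge0 ltW.
have heavy (S : {set 'I_N}) : (#|S| <= k)%N -> Pr (fun _ : 'I_N => p) (heavyev S) <= wK3^-1.
  move=> Sk; have pdN := fdist_law P 'I_N.
  have Kk : 0 < wK3 * k%:R by rewrite mulr_gt0.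
  have := @markov_Pr _ _ _ (fun _ : 'I_N => p) pdN (fun x => \sum_(i in S) val (x i) ^+ 2) _ Kk.
  have f0 (x : {ffun 'I_N -> V}) : 0 <= \sum_(i in S) val (x i) ^+ 2.
    by apply: sumr_ge0 => i _; exact: sqr_ge0.
  move=> /(_ f0) /le_trans; apply; rewrite ler_pdivrMr// mulrA mulVf ?gt_eqF// mul1r Ex_sum.
  apply: (@le_trans _ _ (\sum_(i in S) 1)); last by rewrite sumr_const ler_nat.
  apply: ler_sum => i _; rewrite (Ex_coord pdN i (fun v => val v ^+ 2)).
  exact: (sl_m2_le P).
apply: (@le_trans _ _ (#|[pred S : {set 'I_N} | (#|S| <= k)%N]|%:R * (wK3^-1 ^+ nh * 2 ^+ #|'I_m|))).
  apply: (Pr_exists_le pd) => S Sk.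
  apply: (@chernoff_upper _ _ _ _ _ id (fun=> p) id_bij pd (fun _ => heavyev S)).
  - by rewrite invr_gt0.
  - by rewrite invf_le1.
  by move=> _; exact: heavy.
have n_ge : q * m%:R / 64 <= nh%:R.
  have /truncn_itv/andP[_ h] : 0 <= q * m%:R / 64 by rewrite divr_ge0 ?mulr_ge0.
  exact: ltW.
have Kn : wK3^-1 ^+ nh <= expR (- (3 * m%:R)).
  rewrite /wK3 -expRN -expRM_natr ler_expR mulNr lerN2 -/q.
  have q3 : 0 <= 3 * 64 / q by rewrite divr_ge0 ?mulr_ge0.
  apply: le_trans (ler_wpM2l q3 n_ge).
  by apply: eq_lexx; field; rewrite gt_eqF.
have two : 2 ^+ #|'I_m| <= expR m%:R :> R.
  rewrite card_ord -[m%:R]mulr1 expRM_natl lerXn2r ?nnegrE ?expR_ge0//.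
  by have := @expR_ge1Dx R 1; lra.
apply: (@le_trans _ _ (expR (3 * (k%:R * L)) * (expR (- (3 * m%:R)) * expR m%:R))).
  apply: ler_pM => //; first by rewrite mulr_ge0// exprn_ge0.
  by apply: ler_pM => //; rewrite exprn_ge0.
rewrite -!expRD ler_expR.
have := ler_wpM2r (ltW mp) dlq; have := ler_wpM2r (ltW mp) q1; rewrite -/q.
by have := kL; have := mp; lra.
Qed.

(** A vector of large l1-norm satisfies the bound through the first term. Any other one is
    normalised and handled by [rounding_width], with [J] the set of bad columns. *)
Let good_width M : ~~ F1 M -> ~~ F2 M -> ~~ F3 M -> width_prop M.
Proof.
move=> nF1 nF2 nF3 u.
pose b (j : 'I_m) (i : 'I_N) := val (M (j, i)).
pose J := [set i | badev (colf M i)]%SET.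
have Jk : (#|J| <= k)%N.
  rewrite leqNgt; apply: contra nF2 => kJ.
  pose s := take k (enum J).
  apply/existsP; exists [set i in s]%SET; apply/andP; split.
    have /card_uniqP us : uniq s by rewrite take_uniq// enum_uniq.
    by rewrite cardsE us size_takel// -cardE ltnW.
  apply/forall_inP => i; rewrite inE => /mem_take.
  by rewrite mem_enum inE.
pose rb : pred 'I_m := fun j => heavyev J (rowf M j).
have rb_count : \sum_j (rb j)%:R <= q * m%:R / 64.
  have : (\sum_j (rb j : nat) < nh)%N.
    rewrite ltnNge; apply: contra nF3 => h; apply/existsP; exists J.
    by rewrite Jk.
  rewrite /nh ltnS => h; have qm : 0 <= q * m%:R / 64 by rewrite divr_ge0 ?mulr_ge0.
  have /truncn_itv/andP[g _] := qm; apply: le_trans g.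
  by rewrite -natr_sum ler_nat.
have rbJ j : ~~ rb j -> \sum_(i in J) b j i ^+ 2 <= wK3 * k%:R.
  rewrite /rb /heavyev -leNgt; apply: le_trans.
  by apply: eq_lexx; apply: eq_bigr => i _; rewrite ffunE.
have colJ i : i \notin J -> \sum_j psi k (b j i) <= wC2 * m%:R.
  rewrite inE /badev -leNgt; apply: le_trans.
  by apply: eq_lexx; apply: eq_bigr => j _; rewrite ffunE.
have ball (z : {ffun 'I_N -> gint (5 * k)}) : (\sum_i gmag (z i) <= 5 * k)%N ->
  q * m%:R / 4 <=
  \sum_j (n2 (fun i => gval (z i) : R) / 4 <= `|\sum_i b j i * gval (z i)|)%R%:R.
  move=> zn; rewrite leNgt; apply: contra nF1 => lt; apply/existsP; exists z.
  rewrite zn card_ord /=; apply: le_lt_trans lt; apply: ler_sum => j _.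
  rewrite /ballev; apply: eq_lexx; congr ((_ <= `|_|)%R%:R).
  by apply: eq_bigr => i _; rewrite ffunE.
have skp : 0 < Num.sqrt k%:R :> R by rewrite sqrtr_gt0.
have smp : 0 < Num.sqrt m%:R :> R by rewrite sqrtr_gt0.
have esk : 0 < we1 * Num.sqrt k%:R by rewrite mulr_gt0// we1_gt0.
have a0 : 0 <= n1 u / (we1 * Num.sqrt k%:R) by rewrite divr_ge0 ?n1_ge0// ltW.
have b0 : 0 <= 16 * Num.sqrt (8 / q0 k4) *
      n2 (fun j : 'I_m => (Num.sqrt m%:R)^-1 * \sum_i val (M (j, i)) * u i).
  by rewrite mulr_ge0 ?n2_ge0// mulr_ge0// sqrtr_ge0.
have [le1|gt1] := leP (n2 u * (we1 * Num.sqrt k%:R)) (n1 u).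
  by rewrite -[leLHS]addr0 lerD// ler_pdivlMr.
rewrite -[leLHS]add0r lerD//.
have up : 0 < n2 u.
  rewrite -(pmulr_lgt0 _ esk); apply: le_lt_trans gt1; exact: n1_ge0.
pose u' i := (n2 u)^-1 * u i.
have iu : 0 <= (n2 u)^-1 by rewrite invr_ge0 ltW.
have u'2 : n2 u' = 1 by rewrite n2Z ger0_norm// mulVf// gt_eqF.
have u'1 : n1 u' <= we1 * Num.sqrt k%:R.
  have -> : n1 u' = (n2 u)^-1 * n1 u.
    by rewrite /n1 mulr_sumr; apply: eq_bigr => i _; rewrite /u' normrM ger0_norm.
  by rewrite mulrC ler_pdivrMr// mulrC ltW.
have := rounding_width m0 k0 qp C21 Kc1 K31 we1_gt0 Hb He2 He3 He5 He6 rb_count rbJ colJ u'2 u'1 ball.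
have -> : \sum_j (\sum_i b j i * u' i) ^+ 2 = (n2 u)^-1 ^+ 2 * \sum_j (\sum_i b j i * u i) ^+ 2.
  rewrite mulr_sumr; apply: eq_bigr => j _; rewrite -exprMn; congr (_ ^+ 2).
  by rewrite mulr_sumr; apply: eq_bigr => i _; rewrite /u'; ring.
set Q := \sum_j _ => h.
have Q0 : 0 <= Q by exact: sum_sqr_ge0.
rewrite n2Z ger0_norm ?invr_ge0 ?sqrtr_ge0//.
have -> : n2 (fun j : 'I_m => \sum_i val (M (j, i)) * u i) = Num.sqrt Q by [].
rewrite -(@ler_pXn2r _ 2)// ?nnegrE ?n2_ge0// ?mulr_ge0 ?invr_ge0 ?sqrtr_ge0//.
have q8 : 0 <= 8 / q by rewrite divr_ge0.
have -> : (16 * Num.sqrt (8 / q0 k4) * ((Num.sqrt m%:R)^-1 * Num.sqrt Q)) ^+ 2 =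
   16 ^+ 2 * Num.sqrt (8 / q) ^+ 2 * ((Num.sqrt m%:R ^+ 2)^-1 * Num.sqrt Q ^+ 2) by rewrite -/q -exprVn; ring.
rewrite (sqr_sqrtr q8) (sqr_sqrtr (ltW mp)) (sqr_sqrtr Q0).
have u20 : 0 < n2 u ^+ 2 by rewrite exprn_gt0.
have := ler_wpM2l (ltW u20) h.
have -> : n2 u ^+ 2 * ((n2 u)^-1 ^+ 2 * Q) = Q by field; rewrite gt_eqF.
move=> h2.
have c0 : 0 <= 16 ^+ 2 * (8 / q) * m%:R^-1 by apply: mulr_ge0; [apply: mulr_ge0 => //; exact: sqr_ge0|rewrite invr_ge0 ler0n].
have := ler_wpM2l c0 h2.
have -> : 16 ^+ 2 * (8 / q) / m%:R * (n2 u ^+ 2 * (q * m%:R / 8 * (1 / 16) ^+ 2)) = n2 u ^+ 2.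
  by field; rewrite !gt_eqF.
by move/le_trans; apply; apply: eq_lexx; ring.
Qed.

Lemma width_whp : Pr (fun _ : 'I_m * 'I_N => p) (fun M => ~~ `[< width_prop M >]) <=
  expR (- (q0 k4 / 8 * m%:R)) + (expR (- (dl * m%:R)) + expR (- m%:R)).
Proof.
apply: le_trans (lerD F1_prob (lerD F2_prob F3_prob)).
apply: le_trans (lerD (lexx _) (PrU pd F2 F3)); apply: le_trans (PrU pd _ _).
apply: (Pr_le pd) => M; apply: contraNT; rewrite !negb_or => /and3P[h1 h2 h3].
by apply/asboolP; exact: good_width.
Qed.

End Law.
End Width.

Local Open Scope classical_set_scope.
Local Open Scope ring_scope.

(** * Deterministic recovery *)

Section Deterministic.
Context {R : realType}.

Lemma lpnorm1E (N : nat) (v : 'I_N -> R) : lpnorm 1 v = n1 v.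
Proof.
rewrite /lpnorm invr1 powRr1; last by apply: sumr_ge0 => i _; exact: powR_ge0.
by apply: eq_bigr => i _; rewrite powRr1.
Qed.

Lemma lpnorm2E (N : nat) (v : 'I_N -> R) : lpnorm 2 v = n2 v.
Proof.
rewrite /lpnorm powR12_sqrt; last by apply: sumr_ge0 => i _; exact: powR_ge0.
congr Num.sqrt; apply: eq_bigr => i _.
by rewrite -(real_normK (num_real (v i))) -powR_mulrn.
Qed.

Lemma linfnorm_ge (N : nat) (v : 'I_N -> R) i : `|v i| <= linfnorm v.
Proof. by rewrite /linfnorm (bigD1 i)//= le_max lexx. Qed.

(** Values below the level [l] are charged to the l1-norm, those above it to the square of the
    l2-norm. *)
Lemma powR_interp (a l p : R) : 0 <= a -> 0 < l -> 1 <= p -> p <= 2 ->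
  a `^ p <= l `^ (p - 1) * a + l `^ (p - 2) * a ^+ 2.
Proof.
move=> a0 l0 p1 p2; have [->|an0] := eqVneq a 0.
  by rewrite powR0 ?mulr0 ?expr0n ?mulr0 ?addr0//; lra.
have ap : 0 < a by rewrite lt_neqAle eq_sym an0.
have i1 : 0 <= l `^ (p - 1) * a by rewrite mulr_ge0// powR_ge0.
have i2 : 0 <= l `^ (p - 2) * a ^+ 2 by rewrite mulr_ge0 ?powR_ge0 ?sqr_ge0.
have [al|la] := leP a l.
  apply: le_trans (_ : l `^ (p - 1) * a <= _); last by rewrite lerDl.
  have -> : a `^ p = a `^ (p - 1) * a by rewrite mulrC mulr_powRB1//; lra.
  by rewrite ler_wpM2r// ge0_ler_powR// ?nnegrE//; lra.
apply: le_trans (_ : l `^ (p - 2) * a ^+ 2 <= _); last by rewrite lerDr.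
have -> : a `^ p = a `^ (p - 2) * a ^+ 2.
  rewrite -[a ^+ 2]powR_mulrn// -powRD; first by congr (_ `^ _); lra.
  by rewrite an0 implybT.
rewrite ler_wpM2r ?sqr_ge0//.
have -> : p - 2 = - (2 - p) by ring.
rewrite !powRN lef_pV2 ?posrE ?powR_gt0//.
by rewrite ge0_ler_powR// ?nnegrE//; lra.
Qed.

(** The level [K / t] balances the l1 and l2 contributions: both become [K^p t^(1-p)]. The remaining
    [2^(1/p)] is bounded by 2. *)
Lemma lpnorm_interp (N : nat) (v : 'I_N -> R) (t K p : R) : 0 < t -> 1 <= p -> p <= 2 ->
  n1 v + Num.sqrt t * n2 v <= K -> lpnorm p v <= 2 * K * t `^ (p^-1 - 1).
Proof.
move=> t0 p1 p2 vK.
have a0 := n1_ge0 v; have b0 := n2_ge0 v; have st : 0 < Num.sqrt t by rewrite sqrtr_gt0.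
have sb0 : 0 <= Num.sqrt t * n2 v by rewrite mulr_ge0// ltW.
have K0 : 0 <= K by lra.
have p0 : 0 < p by lra.
have pV : 0 < p^-1 by rewrite invr_gt0.
have [K00|Kn0] := eqVneq K 0.
  have v0 : n2 v = 0.
    have /eqP : Num.sqrt t * n2 v == 0 by rewrite eq_le sb0 andbT; lra.
    by move/eqP; rewrite mulf_eq0 (gt_eqF st) /= => /eqP.
  rewrite K00 mulr0 mul0r /lpnorm big1 ?powR0 ?gt_eqF// => i _.
  by rewrite (n2_eq0 v0) normr0 powR0// gt_eqF.
have Kp : 0 < K by rewrite lt_neqAle eq_sym Kn0.
pose l := K / t; have l0 : 0 < l by rewrite divr_gt0.
have sum_le : \sum_(i < N) `|v i| `^ p <= 2 * (K * l `^ (p - 1)).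
  apply: le_trans (_ : l `^ (p - 1) * n1 v + l `^ (p - 2) * n2 v ^+ 2 <= _).
    rewrite n2_sqr !mulr_sumr -big_split; apply: ler_sum => i _ /=.
    by rewrite -(real_normK (num_real (v i))); exact: powR_interp.
  have e1 : l `^ (p - 2) = l `^ (p - 1) * (t / K).
    rewrite (_ : p - 2 = (p - 1) + (-1)); last by ring.
    rewrite powRD ?(gt_eqF l0) ?implybT// powR_inv1 ?ltW// /l.
    by rewrite invf_div.
  have : n2 v ^+ 2 * t <= K ^+ 2.
    have -> : n2 v ^+ 2 * t = (Num.sqrt t * n2 v) ^+ 2.
      by rewrite exprMn (sqr_sqrtr (ltW t0)) mulrC.
    by rewrite lerXn2r ?nnegrE//; lra.
  rewrite e1 => h2.
  have -> : 2 * (K * l `^ (p - 1)) = l `^ (p - 1) * K + l `^ (p - 1) * K by ring.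
  rewrite lerD// ?ler_wpM2l ?powR_ge0//; first by lra.
  rewrite -mulrA ler_wpM2l ?powR_ge0//.
  have -> : t / K * n2 v ^+ 2 = n2 v ^+ 2 * t / K by ring.
  by rewrite ler_pdivrMr.
rewrite /lpnorm; apply: le_trans (_ : (2 * (K * l `^ (p - 1))) `^ p^-1 <= _).
  apply: ge0_ler_powR => //; rewrite ?nnegrE; first exact: ltW.
    by apply: sumr_ge0 => i _; exact: powR_ge0.
  by rewrite !mulr_ge0 ?powR_ge0.
rewrite powRM ?mulr_ge0 ?powR_ge0// -mulrA.
apply: ler_pM; rewrite ?powR_ge0//.
  by rewrite ler1_powR ?ler1n// invf_le1.
rewrite -[X in X * _ `^ (p-1)](powRr1 K0); apply: eq_lexx.
rewrite powRr1// /l.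
have -> : K * (K / t) `^ (p - 1) = K `^ p * t `^ (1 - p).
  rewrite powRM ?invr_ge0 ?ltW// mulrA mulr_powRB1//; congr (_ * _).
  by rewrite -powR_inv1 ?ltW// -powRrM; congr (_ `^ _); ring.
rewrite powRM ?powR_ge0// -!powRrM mulfV ?gt_eqF// powRr1//; congr (_ * _ `^ _).
by rewrite mulrBl mul1r mulfV ?gt_eqF.
Qed.

Lemma matvecD (m N : nat) (A : 'I_m -> 'I_N -> R) u v j :
  matvec A (fun i => u i + v i) j = matvec A u j + matvec A v j.
Proof. by rewrite /matvec -big_split; apply: eq_bigr => i _; rewrite mulrDr. Qed.

Lemma matvecZ (m N : nat) (A : 'I_m -> 'I_N -> R) c u j :
  matvec A (fun i => c * u i) j = c * matvec A u j.
Proof. by rewrite /matvec mulr_sumr; apply: eq_bigr => i _; rewrite mulrCA. Qed.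

Lemma matvecB (m N : nat) (A : 'I_m -> 'I_N -> R) u v j :
  matvec A (fun i => u i - v i) j = matvec A u j - matvec A v j.
Proof. by rewrite /matvec -sumrB; apply: eq_bigr => i _; rewrite mulrBr. Qed.

(** As [x + h] is no longer than [x], the mass of [h] off the support of [y] is bounded by its mass
    on the support, up to the error [x - y]. The sparse [y] is arbitrary, so attainment of the
    infimum in [sigma_s1] need not be discussed. *)
Lemma l1_cone (N s : nat) (x y h : 'I_N -> R) : (l0norm y <= s)%N ->
  n1 (fun i => x i + h i) <= n1 x ->
  n1 h <= 2 * Num.sqrt s%:R * n2 h + 2 * n1 (fun i => x i - y i).
Proof.
move=> ys xh; pose S := [set i | y i != 0]%SET.
have Ss : (#|S| <= s)%N.
  apply: leq_trans ys; rewrite /l0norm; apply: eq_leq; apply: eq_card => i.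
  by rewrite !inE; apply/idP/idP; rewrite inE.
have hS := n1_on_le S h.
have sS : Num.sqrt #|S|%:R * n2 h <= Num.sqrt s%:R * n2 h.
  by rewrite ler_wpM2r ?n2_ge0// ler_wsqrtr// ler_nat.
have : n1 h <= 2 * (\sum_(i in S) `|h i|) + 2 * n1 (fun i => x i - y i) +
    (n1 (fun i => x i + h i) - n1 x).
  rewrite /n1 !mulr_sumr [X in _ <= X + _ + _]big_mkcond /= -sumrB -!big_split /=.
  apply: ler_sum => i _; rewrite inE; case: eqP => [->|_] /=.
    by rewrite subr0; have := ler_normB (x i + h i) (x i);
       rewrite [x i + h i]addrC addrK; lra.
  have := ler_normB (x i + h i) (h i); rewrite addrK.
  by have := normr_ge0 (x i - y i); lra.
lra.
Qed.

Section Recovery.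
Variables (m N s : nat) (A : 'I_m -> 'I_N -> R) (ss rho tau d c2 : R).
Variable q : ('I_m -> R) -> R.
Hypotheses (ss0 : 0 < ss) (rho0 : 0 < rho) (tau0 : 0 < tau).
Hypotheses (s1 : (1 <= s)%N) (c20 : 0 <= c2) (c21 : c2 <= 1)
  (c2rho : Num.sqrt c2 * rho <= 1 / 4) (s_le : s%:R <= c2 * ss).
Hypothesis width : forall u, n2 u <= rho * n1 u / Num.sqrt ss + tau * n2 (matvec A u).
Hypothesis quotient : forall w, exists2 u, (forall j, matvec A u j = w j) &
  n1 u <= d * Num.sqrt ss * q w.
Hypothesis qZ : forall c w, 0 <= c -> q (fun j => c * w j) = c * q w.
Hypothesis q_ge : forall w, n2 w <= q w.

(** The width property and the cone condition bound the two norms of the error by each other;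
    [sqrt(c2) * rho <= 1/4] makes the feedback a factor 1/2, which is absorbed. *)
Lemma l1_min_error (x x' z y : 'I_N -> R) (e : R) :
  (l0norm y <= s)%N -> n1 z <= n1 x' ->
  n2 (matvec A (fun i => z i - x' i)) <= e ->
  n1 (fun i => x' i - z i) + Num.sqrt ss * n2 (fun i => x' i - z i) <=
  Num.sqrt ss * (tau * e * (5 + 4 * rho)) + 4 * (1 + rho) * n1 (fun i => x' i - y i).
Proof.
move=> ys zx Ae; pose h i := z i - x' i.
have <- : n1 h = n1 (fun i => x' i - z i) by rewrite -n1N; apply: eq_n1 => i; rewrite opprB.
have <- : n2 h = n2 (fun i => x' i - z i) by rewrite -n2N; apply: eq_n2 => i; rewrite opprB.
have S0 : 0 < Num.sqrt ss by rewrite sqrtr_gt0.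
have cone : n1 h <= 2 * Num.sqrt s%:R * n2 h + 2 * n1 (fun i => x' i - y i).
  apply: l1_cone => //; apply: le_trans zx.
  by apply: eq_lexx; apply: eq_n1 => i; rewrite /h; ring.
have w := width h; rewrite -/h in Ae.
have sS : Num.sqrt s%:R <= Num.sqrt c2 * Num.sqrt ss.
  by rewrite -sqrtrM// ler_wsqrtr.
have r1 : Num.sqrt c2 <= 1 by rewrite -[leRHS]sqrtr1 ler_wsqrtr.
have r0 : 0 <= Num.sqrt c2 by exact: sqrtr_ge0.
move: w cone Ae sS; have := n1_ge0 h; have := n2_ge0 h.
have := n1_ge0 (fun i => x' i - y i); have := n2_ge0 (matvec A h); have := sqrtr_ge0 (s%:R : R).
set S := Num.sqrt ss in S0 *; set a := n1 h; set b := n2 h; set g := n1 _.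
set t := Num.sqrt s%:R; set r := Num.sqrt c2 in r0 r1 *; set f := n2 _.
move=> t0 f0 g0 b0 a0 w cone fe tS.
have e0 : 0 <= e by apply: le_trans fe.
have w' : S * b <= rho * a + tau * S * e.
  have : S * b <= S * (rho * a / S + tau * f) by rewrite ler_wpM2l// ltW.
  have -> : S * (rho * a / S + tau * f) = rho * a + tau * S * f by field; rewrite gt_eqF.
  have : tau * S * f <= tau * S * e by rewrite ler_wpM2l// mulr_ge0 ?ltW.
  lra.
have tb : t * b <= r * (S * b) by rewrite mulrA ler_wpM2r.
have rb : r * (S * b) <= r * (rho * a + tau * S * e) by rewrite ler_wpM2l.
have ra : r * rho * a <= 1 / 4 * a by rewrite ler_wpM2r.
have re : r * (tau * S * e) <= tau * S * e.
  by rewrite -[leRHS]mul1r ler_wpM2r// !mulr_ge0// ltW.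
have a4 : a <= 4 * (tau * S * e) + 4 * g by lra.
have : rho * a <= rho * (4 * (tau * S * e) + 4 * g) by rewrite ler_wpM2l// ltW.
lra.
Qed.

(** The part of the noise exceeding [eta] is moved into the signal: by the quotient property it is
    [A u] with [u] short, so [x + u] is feasible and competes with the minimiser [z]. The error
    relative to [x + u] is then small, and [u] is small by its l1-norm and the width property. *)
Lemma recovery (eta p : R) (x z : 'I_N -> R) (w : 'I_m -> R) :
  0 <= eta -> 1 <= p -> p <= 2 ->
  is_l1_min A eta (fun j => matvec A x j + w j) z ->
  lpnorm p (fun i => x i - z i) <=
    8 * (1 + rho) / (s%:R `^ (1 - p^-1)) * sigma_s1 s x
    + ss `^ (p^-1 - 2^-1) *
      (4 * tau * (5 + 4 * rho) * eta + 2 * (5 * (1 + rho) * d + tau) * (q w / lpnorm 2 w)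
         * Num.max (lpnorm 2 w - eta) 0).
Proof.
move=> eta0 p1 p2 [zfeas zmin].
rewrite !lpnorm2E in zfeas *.
(* [c] is the fraction of [w] to be moved; what is left has norm at most [eta]. For [w = 0],
   division by zero returns [c = 0]. *)
set mx := Num.max _ _; pose c := mx / n2 w.
have mx0 : 0 <= mx by rewrite le_max lexx orbT.
have c0 : 0 <= c by rewrite divr_ge0// n2_ge0.
have q0 w' : 0 <= q w' by apply: le_trans (q_ge w'); exact: n2_ge0.
have [u Au u1] := quotient (fun j => c * w j).
rewrite qZ// in u1.
have cq : q w / n2 w * mx = c * q w by rewrite /c; ring.
rewrite -[_ * (q w / n2 w) * mx]mulrA cq.
pose x' i := x i + u i.
have S0 : 0 < Num.sqrt ss by rewrite sqrtr_gt0.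
have x'feas : n2 (fun j => matvec A x' j - (matvec A x j + w j)) <= eta.
  rewrite (eq_n2 (v := fun j => (c - 1) * w j)); last first.
    by move=> j; rewrite matvecD Au; ring.
  rewrite n2Z /c /mx; have [wE|wn] := leP (n2 w) eta.
    rewrite max_r ?subr_le0// mul0r sub0r normrN1 mul1r//.
  rewrite max_l; last by rewrite subr_ge0 ltW.
  have wp : 0 < n2 w by apply: le_lt_trans wn.
  have -> : (n2 w - eta) / n2 w - 1 = - (eta / n2 w) by field; rewrite gt_eqF.
  by rewrite normrN ger0_norm ?divr_ge0 ?n2_ge0// divfK ?gt_eqF.
have zx' : n1 z <= n1 x'.
  by rewrite -!lpnorm1E; apply: zmin; rewrite lpnorm2E.
have Ah : n2 (matvec A (fun i => z i - x' i)) <= 2 * eta.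
  apply: le_trans (_ : n2 (fun j => (matvec A z j - (matvec A x j + w j)) +
     - (matvec A x' j - (matvec A x j + w j))) <= _).
    apply: eq_lexx; apply: eq_n2 => j.
    by rewrite matvecB; ring.
  by apply: le_trans (n2D _ _) _; rewrite n2N; lra.
have u2 : Num.sqrt ss * n2 u <= rho * n1 u + tau * Num.sqrt ss * (c * q w).
  have Auq : n2 (matvec A u) <= c * q w.
    by rewrite (eq_n2 Au) -qZ//.
  have : Num.sqrt ss * n2 u <= Num.sqrt ss * (rho * n1 u / Num.sqrt ss + tau * n2 (matvec A u)).
    by rewrite ler_wpM2l// ltW.
  have -> : Num.sqrt ss * (rho * n1 u / Num.sqrt ss + tau * n2 (matvec A u)) =
     rho * n1 u + tau * Num.sqrt ss * n2 (matvec A u) by field; rewrite gt_eqF.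
  have : tau * Num.sqrt ss * n2 (matvec A u) <= tau * Num.sqrt ss * (c * q w).
    by rewrite ler_wpM2l// mulr_ge0 ?ltW.
  lra.
set X := lpnorm p _; set D := 4 * tau * _; set E := 2 * (5 * _ * d + tau).
have ssp : 0 < ss `^ (p^-1 - 1) by rewrite powR_gt0.
have pV1 : p^-1 <= 1 by rewrite invf_le1; lra.
have sp : 0 < s%:R `^ (1 - p^-1) :> R by rewrite powR_gt0// ltr0n.
have s_ss : s%:R <= ss by apply: le_trans s_le _; rewrite ler_piMl// ltW.
have main y : (l0norm y <= s)%N -> X <= 8 * (1 + rho) / (s%:R `^ (1 - p^-1)) *
    n1 (fun i => x i - y i) + ss `^ (p^-1 - 2^-1) * (D * eta + E * (c * q w)).
  move=> ys; have err := l1_min_error x ys zx' Ah.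
  have g1 : n1 (fun i => x' i - y i) <= n1 (fun i => x i - y i) + n1 u.
    apply: le_trans (n1D _ _); apply: eq_lexx.
    by apply: eq_n1 => i; rewrite /x'; ring.
  have g2 : n1 (fun i => x i - z i) <= n1 (fun i => x' i - z i) + n1 u.
    rewrite -(n1N u); apply: le_trans (n1D _ _); apply: eq_lexx.
    by apply: eq_n1 => i; rewrite /x'; ring.
  have g3 : n2 (fun i => x i - z i) <= n2 (fun i => x' i - z i) + n2 u.
    rewrite -(n2N u); apply: le_trans (n2D _ _); apply: eq_lexx.
    by apply: eq_n2 => i; rewrite /x'; ring.
  pose K := Num.sqrt ss * (D / 2 * eta + E / 2 * (c * q w)) + 4 * (1 + rho) * n1 (fun i => x i - y i).
  have XK : X <= 2 * K * ss `^ (p^-1 - 1).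
    apply: lpnorm_interp => //.
    have : Num.sqrt ss * n2 (fun i => x i - z i) <=
      Num.sqrt ss * (n2 (fun i => x' i - z i) + n2 u) by rewrite ler_wpM2l// ltW.
    have : 4 * (1 + rho) * n1 (fun i => x' i - y i) <=
      4 * (1 + rho) * (n1 (fun i => x i - y i) + n1 u) by rewrite ler_wpM2l// mulr_ge0// addr_ge0// ltW.
    have : rho * n1 u <= rho * (d * Num.sqrt ss * (c * q w)) by rewrite ler_wpM2l// ltW.
    rewrite /K /D /E; lra.
  apply: le_trans XK _.
  have e1 : Num.sqrt ss * ss `^ (p^-1 - 1) = ss `^ (p^-1 - 2^-1).
    rewrite -powR12_sqrt ?ltW// -powRD; first by congr (_ `^ _); field; lra.
    by rewrite (gt_eqF ss0) implybT.
  have e2 : ss `^ (p^-1 - 1) <= (s%:R `^ (1 - p^-1))^-1.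
    rewrite -powRN (_ : - (1 - p^-1) = - (1 - p^-1)) // (_ : p^-1 - 1 = - (1 - p^-1)); last by ring.
    rewrite !powRN lef_pV2 ?posrE ?powR_gt0 ?ltr0n//.
    by rewrite ge0_ler_powR// ?nnegrE ?ler0n ?subr_ge0// ltW.
  have -> : 2 * K * ss `^ (p^-1 - 1) = ss `^ (p^-1 - 1) * (8 * (1 + rho) * n1 (fun i => x i - y i))
     + (Num.sqrt ss * ss `^ (p^-1 - 1)) * (D * eta + E * (c * q w)).
    by rewrite /K; field.
  by rewrite e1 lerD2r [8 * _ / _]mulrC -[leRHS]mulrA ler_wpM2r// mulr_ge0 ?n1_ge0// mulr_ge0// addr_ge0// ltW.
pose C := 8 * (1 + rho) / s%:R `^ (1 - p^-1).
have C0 : 0 < C by rewrite divr_gt0// mulr_gt0// addr_gt0.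
rewrite -/C; pose r := ss `^ (p^-1 - 2^-1) * (D * eta + E * (c * q w)).
(* The estimate holds for every sparse [y]; solved for the l1-error it passes to the infimum. *)
suff : (X - r) / C <= sigma_s1 s x by rewrite ler_pdivrMr// -/r; lra.
apply: lb_le_inf.
  exists (lpnorm 1 (fun i => x i - 0)), (fun=> 0) => //=.
  rewrite /l0norm eq_card0// => i; rewrite !inE; apply/negbTE/negP; rewrite inE /=.
  by rewrite eqxx.
move=> _ [v /= vs <-]; rewrite lpnorm1E ler_pdivrMr//.
by have := main _ vs; rewrite -/C -/r; lra.
Qed.

End Recovery.
End Deterministic.

(** * Duality in finite dimension: solving [A u = w] with small l1-norm *)

Section Separation.
Context {R : realType}.

Lemma sum_continuous_rV (N : nat) (I : finType) (F : I -> 'rV[R]_N -> R) :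
  (forall i, continuous (F i)) -> continuous (fun v => \sum_i F i v).
Proof.
move=> cF; apply: continuous_big => // ; exact: add_continuous.
Qed.

(** If [w] lies outside the compact image of the l1-ball, the residual [y] at the nearest point
    separates: its pairing with [w] exceeds its maximum [c] over the image by [n2 y ^+ 2], while the
    hypothesis applied to [y] allows at most [c]. *)
Lemma solve_l1 (m N : nat) (A : 'I_m -> 'I_N -> R) (w : 'I_m -> R) (r : R) : 0 <= r ->
  (forall (y : 'I_m -> R) (M : R), 0 <= M -> (forall i, `|\sum_j A j i * y j| <= M) ->
     \sum_j y j * w j <= r * M) ->
  exists2 u : 'I_N -> R, (forall j, matvec A u j = w j) & n1 u <= r.
Proof.
move=> r0 dual.
pose f (v : 'rV[R]_N) := \sum_j (matvec A (v ord0) j - w j) ^+ 2.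
pose K : set 'rV[R]_N := [set v | n1 (v ord0) <= r].
have cont_coord i : continuous (fun v : 'rV[R]_N => v ord0 i).
  exact: coord_continuous.
have cn1 : continuous (fun v : 'rV[R]_N => n1 (v ord0)).
  apply: sum_continuous_rV => i v; apply: (continuous_comp (cont_coord i v)).
  exact: norm_continuous.
have cf : continuous f.
  apply: sum_continuous_rV => j v.
  have c1 : {for v, continuous (fun v : 'rV[R]_N => matvec A (v ord0) j - w j)}.
    apply: (@cvgB R _ _ (nbhs v) _ (fun v0 : 'rV[R]_N => matvec A (v0 ord0) j) (fun=> w j));
      last exact: cvg_cst.
    apply: (@sum_continuous_rV N _ (fun i (v : 'rV[R]_N) => A j i * v ord0 i)) => i v'.
    apply: (@cvgM R _ (nbhs v') _ (fun=> A j i) (fun v0 : 'rV[R]_N => v0 ord0 i)).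
      exact: cvg_cst.
    exact: cont_coord.
  have -> : (fun v0 : 'rV[R]_N => (matvec A (v0 ord0) j - w j) ^+ 2) =
    (fun v0 : 'rV[R]_N => (matvec A (v0 ord0) j - w j) * (matvec A (v0 ord0) j - w j)).
    by apply: funext => v0; rewrite expr2.
  exact: (@cvgM R _ (nbhs v) _ _ _ _ _ c1 c1).
have Kc : compact K.
  apply: (@subclosed_compact _ _ [set v : 'rV[R]_N | forall i, `[- r, r]%classic (v ord0 i)]).
  - apply: (@closed_comp _ _ (fun v : 'rV[R]_N => n1 (v ord0)) [set x | x <= r]).
      by move=> v _; exact: cn1.
    exact: closed_le.
  - exact: (@rV_compact _ _ (fun=> `[- r, r]%classic) (fun=> @segment_compact _ _ _)).
  - move=> v /= vr i; rewrite in_itv /= -ler_norml; apply: le_trans vr.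
    by rewrite /n1 (bigD1 i)//= lerDl sumr_ge0.
have K0 : K !=set0.
  by exists 0; rewrite /K /= /n1 big1// => i _; rewrite mxE normr0.
have [u0 /set_mem u0K u0min] := EVT_min_rV K0 Kc (continuous_subspaceT cf).
pose u i := u0 ord0 i; pose y j := w j - matvec A u j.
have [y0|yn0] := eqVneq (n2 y) 0.
  by exists u => // j; have := n2_eq0 y0 j; rewrite /y => /eqP; rewrite subr_eq0 => /eqP.
exfalso.
have yp : 0 < n2 y ^+ 2 by rewrite exprn_gt0// lt_neqAle eq_sym yn0 n2_ge0.
(* First-order optimality at the projection of [w] onto the image of the l1-ball. *)
have opt (v : 'I_N -> R) : n1 v <= r -> \sum_j y j * matvec A v j <= \sum_j y j * matvec A u j.
  move=> vr; pose g j := matvec A v j - matvec A u j.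
  suff : \sum_j y j * g j <= 0.
    rewrite /g; under eq_bigr do rewrite mulrBr.
    by rewrite sumrB subr_le0.
  rewrite leNgt; apply/negP => dp; set D := \sum_j _ in dp.
  pose G := \sum_j g j ^+ 2.
  have G0 : 0 <= G by exact: sum_sqr_ge0.
  have step t : 0 <= t -> t <= 1 -> 2 * t * D <= t ^+ 2 * G.
    move=> t0 t1; pose ut : 'rV[R]_N := \row_i ((1 - t) * u i + t * v i).
    have utK : K ut.
      rewrite /K /= (eq_n1 (v := fun i => (1 - t) * u i + t * v i)) => [|i]; last by rewrite mxE.
      apply: le_trans (n1D _ _) _.
      have e (c : R) (z : 'I_N -> R) : 0 <= c -> n1 (fun i => c * z i) = c * n1 z.
        by move=> c0; rewrite /n1 mulr_sumr; apply: eq_bigr => i _; rewrite normrM ger0_norm.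
      rewrite !e//; last lra.
      have ur : n1 u <= r by exact: u0K.
      nra.
    have := u0min ut (mem_set utK).
    have -> : f u0 = \sum_j y j ^+ 2.
      by apply: eq_bigr => j _; rewrite /y -[in RHS]sqrrN opprB.
    have -> : f ut = \sum_j y j ^+ 2 - 2 * t * D + t ^+ 2 * G.
      rewrite /D /G !mulr_sumr -sumrB -big_split /=; apply: eq_bigr => j _.
      have -> : matvec A (ut ord0) j = matvec A u j + t * g j.
        rewrite /g -matvecB -matvecZ -matvecD /matvec; apply: eq_bigr => i _.
        by rewrite mxE; ring.
      by rewrite /y; ring.
    lra.
  have GD : 0 < G + D by lra.
  (* This step length lies in ]0, 1] and satisfies [t G < 2 D], so moving towards [v] would decrease
     the distance. *)
  pose t := D / (G + D).
  have t0 : 0 < t by rewrite divr_gt0.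
  have t1 : t <= 1 by rewrite ler_pdivrMr// mul1r; lra.
  have := step t (ltW t0) t1.
  have -> : t ^+ 2 * G = t * (t * G) by ring.
  have -> : 2 * t * D = t * (2 * D) by ring.
  rewrite ler_pM2l// /t mulrAC ler_pdivlMr//; nra.
pose c := \sum_j y j * matvec A u j.
have cE : \sum_j y j * w j = c + n2 y ^+ 2.
  rewrite n2_sqr /c -big_split; apply: eq_bigr => j _ /=.
  by have -> : w j = matvec A u j + y j; rewrite /y; ring.
have c0 : 0 <= c.
  have := opt (fun=> 0); rewrite -/c {1}/n1 big1 => [|i _]; last by rewrite normr0.
  move=> /(_ r0); rewrite big1// => j _.
  by rewrite /matvec big1 ?mulr0// => i _; rewrite mulr0.
(* Optimality is tested at a vertex of the ball, [r] times a signed unit vector. *)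
have col i : r * `|\sum_j A j i * y j| <= c.
  set a := \sum_j _.
  pose v k := if k == i then Num.sg a * r else 0.
  have := opt v; rewrite -/c.
  have -> : n1 v = `|Num.sg a| * r.
    rewrite /n1 (bigD1 i)//= big1 => [|k /negbTE ki]; last by rewrite /v ki normr0.
    by rewrite /v eqxx normrM (ger0_norm r0) addr0.
  have -> : \sum_j y j * matvec A v j = r * `|a|.
    have -> : `|a| = Num.sg a * a by rewrite -normrEsg.
    rewrite /a !mulr_sumr; apply: eq_bigr => j _.
    rewrite /matvec (bigD1 i)//= big1 => [|k /negbTE ki]; last by rewrite /v ki mulr0.
    by rewrite /v eqxx -/a; ring.
  apply; rewrite ler_piMl// normr_sg.
  by case: (a != 0).
have [rp|] := ltP 0 r.
  have := dual y (c / r); rewrite divr_ge0// => /(_ isT).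
  rewrite [r * _]mulrC divfK ?gt_eqF// => h.
  have : \sum_j y j * w j <= c.
    by apply: h => i; rewrite ler_pdivlMr// mulrC.
  by rewrite cE; lra.
(* For [r = 0] the quotient [c / r] is meaningless; any common bound for the columns serves, as it
   is multiplied by 0. *)
move=> rle; have re : r = 0 by lra.
have := dual y (\sum_i `|\sum_j A j i * y j|).
rewrite sumr_ge0// => /(_ isT); rewrite re mul0r => h.
have : \sum_j y j * w j <= 0.
  by apply: h => i; rewrite [leRHS](bigD1 i)//= lerDl sumr_ge0.
by rewrite cE; lra.
Qed.

End Separation.

(** * Discretisation of the entries *)

Section Quantizer.
Context {R : realType}.

Definition gneg n (g : gint n) : gint n := omap (fun a => (a.1, ~~ a.2)) g.

Lemma gnegK n : involutive (@gneg n).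
Proof. by case=> [[a s]|] //=; rewrite negbK. Qed.

Lemma gval_neg n (g : gint n) : gval (gneg g) = - gval g :> R.
Proof. by case: g => [[a s]|]; rewrite /= ?oppr0//; case: s; rewrite /= ?expr0 ?expr1; ring. Qed.

Variables (K : nat) (h : R).
Hypotheses (h0 : 0 < h).

(* Rounding to [h Z] towards [0], saturated at magnitude [K h]. *)
Definition qlev (x : R) : nat := minn (Num.truncn (`|x| / h)) K.

Definition qz (x : R) : gint K :=
  if qlev x is n.+1 then omap (fun a => (a, x < 0)) (insub n) else None.

Lemma qlev0 : qlev 0 = 0%N.
Proof. by rewrite /qlev normr0 mul0r truncn0 min0n. Qed.

Lemma qlev_le x : (qlev x <= K)%N.
Proof. exact: geq_minr. Qed.

Let nx0 (x : R) : 0 <= `|x| / h. Proof. by rewrite divr_ge0// ltW. Qed.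

Lemma qlev_ge n x : (n <= qlev x)%N = (n <= K)%N && (n%:R * h <= `|x|).
Proof. by rewrite leq_min truncn_ge_nat// andbC ler_pdivlMr. Qed.

Lemma qzE x : qz x = if qlev x == 0%N then None else
   omap (fun a => (a, x < 0)) (insub (qlev x).-1).
Proof. by rewrite /qz; case: (qlev x). Qed.

Lemma gval_qz x : gval (qz x) = Num.sg x * (qlev x)%:R.
Proof.
rewrite /qz; have := qlev_le x; case e : (qlev x) => [|n] nK /=; first by rewrite mulr0.
rewrite insubT /= neqr0_sign//; apply/eqP => x0.
have : (1 <= qlev x)%N by rewrite e.
by rewrite qlev_ge x0 normr0 mul1r => /andP[_]; rewrite leNgt h0.
Qed.

Lemma norm_gval_qz x : `|gval (qz x)| = (qlev x)%:R :> R.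
Proof.
rewrite gval_qz normrM normr_sg normr_nat.
have [->|_] := eqVneq x 0; last by rewrite mul1r.
by rewrite qlev0 mulr0.
Qed.

Lemma qz_opp x : qz (- x) = gneg (qz x).
Proof.
have e : qlev (- x) = qlev x by rewrite /qlev normrN.
rewrite !qzE e; case: eqP => // /eqP l0; case: insubP => //= a _ _.
congr (Some (_, _)); rewrite oppr_lt0 ltNge le_eqVlt negb_or.
suff -> : x != 0 by [].
apply: contraNN l0 => /eqP ->.
by rewrite qlev0.
Qed.

Lemma qlev_h_le x : h * (qlev x)%:R <= `|x|.
Proof. by have := leqnn (qlev x); rewrite qlev_ge => /andP[_]; rewrite mulrC. Qed.

Lemma qz_norm_le x : `|h * gval (qz x)| <= `|x|.
Proof. by rewrite normrM (gtr0_norm h0) norm_gval_qz qlev_h_le. Qed.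

Lemma qlev_lt x : qlev x = K \/ `|x| < h * (qlev x)%:R + h.
Proof.
have [e|ne] := eqVneq (qlev x) K; [by left|right].
have lt : (qlev x < K)%N by rewrite ltn_neqAle ne qlev_le.
have : ~~ (qlev x < qlev x)%N by rewrite ltnn.
rewrite qlev_ge lt /= -ltNge -natr1 mulrDl mul1r mulrC.
exact.
Qed.

Lemma qz_err x : `|x| < K%:R * h -> `|x - h * gval (qz x)| <= h.
Proof.
move=> xK; have xl : `|x| < h * (qlev x)%:R + h.
  case: (qlev_lt x) => // e; rewrite e mulrC; apply: lt_le_trans xK _.
  by rewrite lerDl ltW.
have -> : x - h * gval (qz x) = Num.sg x * (`|x| - h * (qlev x)%:R).
  by rewrite gval_qz {1}[x]numEsg; ring.
rewrite normrM; apply: (@le_trans _ _ (`| `|x| - h * (qlev x)%:R |)).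
  by rewrite ler_piMl// normr_sg; case: (x != 0).
rewrite ger0_norm; first by lra.
by rewrite subr_ge0 qlev_h_le.
Qed.

Lemma qz_norm_ge x : Num.min (`|x| - h) (K%:R * h) <= `|h * gval (qz x)|.
Proof.
rewrite normrM (gtr0_norm h0) norm_gval_qz ge_min.
case: (qlev_lt x) => [->|lt]; first by rewrite mulrC lexx orbT.
by apply/orP; left; lra.
Qed.

Lemma measurable_cell (v : gint K) : measurable [set x : R | qz x = v].
Proof.
have mge n : measurable [set x : R | (n <= qlev x)%N].
  have [nK|nK] := boolP (n <= K)%N; last first.
    have -> : [set x : R | (n <= qlev x)%N] = set0; last exact: measurable0.
    by apply/seteqP; split => // x /=; rewrite qlev_ge (negbTE nK).
  have -> : [set x : R | (n <= qlev x)%N] = (fun x : R => n%:R * h <= `|x|) @^-1` [set true].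
    by apply/seteqP; split => x /=; rewrite qlev_ge nK.
  rewrite -[X in measurable X]setTI; apply: measurable_fun_ler => //.
have meq n : measurable [set x : R | qlev x = n].
  have -> : [set x : R | qlev x = n] =
     [set x : R | (n <= qlev x)%N] `\` [set x : R | (n < qlev x)%N].
    apply/seteqP; split => x /=; first by move=> ->; rewrite leqnn ltnn.
    by case=> h1 /negP; rewrite -leqNgt => h2; apply/eqP; rewrite eqn_leq h1 h2.
  exact: measurableD.
case: v => [[a s]|]; last first.
  rewrite (_ : [set x | _] = [set x | qlev x = 0%N]); first exact: meq.
  apply/seteqP; split => x /=; rewrite qzE; last by move=> ->.
  case: eqP => // _; have := qlev_le x.
  case: insubP => //=; case: (qlev x) => [|n] //= h1 h2.
  by rewrite h2 in h1.
have -> : [set x | qz x = Some (a, s)] = [set x | qlev x = a.+1] `&` [set x : R | (x < 0) = s].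
  apply/seteqP; split => x /=; rewrite qzE.
    case: eqP => // /eqP l0; case: insubP => //= a' _ a'E [aa ss]; split=> //.
    by rewrite -aa a'E prednK// lt0n.
  move=> [la <-]; rewrite la /= insubT//= => lt.
  by congr (Some (_, _)); apply: val_inj.
apply: measurableI; first exact: meq.
have -> : [set x : R | (x < 0) = s] = (fun x : R => x < 0) @^-1` [set s] by [].
by rewrite -[X in measurable X]setTI; apply: measurable_fun_ltr.
Qed.

End Quantizer.

(** * The law of a discretised entry *)

Section DiscreteLaw.
Context {d : measure_display} {T : measurableType d} {R : realType}.
Variables (P : probability T R) (X : {RV P >-> R}) (K : nat) (h : R).
Hypothesis h0 : 0 < h.

Let V := gint K.
Definition cell (v : gint K) : set T := X @^-1` [set x | qz K h x = v].
Definition pv (v : gint K) : R := fine (P (cell v)).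
Definition qval (v : gint K) : R := h * gval v.

Lemma cell_measurable v : measurable (cell v).
Proof. by apply: measurable_funPTI; exact: measurable_cell. Qed.

Lemma pvE v : (pv v)%:E = P (cell v).
Proof. by rewrite fineK// fin_num_measure//; exact: cell_measurable. Qed.

Lemma pv_ge0 v : 0 <= pv v.
Proof. by rewrite -lee_fin pvE measure_ge0. Qed.

Let Q (w : T) : gint K := qz K h (X w).

Let cellsE (f : V -> R) w : (f (Q w))%:E = (\sum_v ((f v)%:E * (\1_(cell v) w)%:E))%E.
Proof.
rewrite (bigD1 (Q w))//= big1 ?adde0 => [|v vQ].
  by rewrite indicE mem_set// mule1.
rewrite indicE memNset ?mule0// /cell /= => e.
by rewrite -e eqxx in vQ.
Qed.

Lemma measurable_cells (f : V -> R) : measurable_fun setT (fun w => (f (Q w))%:E).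
Proof.
rewrite (_ : (fun w => _) = (fun w => \sum_v ((f v)%:E * (\1_(cell v) w)%:E)%E)); last first.
  by apply: funext => w; exact: cellsE.
apply: emeasurable_sum => v; apply: emeasurable_funM => //.
by apply/measurable_EFinP; apply: measurable_indic; exact: cell_measurable.
Qed.

Lemma integral_cells (f : V -> R) : (forall v, 0 <= f v) ->
  (\int[P]_w (f (Q w))%:E)%E = (\sum_v pv v * f v)%:E.
Proof.
move=> f0; under eq_integral do rewrite cellsE.
rewrite ge0_integral_sum//; last 2 first.
- move=> v; apply: emeasurable_funM => //.
  by apply/measurable_EFinP; apply: measurable_indic; exact: cell_measurable.
- by move=> v w _; rewrite mule_ge0// lee_fin.
rewrite -sumEFin; apply: eq_bigr => v _.
have mi : measurable_fun setT (fun w => (\1_(cell v) w : R)%:E).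
  by apply/measurable_EFinP; apply: measurable_indic; exact: cell_measurable.
rewrite ge0_integralZl_EFin// integral_indic//; last exact: cell_measurable.
by rewrite setIT EFinM pvE muleC.
Qed.

Lemma cells_le (f : V -> R) (g : T -> R) : measurable_fun setT g -> (forall v, 0 <= f v) ->
  (forall w, f (Q w) <= g w) -> ((\sum_v pv v * f v)%:E <= \int[P]_w (g w)%:E)%E.
Proof.
move=> mg f0 fg; rewrite -integral_cells//; apply: ge0_le_integral => //.
- by move=> w _; rewrite lee_fin.
- exact: measurable_cells.
- exact/measurable_EFinP.
- by move=> w _; rewrite lee_fin.
Qed.

Lemma cells_ge (f : V -> R) (g : T -> R) : measurable_fun setT g -> (forall v, 0 <= f v) ->
  (forall w, 0 <= g w) -> (forall w, g w <= f (Q w)) ->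
  (\int[P]_w (g w)%:E <= (\sum_v pv v * f v)%:E)%E.
Proof.
move=> mg f0 g0 gf; rewrite -integral_cells//; apply: ge0_le_integral => //.
- by move=> w _; rewrite lee_fin.
- exact/measurable_EFinP.
- exact: measurable_cells.
- by move=> w _; rewrite lee_fin.
Qed.

Lemma pv_sum1 : \sum_v pv v = 1.
Proof.
have := @integral_cells (fun=> 1) (fun=> ler01).
have -> : (\int[P]_w (1 : R)%:E = 1)%E.
  by rewrite -[RHS](@probability_setT _ _ _ P) -[RHS]mul1e -integral_cst.
by under [in RHS]eq_bigr do rewrite mulr1; case.
Qed.

Lemma pv_neg v : symmetric_rv X -> pv (gneg v) = pv v.
Proof.
move=> sym; rewrite /pv /cell sym; last exact: measurable_cell.
congr (fine (P _)); apply/seteqP; split => w /=; rewrite qz_opp//.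
  by move/(can_inj (@gnegK K)).
by move=> ->.
Qed.

Lemma qval_neg v : qval (gneg v) = - qval v.
Proof. by rewrite /qval gval_neg mulrN. Qed.

Lemma qval_le w : `|qval (Q w)| <= `|X w|.
Proof. exact: qz_norm_le. Qed.

Lemma moment2_le : centered_unit_variance X -> \sum_v pv v * qval v ^+ 2 <= 1.
Proof.
move=> [_ X2]; rewrite -lee_fin -[leRHS]X2 expectation.unlock.
apply: cells_le; first exact: measurable_funX.
- by move=> v; exact: sqr_ge0.
- move=> w; rewrite -[leLHS]real_normK ?num_real// -[leRHS]real_normK ?num_real//.
  by rewrite lerXn2r ?nnegrE// qval_le.
Qed.

Variable k4 : R.
Hypotheses (k41 : 1 <= k4) (X4 : (\int[P]_w (X w ^+ 4)%:E <= k4%:E)%E).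

Lemma moment4_le : \sum_v pv v * qval v ^+ 4 <= k4.
Proof.
rewrite -lee_fin; apply: le_trans X4; apply: cells_le; first exact: measurable_funX.
- by move=> v; exact: exprn_even_ge0.
- move=> w; have e x : x ^+ 4 = `|x| ^+ 4 :> R.
    by rewrite -normrX ger0_norm// exprn_even_ge0.
  by rewrite e [leRHS]e lerXn2r ?nnegrE// qval_le.
Qed.

(** Below saturation [|X| <= |qval| + h], above it [X^2 <= X^4 / (K h)^2]; so the unit variance is
    at most twice the discrete second moment plus [2 h^2 + k4 / (K h)^2]. *)
Lemma moment2_ge : (0 < K)%N -> centered_unit_variance X ->
  2 * h ^+ 2 + k4 / (K%:R * h) ^+ 2 <= 1 / 2 -> 1 / 4 <= \sum_v pv v * qval v ^+ 2.
Proof.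
move=> K0 [_ X2] small; pose c := ((K%:R * h) ^+ 2)^-1.
have Kh : 0 < K%:R * h by rewrite mulr_gt0// ltr0n.
have c0 : 0 <= c by rewrite invr_ge0 sqr_ge0.
pose f (v : V) := 2 * qval v ^+ 2 + 2 * h ^+ 2.
have f0 v : 0 <= f v by rewrite /f addr_ge0// mulr_ge0// sqr_ge0.
have X40 w : 0 <= X w ^+ 4 by exact: exprn_even_ge0.
have m4 : measurable_fun setT (fun w => (X w ^+ 4)%:E).
  by apply/measurable_EFinP; exact: measurable_funX.
have : (1%:E <= (\sum_v pv v * f v)%:E + (c * k4)%:E)%E.
  rewrite -[leLHS]X2 expectation.unlock -integral_cells//.
  apply: (@le_trans _ _ (\int[P]_w ((f (Q w))%:E + c%:E * (X w ^+ 4)%:E))%E).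
    apply: ge0_le_integral => //.
    - by move=> w _; rewrite lee_fin sqr_ge0.
    - by apply/measurable_EFinP; exact: measurable_funX.
    - apply: emeasurable_funD; first exact: measurable_cells.
      exact: emeasurable_funM.
    move=> w _; rewrite -EFinM -EFinD lee_fin /f.
    have := qz_norm_ge K h0 (X w); rewrite ge_min => /orP[h1|h1].
      have h2 : `|X w| <= `|qval (Q w)| + h by rewrite /qval; lra.
      have : X w ^+ 2 <= (`|qval (Q w)| + h) ^+ 2.
        rewrite -[leLHS]real_normK ?num_real// lerXn2r ?nnegrE//.
        by rewrite addr_ge0// ltW.
      have := sqr_ge0 (`|qval (Q w)| - h).
      have : 0 <= c * X w ^+ 4 by rewrite mulr_ge0.
      rewrite -[qval (Q w) ^+ 2]real_normK ?num_real//; lra.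
    have h2 : K%:R * h <= `|X w| by apply: le_trans (qval_le w).
    have : X w ^+ 2 <= c * X w ^+ 4.
      rewrite /c mulrC ler_pdivlMr ?exprn_gt0//.
      have -> : X w ^+ 4 = X w ^+ 2 * X w ^+ 2 by ring.
      rewrite ler_wpM2l ?sqr_ge0// -[leRHS]real_normK ?num_real//.
      by rewrite lerXn2r ?nnegrE// ltW.
    have := sqr_ge0 (qval (Q w)); have := sqr_ge0 h; lra.
  rewrite ge0_integralD//; last 4 first.
  - by move=> w _; rewrite lee_fin.
  - exact: measurable_cells.
  - by move=> w _; rewrite mule_ge0// lee_fin.
  - exact: emeasurable_funM.
  rewrite leeD2l// ge0_integralZl_EFin//; last by move=> w _; rewrite lee_fin.
  by rewrite EFinM lee_wpmul2l// lee_fin.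
rewrite -EFinD lee_fin.
have -> : \sum_v pv v * f v = 2 * (\sum_v pv v * qval v ^+ 2) + 2 * h ^+ 2 * \sum_v pv v.
  by rewrite !mulr_sumr -big_split; apply: eq_bigr => v _; rewrite /f /=; ring.
by rewrite pv_sum1 [c * k4]mulrC /c; lra.
Qed.

Lemma discrete_symlaw : (0 < K)%N -> symmetric_rv X -> centered_unit_variance X ->
  2 * h ^+ 2 + k4 / (K%:R * h) ^+ 2 <= 1 / 2 -> symlaw pv qval (@gneg K) k4.
Proof.
move=> K0 sym cu small; split.
- exact: pv_ge0.
- exact: pv_sum1.
- exact: gnegK.
- exact: qval_neg.
- by move=> v; exact: pv_neg.
- exact: moment2_ge.
- exact: moment2_le.
- exact: moment4_le.
- exact: k41.
Qed.

Lemma discrete_tail (t q C : R) : 0 < t -> 0 < q -> 0 <= C ->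
  (\int[P]_w (`|X w| `^ q)%:E <= (C `^ q)%:E)%E ->
  atail pv qval t <= (C / t) `^ q.
Proof.
move=> t0 q0 C0 Xq.
have tq : 0 < t `^ q by rewrite powR_gt0.
have -> : atail pv qval t = \sum_v pv v * (t < `|qval v|)%R%:R.
  rewrite /atail big_mkcond /=; apply: eq_bigr => v _.
  by case: ltP => _; rewrite ?mulr1 ?mulr0.
have -> : (C / t) `^ q = (t `^ q)^-1 * C `^ q.
  rewrite powRM ?invr_ge0 ?(ltW t0)// -(powR_inv1 (ltW t0)) powRAC.
  by rewrite powR_inv1 ?powR_ge0// mulrC.
have mq : measurable_fun setT (fun w => `|X w| `^ q).
  apply: (@measurableT_comp _ _ _ _ _ _ (@powR R ^~ q) _ (fun w => `|X w|)).
    exact: measurable_powR.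
  exact: measurableT_comp.
rewrite -lee_fin EFinM.
apply: (@le_trans _ _ ((t `^ q)^-1%:E * \int[P]_w (`|X w| `^ q)%:E)%E); last first.
  by rewrite lee_wpmul2l// lee_fin invr_ge0 ltW.
have mqe : measurable_fun setT (fun w => (`|X w| `^ q)%:E) by exact/measurable_EFinP.
have tq' : 0 <= (t `^ q)^-1 by rewrite invr_ge0 ltW.
have Xq0 w : setT w -> (0 <= (`|X w| `^ q)%:E)%E by rewrite lee_fin powR_ge0.
rewrite -ge0_integralZl_EFin//.
apply: (@cells_le (fun v => (t < `|qval v|)%R%:R) (fun w => (t `^ q)^-1 * `|X w| `^ q)) => //.
  exact: measurable_funM.
move=> w; case: ltP => /= lt; last by rewrite mulr_ge0 ?invr_ge0 ?powR_ge0.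
rewrite mulrC ler_pdivlMr// mul1r; apply: ge0_ler_powR; rewrite ?nnegrE//; try exact: ltW.
exact: le_trans (ltW lt) (qval_le w).
Qed.

(** Rounding lowers an absolute value by at most [h] unless it saturates, and [t] does not exceed
    the saturation level. The factor 2 passes from the two-sided to the upper tail by symmetry. *)
Lemma discrete_utail (t : R) : symmetric_rv X -> 0 < t -> t <= K%:R * h ->
  (P [set w | (t + h < `|X w|)%R] <= (2 * utail pv qval t)%:E)%E.
Proof.
move=> sym t0 tK.
have mA : measurable [set w | (t + h < `|X w|)%R].
  have -> : [set w | (t + h < `|X w|)%R] = (fun w => t + h < `|X w|) @^-1` [set true].
    by apply/seteqP; split.
  rewrite -[X in measurable X]setTI; apply: measurable_fun_ltr => //.
  exact: measurableT_comp.
have -> : P [set w | (t + h < `|X w|)%R] = (\int[P]_w (\1_[set w | (t + h < `|X w|)%R] w)%:E)%E.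
  by rewrite integral_indic// setIT.
have -> : 2 * utail pv qval t = \sum_v pv v * (t <= `|qval v|)%R%:R.
  have e (v : V) : (t <= `|qval v|)%R%:R = (t <= qval v)%R%:R + (t <= - qval v)%R%:R :> R.
    case: (leP 0 (qval v)) => q0.
      rewrite ger0_norm// (_ : (t <= - qval v) = false) ?addr0//.
      by apply/negbTE; rewrite -ltNge; lra.
    rewrite ltr0_norm// (_ : (t <= qval v) = false) ?add0r//.
    by apply/negbTE; rewrite -ltNge; lra.
  under [RHS]eq_bigr do rewrite e mulrDr.
  rewrite big_split /= [X in _ + X](reindex_inj (can_inj (@gnegK K))) /=.
  have -> : \sum_v pv (gneg v) * (t <= - qval (gneg v))%R%:R = \sum_v pv v * (t <= qval v)%R%:R.
    by apply: eq_bigr => v _; rewrite pv_neg// qval_neg opprK.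
  have -> : \sum_v pv v * (t <= qval v)%R%:R = utail pv qval t.
    rewrite /utail [RHS]big_mkcond /=; apply: eq_bigr => v _.
    by case: (t <= qval v); rewrite ?mulr1 ?mulr0.
  by ring.
apply: (@cells_ge (fun v => (t <= `|qval v|)%R%:R) (\1_[set w | (t + h < `|X w|)%R])) => //.
move=> w; rewrite indicE; case: (boolP (w \in _)) => [/set_mem /= lt|_]; last exact: ler0n.
suff -> : t <= `|qval (Q w)| by [].
have := qz_norm_ge K h0 (X w); rewrite ge_min => /orP[g|g]; rewrite /qval /Q; lra.
Qed.

End DiscreteLaw.

Section Moments.
Context {d : measure_display} {T : measurableType d} {R : realType}.
Variables (P : probability T R) (X : {RV P >-> R}).

(** Raising both constants to at least 1 only weakens the bound because [q >= 4], and it frees later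
    estimates from the case of small constants. *)
Lemma weak_moment_integral (k kappa1 gamma q : R) :
  weak_moment X k kappa1 gamma -> 4 <= q -> q <= k ->
  (\int[P]_w (`|X w| `^ q)%:E <= ((Num.max 1 kappa1 * q `^ (Num.max 1 gamma)) `^ q)%:E)%E.
Proof.
move=> wm q4 qk; have q0 : 0 < q by lra.
have := wm q q4 qk; set C := kappa1 * q `^ gamma => NC.
set C' := Num.max 1 kappa1 * _.
have CC : C <= C'.
  have g1 : q `^ gamma <= q `^ (Num.max 1 gamma).
    by apply: ler_powR; [lra|rewrite le_max lexx orbT].
  apply: (@le_trans _ _ (Num.max 1 kappa1 * q `^ gamma)).
    by rewrite ler_wpM2r ?powR_ge0// le_max lexx orbT.
  by rewrite ler_wpM2l// le_max ler01.
have N0 := Lnorm_ge0 P q%:E (EFin \o X).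
have C0 : 0 <= C by rewrite -lee_fin; exact: le_trans N0 NC.
have := @poweR_Lnorm _ _ _ P (EFin \o X) q; rewrite gt_eqF// => /(_ isT) e.
have -> : (\int[P]_w (`|X w| `^ q)%:E)%E = ('N[P]_q%:E[EFin \o X] `^ q)%E.
  by rewrite e; apply: eq_integral.
apply: (@le_trans _ _ (C%:E `^ q)%E).
  apply: gt0_ler_poweR => //; first exact: ltW.
  - by rewrite in_itv /= N0 leey.
  - by rewrite in_itv /= lee_fin C0 leey.
rewrite poweR_EFin lee_fin; apply: ge0_ler_powR; rewrite ?nnegrE//; first exact: ltW.
exact: le_trans C0 CC.
Qed.

End Moments.

(** * From the probability space to the finite product *)

Section MatrixEvent.
Context {d : measure_display} {T : measurableType d} {R : realType}.
Variable P : probability T R.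

Lemma measure_bigsetU_le (I : Type) (r : seq I) (Q : pred I) (F : I -> set T) :
  (forall i, measurable (F i)) ->
  (P (\big[setU/set0]_(i <- r | Q i) F i) <= \sum_(i <- r | Q i) P (F i))%E.
Proof.
move=> mF; elim: r => [|i r IH]; first by rewrite !big_nil measure0.
rewrite !big_cons; case: ifP => // _.
apply: le_trans (leeD (lexx _) IH); apply: measureU2 => //.
exact: bigsetU_measurable.
Qed.

Lemma bigsetU_in (I : eqType) (r : seq I) (Q : pred I) (F : I -> set T) i w :
  i \in r -> Q i -> F i w -> (\big[setU/set0]_(i <- r | Q i) F i) w.
Proof.
elim: r => // k r IH; rewrite inE big_cons => /orP[/eqP <-|ir] Qi Fi.
  by rewrite Qi; left.
by case: ifP => _; [right|]; exact: IH.
Qed.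

Lemma bigsetI_all (I : Type) (r : seq I) (Q : pred I) (F : I -> set T) w :
  (forall i, F i w) -> (\big[setI/setT]_(i <- r | Q i) F i) w.
Proof. by move=> h; elim/big_rec: _ => // i A _ Aw; split. Qed.

Variables (m N : nat) (X : {RV P >-> R}) (b : 'I_m -> 'I_N -> {RV P >-> R}).
Hypothesis indep : mutually_independent (fun ji : 'I_m * 'I_N => b ji.1 ji.2).
Hypothesis dist : forall j i, same_distribution (b j i) X.
Variables (K : nat) (h k4 : R).
Hypotheses (K0 : (0 < K)%N) (h0 : 0 < h).
Hypothesis X4 : (\int[P]_w (X w ^+ 4)%:E <= k4%:E)%E.

Let V := gint K.
Let I := ('I_m * 'I_N)%type.
Let bb (ji : I) : {RV P >-> R} := b ji.1 ji.2.
Let E (M : {ffun I -> V}) : set T :=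
  \big[setI/setT]_(ji in [set: I]%SET) (bb ji @^-1` [set x | qz K h x = M ji]).
Let far := [set x : R | K%:R * h <= `|x|].
Let A (ji : I) : set T := bb ji @^-1` far.

Let mcell v : measurable [set x : R | qz K h x = v] := measurable_cell h0 v.

Let mE M : measurable (E M).
Proof. by apply: bigsetI_measurable => ji _; apply: measurable_funPTI. Qed.

Let mfar : measurable far.
Proof.
have -> : far = (fun x : R => K%:R * h <= `|x|) @^-1` [set true] by apply/seteqP; split.
by rewrite -[X in measurable X]setTI; apply: measurable_fun_ler.
Qed.

Let mA ji : measurable (A ji).
Proof. exact: measurable_funPTI. Qed.

Let PE M : P (E M) = (\prod_ji pv X h (M ji))%:E.
Proof.
rewrite /E (indep [set: I]%SET (fun ji => mcell (M ji))).
rewrite -prodEFin; apply: eq_big => [ji|ji _]; first by rewrite finset.in_setT.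
by rewrite dist// pvE.
Qed.

Let PA ji : (P (A ji) <= (k4 / (K%:R * h) ^+ 4)%:E)%E.
Proof.
have Kh : 0 < K%:R * h by rewrite mulr_gt0// ltr0n.
rewrite /A dist//.
have mX : measurable_fun setT (X : T -> R) := measurable_funPT X.
have -> : P (X @^-1` far) = (\int[P]_w (\1_(X @^-1` far) w)%:E)%E.
  by rewrite integral_indic ?setIT//; exact: measurable_funPTI.
set c := ((K%:R * h) ^+ 4)^-1.
have c0 : 0 <= c by rewrite invr_ge0 exprn_ge0// ltW.
have m4 : measurable_fun setT (fun w => (X w ^+ 4)%:E).
  by apply/measurable_EFinP; exact: measurable_funX.
have X40 w : setT w -> (0 <= (X w ^+ 4)%:E)%E by rewrite lee_fin exprn_even_ge0.
apply: (@le_trans _ _ (c%:E * \int[P]_w (X w ^+ 4)%:E)%E); last first.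
  by rewrite mulrC EFinM lee_wpmul2l// lee_fin.
rewrite -ge0_integralZl_EFin//; apply: ge0_le_integral => //.
- by apply/measurable_EFinP; apply: measurable_indic; exact: measurable_funPTI.
- exact: emeasurable_funM.
move=> w _; rewrite -EFinM lee_fin indicE; case: (boolP (w \in _)) => [/set_mem /= hw|_]; last first.
  by rewrite mulr_ge0// exprn_even_ge0.
rewrite /c mulrC ler_pdivlMr ?exprn_gt0// mul1r.
have -> : X w ^+ 4 = `|X w| ^+ 4 by rewrite -normrX ger0_norm// exprn_even_ge0.
by rewrite lerXn2r// nnegrE ltW.
Qed.

(** The event is the complement of finitely many measurable sets: an entry is beyond saturation, or
    the discretised matrix is a given bad one. It is therefore measurable whatever [good] says.
    Independence is used only for cells, where it gives the product weight. *)
Lemma matrix_event (good : {ffun I -> V} -> bool) :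
  exists G : set T, [/\ measurable G,
    (forall w, G w -> good [ffun ji : I => qz K h (b ji.1 ji.2 w)] /\
       forall j i, `|b j i w| < K%:R * h) &
    ((1 - (Pr (fun _ : I => @pv _ _ _ P X K h) (fun M => ~~ good M) +
       (m * N)%:R * (k4 / (K%:R * h) ^+ 4)))%:E <= P G)%E].
Proof.
pose B1 := \big[setU/set0]_(ji : I) A ji.
pose B2 := \big[setU/set0]_(M : {ffun I -> V} | ~~ good M) E M.
have mB1 : measurable B1 by exact: bigsetU_measurable.
have mB2 : measurable B2 by exact: bigsetU_measurable.
have mB : measurable (B1 `|` B2) by exact: measurableU.
exists (~` (B1 `|` B2)); split; first exact: measurableC.
  move=> w nB; split.
    apply: contrapT => /negP ng; apply: nB; right.
    set M := [ffun ji => _] in ng.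
    apply: (bigsetU_in (i := M)) => //; first exact: mem_index_enum.
    by apply: bigsetI_all => ji; rewrite /= ffunE.
  move=> j i; rewrite ltNge; apply/negP => far_; apply: nB; left.
  by apply: (bigsetU_in (i := (j, i))) => //; exact: mem_index_enum.
rewrite probability_setC// EFinB leeB//.
apply: le_trans (measureU2 P mB1 mB2) _.
rewrite EFinD [leRHS]addeC; apply: leeD.
  apply: le_trans (measure_bigsetU_le _ _ mA) _.
  apply: (@le_trans _ _ (\sum_(ji : I) (k4 / (K%:R * h) ^+ 4)%:E)%E).
    by apply: lee_sum => ji _; exact: PA.
  by rewrite sumEFin lee_fin sumr_const card_prod !card_ord [leRHS]mulr_natl.
apply: le_trans (measure_bigsetU_le _ _ mE) _.
under eq_bigr do rewrite PE.
rewrite sumEFin lee_fin /Pr /Ex [leLHS]big_mkcond /=; apply: ler_sum => M _.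
by case: (good M); rewrite /= ?mulr0 ?mulr1.
Qed.

End MatrixEvent.

(** * The common core of both parts *)

Section Core.
Context {R : realType}.
(* [C1] is a rate in the tail bound [exp(- C1 t^2) <= P(|X| > t + 1) / 2] of part (b). *)
Variables (kappa1 gamma C1 : R).
Hypothesis C11 : 1 <= C1.

Let kap := Num.max 1 kappa1.
Let gam := Num.max 1 gamma.
(** The moment assumption at order 4, with constants raised to at least 1. *)
Definition fk4 : R := (kap * 4 `^ gam) ^+ 4.
(** Gives both [fc <= 1/2], which keeps the tilts of part (a) in the bounded regime, and
    [C1 * fc ^+ 2 <= 1/4]. *)
Definition fc : R := (2 * C1)^-1.
Let Z := kap * expR 10 * 2 `^ (gam - 1).
(** Small enough that [11 fdl <= q0 / 8], so that counting grid vectors costs less than the Chernoff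
    exponent, and that [2 fdl Z^2 <= 1], the condition of the bad column bound. *)
Definition fdl : R := q0 fk4 / (8 * 11 * Z ^+ 2).
(** A product of three factors, each at least 1, so that [exp L] dominates each one: this yields
    [L >= 4], [4 / fdl <= exp(L/2)] and [Y0 <= exp(L/8)]. *)
Definition fCt : R := expR 4 * (4 / fdl) ^+ 2 * Y0 fk4 fc ^+ 8.
Definition ftau : R := 16 * Num.sqrt (8 / q0 fk4).
(** The first term is the width constant when [k >= fdl * sstar / 2]; the added [ftau] absorbs the
    discretisation error in the image. *)
Definition frho : R := (we1 fk4 kap gam * Num.sqrt (fdl / 2))^-1 + ftau.
Definition fKq : R := 4 * 32 * fk4 / fc.
(** Ensures [sqrt(fc2) * frho <= 1/4] and [32 fc2 <= fdl]. By the latter, the mere existence of an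
    admissible [s >= 1] forces [fdl * sstar >= 32]. *)
Definition fc2 : R := fdl / (32 * (1 + frho ^+ 2)).

Let kap1 : 1 <= kap. Proof. by rewrite le_max lexx. Qed.
Let gam1 : 1 <= gam. Proof. by rewrite le_max lexx. Qed.
Let k41 : 1 <= fk4.
Proof.
have h1 : 1 <= 4 `^ gam.
  by rewrite -[leLHS](powRr0 4); apply: ler_powR; [lra|have := gam1; lra].
by apply: exprn_ege1; apply: mulr_ege1.
Qed.
Let k4p : 0 < fk4. Proof. by have := k41; lra. Qed.
Let k4_ge0 : 0 <= fk4 := ltW k4p.
Let cp : 0 < fc. Proof. by rewrite invr_gt0 mulr_gt0//; have := C11; lra. Qed.
Let c_half : fc <= 1 / 2.
Proof.
rewrite /fc -[1 / 2]invf_div lef_pV2 ?posrE ?divr_gt0 ?mulr_gt0//; have := C11; lra.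
Qed.
Let cC1 : C1 * fc ^+ 2 <= 1 / 4.
Proof.
have C1p : 0 < C1 by have := C11; lra.
have -> : C1 * fc ^+ 2 = (4 * C1)^-1 by rewrite /fc; field; rewrite gt_eqF.
rewrite -[1 / 4]invf_div lef_pV2 ?posrE ?divr_gt0 ?mulr_gt0//; have := C11; lra.
Qed.
Let qp : 0 < q0 fk4. Proof. by rewrite invr_gt0 mulr_gt0//; have := k41; lra. Qed.
Let q1 : q0 fk4 <= 1.
Proof. by rewrite /q0 invf_le1 ?mulr_gt0//; have := k41; lra. Qed.
Let Z1 : 1 <= Z.
Proof.
have h1 : 1 <= expR 10 :> R by rewrite -[leLHS]expR0 ler_expR.
have h2 : 1 <= 2 `^ (gam - 1).
  by rewrite -[leLHS](powRr0 2); apply: ler_powR; [lra|have := gam1; lra].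
by apply: mulr_ege1 => //; apply: mulr_ege1.
Qed.
Let Zp : 0 < Z. Proof. by have := Z1; lra. Qed.
Let Z21 : 1 <= Z ^+ 2. Proof. exact: exprn_ege1. Qed.
Let dlp : 0 < fdl. Proof. by rewrite /fdl divr_gt0// mulr_gt0 ?exprn_gt0// mulr_gt0. Qed.
Let dlE : 8 * 11 * (fdl * Z ^+ 2) = q0 fk4.
Proof. by rewrite /fdl; field; rewrite gt_eqF. Qed.
Let dlZ : fdl <= fdl * Z ^+ 2. Proof. by rewrite ler_peMr// ltW. Qed.
Let dlH : 2 * fdl * Z ^+ 2 <= 1. Proof. by have := dlE; have := q1; lra. Qed.
Let dlq : 11 * fdl <= q0 fk4 / 8. Proof. by have := dlE; have := dlZ; lra. Qed.
Let dl1 : fdl <= 1 / 8. Proof. by have := dlq; have := q1; have := dlp; lra. Qed.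
Let e0p : 0 < c0 fk4.
Proof.
rewrite /c0 invr_gt0 mulr_gt0// exprn_gt0// /C4.
have : 0 <= 8 * (fk4 + 1) * (16 / 3) ^+ 2.
  by apply: mulr_ge0; [rewrite mulr_ge0//; have := k41; lra|exact: sqr_ge0].
lra.
Qed.
Let Y01 : 1 <= Y0 fk4 fc.
Proof.
have h1 : 0 <= 12 * 32 / c0 fk4 ^+ 2 by rewrite divr_ge0 ?sqr_ge0 ?mulr_ge0.
have h2 : 0 <= 3 * 32 * 32 * fk4 / (c0 fk4 ^+ 3 * (fc / (32 * fk4)) ^+ 2).
  apply: divr_ge0; first by apply: mulr_ge0 => //; lra.
  by apply: mulr_ge0; [rewrite exprn_ge0// ltW|exact: sqr_ge0].
by rewrite /Y0; lra.
Qed.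
Let dl4 : 1 <= 4 / fdl. Proof. by rewrite ler_pdivlMr//; have := dl1; lra. Qed.
Lemma fCt_gt0 : 0 < fCt.
Proof.
have h1 : 0 < (4 / fdl) ^+ 2 by rewrite exprn_gt0//; have := dl4; lra.
have h2 : 0 < Y0 fk4 fc ^+ 8 by rewrite exprn_gt0//; have := Y01; lra.
by rewrite /fCt mulr_gt0// mulr_gt0// expR_gt0.
Qed.
Let taup : 0 < ftau. Proof. by rewrite mulr_gt0// sqrtr_gt0 divr_gt0. Qed.
Let e1p : 0 < we1 fk4 kap gam.
Proof.
have C2p : 0 < wC2 kap gam.
  have : 0 <= C3 kap gam.
    rewrite /C3; apply: mulr_ge0; last exact: powR_ge0.
    by apply: mulr_ge0; [rewrite mulr_ge0// sqr_ge0|exact: expR_ge0].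
  by rewrite /wC2; lra.
have Kp : 0 < wKc fk4 kap gam by rewrite divr_gt0// mulr_gt0.
apply: divr_gt0 => //; apply: mulr_gt0; first by rewrite !mulr_gt0.
by apply: mulr_gt0; [exact: expR_gt0|exact: mulr_gt0].
Qed.
Let dl2p : 0 < Num.sqrt (fdl / 2). Proof. by rewrite sqrtr_gt0 divr_gt0. Qed.
Lemma frho_gt0 : 0 < frho.
Proof. by rewrite addr_gt0// invr_gt0 mulr_gt0. Qed.
Lemma fKq_gt0 : 0 < fKq.
Proof. by rewrite divr_gt0// mulr_gt0// mulr_gt0. Qed.
Lemma fc2_gt0 : 0 < fc2.
Proof. by rewrite divr_gt0// mulr_gt0// addr_gt0// exprn_gt0// frho_gt0. Qed.
Let c2E : 32 * (fc2 + fc2 * frho ^+ 2) = fdl.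
Proof.
rewrite /fc2; have h : 0 < 1 + frho ^+ 2 by rewrite addr_gt0// exprn_gt0// frho_gt0.
by field; rewrite gt_eqF.
Qed.
Let c2r0 : 0 <= fc2 * frho ^+ 2. Proof. by rewrite mulr_ge0 ?sqr_ge0// ltW// fc2_gt0. Qed.
Let c2dl : 32 * fc2 <= fdl. Proof. by have := c2E; have := c2r0; lra. Qed.
Let c2_1 : fc2 <= 1. Proof. by have := c2dl; have := dl1; have := fc2_gt0; lra. Qed.
Let c2rho : Num.sqrt fc2 * frho <= 1 / 4.
Proof.
rewrite -(@ler_pXn2r _ 2)// ?nnegrE ?mulr_ge0 ?sqrtr_ge0 ?(ltW frho_gt0)//.
rewrite exprMn sqr_sqrtr ?(ltW fc2_gt0)//.
have -> : (1 / 4 : R) ^+ 2 = 1 / 16 by field.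
by have := c2E; have := fc2_gt0; have := dl1; lra.
Qed.

(* [W] is the unit ball of the gauge [qn] that measures the noise: the clipped norm in part (a),
   where coordinates are bounded, and the Euclidean norm in part (b). *)
Section Instance.
Variables (d : measure_display) (T : measurableType d) (P : probability T R).
Variables (m N : nat) (X : {RV P >-> R}) (b : 'I_m -> 'I_N -> {RV P >-> R}) (eta : R) (s : nat).
Hypotheses (m0 : (0 < m)%N) (mN : (m <= N)%N).
Hypothesis indep : mutually_independent (fun ji : 'I_m * 'I_N => b ji.1 ji.2).
Hypothesis dist : forall j i, same_distribution (b j i) X.
Hypotheses (sym : symmetric_rv X) (cu : centered_unit_variance X).
Hypothesis wm : weak_moment X (Num.max 4 (ln N%:R)) kappa1 gamma.
Hypotheses (eta0 : 0 <= eta) (NCt : fCt * m%:R <= N%:R).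
Hypothesis mln : (ln N%:R) `^ (Num.max (2 * gamma - 1) 1) <= m%:R.
Hypotheses (s1 : (1 <= s)%N) (s_le : s%:R <= fc2 * sstar m N).

Let L : R := ln (expR 1 * N%:R / m%:R).
Variables (W : ('I_m -> R) -> Prop) (qn : ('I_m -> R) -> R).
Hypothesis W_n2 : forall w, W w -> n2 w <= 1.
Hypothesis W_small : forall w, n2 w <= (Num.sqrt L)^-1 -> W w.
Hypothesis W_sg : forall (th w : 'I_m -> R), W w -> W (fun j => Num.sg (th j) * `|w j|).
Hypothesis W_tail : (forall w j, W w -> Num.sqrt L * `|w j| <= 1) \/
  (forall t, 1 / 2 <= t -> ((2 * expR (- (C1 * t ^+ 2)))%:E <= P [set w | (t + 1 < `|X w|)%R])%E).
Hypothesis qn_ge : forall w, n2 w <= qn w.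
Hypothesis qnZ : forall c w, 0 <= c -> qn (fun j => c * w j) = c * qn w.
Hypothesis qnW : forall w, 0 < qn w -> W (fun j => (qn w)^-1 * w j).

Let mp : 0 < m%:R :> R. Proof. by rewrite ltr0n. Qed.
Let Np : 0 < N%:R :> R. Proof. by rewrite ltr0n (leq_trans m0). Qed.
Let eNm : 0 < expR 1 * N%:R / m%:R :> R.
Proof. by rewrite divr_gt0// mulr_gt0// expR_gt0. Qed.
Let expL : expR L = expR 1 * N%:R / m%:R. Proof. by rewrite lnK// posrE. Qed.
Let LN : expR L * m%:R = expR 1 * N%:R. Proof. by rewrite expL divfK// gt_eqF. Qed.
Let CtL : fCt <= expR L.
Proof.
rewrite expL ler_pdivlMr//; apply: le_trans NCt _.
by rewrite ler_peMl ?ler0n//; have := @expR_ge1Dx R 1; lra.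
Qed.
Let Ct3 : [/\ expR 4 <= fCt, (4 / fdl) ^+ 2 <= fCt & Y0 fk4 fc ^+ 8 <= fCt].
Proof.
have a1 : 1 <= expR 4 :> R by rewrite -[leLHS]expR0 ler_expR.
have a2 : 1 <= (4 / fdl) ^+ 2 by exact: exprn_ege1.
have a3 : 1 <= Y0 fk4 fc ^+ 8 by exact: exprn_ege1.
rewrite /fCt; move: a1 a2 a3.
set x := expR 4; set y := _ ^+ 2; set z := _ ^+ 8 => a1 a2 a3.
have xy : 1 <= x * y by nra.
have zx : x <= x * y by rewrite ler_peMr//; lra.
have zy : y <= x * y by rewrite ler_peMl//; lra.
have xyz : x * y <= x * y * z by rewrite ler_peMr//; lra.
have z3 : z <= x * y * z by rewrite ler_peMl//; lra.
by split; lra.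
Qed.
Let L4 : 4 <= L.
Proof. by have [h _ _] := Ct3; rewrite -ler_expR; apply: le_trans h CtL. Qed.
Let Lp : 0 < L. Proof. by have := L4; lra. Qed.
Let sLp : 0 < Num.sqrt L. Proof. by rewrite sqrtr_gt0. Qed.
Let dlL : 4 / fdl <= expR (L / 2).
Proof.
rewrite -(@ler_pXn2r _ 2)// ?nnegrE ?expR_ge0//; last by have := dl4; lra.
have [_ h _] := Ct3; apply: le_trans h (le_trans CtL _).
by rewrite -expRM_natl ler_expR; lra.
Qed.
Let YL : Y0 fk4 fc <= expR (L / 8).
Proof.
rewrite -(@ler_pXn2r _ 8)// ?nnegrE ?expR_ge0//; last by have := Y01; lra.
have [_ _ h] := Ct3; apply: le_trans h (le_trans CtL _).
by rewrite -expRM_natl ler_expR; lra.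
Qed.
Let lN : R := ln N%:R.
Let lNE : expR lN = N%:R. Proof. by rewrite lnK// posrE. Qed.
Let lN4 : 4 <= lN.
Proof.
rewrite -ler_expR lNE; have [h _ _] := Ct3; apply: le_trans h (le_trans _ NCt).
by rewrite ler_peMr ?ler1n// ltW// fCt_gt0.
Qed.
(** The exponents agree because [2 max(1, gamma) - 1 = max(2 gamma - 1, 1)]. *)
Let mlN : lN `^ (2 * gam - 1) <= m%:R.
Proof.
apply: le_trans mln; rewrite -/lN; apply: eq_lexx; congr (_ `^ _).
rewrite /gam; case: (leP gamma 1) => h.
  by rewrite max_r; lra.
by rewrite max_l; lra.
Qed.

Let ss : R := sstar m N.
Let ssE : ss * L = m%:R. Proof. by rewrite /ss /sstar -/L divfK// gt_eqF. Qed.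
Let ssp : 0 < ss. Proof. by rewrite /ss /sstar divr_gt0. Qed.
Let sS := Num.sqrt ss.
Let sSp : 0 < sS. Proof. by rewrite sqrtr_gt0. Qed.
Let sm : R := Num.sqrt m%:R.
Let smp : 0 < sm. Proof. by rewrite sqrtr_gt0. Qed.
Let smE : sm = sS * Num.sqrt L.
Proof. by rewrite /sm -ssE sqrtrM// ltW. Qed.
Let ss_ge : 1 <= fc2 * ss.
Proof. by apply: le_trans s_le; rewrite ler1n. Qed.
Let dlss : 32 <= fdl * ss.
Proof.
have := ler_wpM2r (ltW ssp) c2dl; have := ss_ge; lra.
Qed.
Let dlm : 2 <= fdl * m%:R.
Proof.
rewrite -ssE mulrA; have := dlss; have := L4; set x := fdl * ss; nra.
Qed.

Let k := Num.truncn (fdl * ss).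
Let k_itv : k%:R <= fdl * ss < k.+1%:R.
Proof. by apply: truncn_itv; have := dlss; lra. Qed.
Let k0 : (0 < k)%N.
Proof. by rewrite truncn_gt0; have := dlss; lra. Qed.
Let kL : k%:R * L <= fdl * m%:R.
Proof. by rewrite -ssE mulrA ler_wpM2r ?(ltW Lp)//; have /andP[] := k_itv. Qed.
Let k2 : fdl * ss <= 2 * k%:R.
Proof.
have /andP[_] := k_itv; rewrite -natr1.
by have : 1 <= k%:R :> R by [rewrite ler1n]; lra.
Qed.
Let kL2 : fdl * m%:R <= 2 * (k%:R * L).
Proof. by have := ler_wpM2r (ltW Lp) k2; rewrite -[X in _ <= X -> _]mulrA -[X in X <= _ -> _]mulrA ssE. Qed.

(** One mesh meeting three demands: [4 h <= 1] for the variance and the tails, [h sS <= 1] for the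
    width and [fKq h sm <= 1/2] for the quotient property. *)
Let h := (4 + sS + 2 * fKq * sm)^-1.
Let Kqp := fKq_gt0.
Let hden : 0 < 4 + sS + 2 * fKq * sm.
Proof. by rewrite !addr_gt0// mulr_gt0// mulr_gt0. Qed.
Let hp : 0 < h. Proof. by rewrite invr_gt0. Qed.
Let Kqsm : 0 < 2 * fKq * sm. Proof. by rewrite mulr_gt0// mulr_gt0. Qed.
Let hE : h * (4 + sS + 2 * fKq * sm) = 1. Proof. by rewrite mulVf// gt_eqF. Qed.
Let h4 : 4 * h <= 1.
Proof.
have := hE; have : 0 < h * sS by rewrite mulr_gt0.
have : 0 < h * (2 * fKq * sm) by rewrite mulr_gt0.
lra.
Qed.
Let hs : h * sS <= 1.
Proof.
have := hE; have := hp; have : 0 < h * (2 * fKq * sm) by rewrite mulr_gt0.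
lra.
Qed.
Let hq : fKq * (h * sm) <= 1 / 2.
Proof.
have := hE; have := hp; have : 0 < h * sS by rewrite mulr_gt0.
lra.
Qed.

(** The saturation level has to exceed [4 fk4], to preserve the variance, a quantity that makes
    saturation of some entry cost at most [exp(-m)], and [L], so that the tails used for tilting are
    not cut off. *)
Let A : R := 4 * fk4 + (m * N)%:R * fk4 * expR m%:R + L.
Let A_ge : [/\ 4 * fk4 <= A, (m * N)%:R * fk4 * expR m%:R <= A, L <= A & 1 <= A].
Proof.
have a1 : 0 <= (m * N)%:R * fk4 * expR m%:R.
  by apply: mulr_ge0; [exact: mulr_ge0|exact: expR_ge0].
have := k41; have := L4; rewrite /A; set y := (m * N)%:R * _ * _ in a1 *.
by split; lra.
Qed.
Let K := (Num.truncn (A / h)).+1.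
Let Kh : A <= K%:R * h.
Proof.
have [_ _ _ A1] := A_ge.
have /truncn_itv/andP[_ g] : 0 <= A / h by rewrite divr_ge0 ?(ltW hp)//; lra.
by rewrite -ler_pdivrMr// ltW.
Qed.

Let X4 : (\int[P]_w (X w ^+ 4)%:E <= fk4%:E)%E.
Proof.
have q4 : 4 <= Num.max 4 (ln N%:R : R) by rewrite le_max lexx.
have := weak_moment_integral wm (lexx 4) q4; rewrite powR_mulrn; last first.
  by rewrite mulr_ge0 ?powR_ge0// le_max ler01.
apply: le_trans; apply: eq_lexx.
apply: eq_integral => w _; congr EFin.
by rewrite powR_mulrn// -normrX ger0_norm// exprn_even_ge0.
Qed.

Let small : 2 * h ^+ 2 + fk4 / (K%:R * h) ^+ 2 <= 1 / 2.
Proof.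
have [A4 _ _ A1] := A_ge.
have h16 : h ^+ 2 <= 1 / 16.
  by have := h4; have := hp; rewrite expr2; nra.
have Ap : 0 < K%:R * h by have := Kh; lra.
have : fk4 / (K%:R * h) ^+ 2 <= 1 / 4.
  rewrite ler_pdivrMr ?exprn_gt0//.
  have : A * 1 <= K%:R * h * (K%:R * h) by apply: ler_pM => //; [lra|have := Kh; lra].
  rewrite -expr2; lra.
lra.
Qed.

Let p := @pv _ _ _ P X K h.
Let val := @qval R K h.
Let law : symlaw p val (@gneg K) fk4 := discrete_symlaw hp k41 X4 (ltn0Sn _) sym cu small.

Let tailH t q : 0 < t -> 4 <= q -> q <= lN -> atail p val t <= (kap * q `^ gam / t) `^ q.
Proof.
move=> t0 q4 qN; apply: (discrete_tail K hp) => //; first by lra.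
  by rewrite mulr_ge0 ?powR_ge0//; have := kap1; lra.
by apply: (weak_moment_integral wm) => //; rewrite le_max qN orbT.
Qed.

(** Either the coordinates of [w] are so small that the tilt is in the bounded regime, or the tail
    of [X] beyond [t + 1] is available; since [h <= 1], rounding does not reduce the discrete tail
    below it. *)
Let W_tail' w j : W w -> `|fc * Num.sqrt L * w j| <= 1 / 2 \/
  expR (- (C1 * (fc * Num.sqrt L * w j) ^+ 2)) <= utail p val `|fc * Num.sqrt L * w j|.
Proof.
move=> Ww; set t := fc * Num.sqrt L * w j.
have te : `|t| = fc * (Num.sqrt L * `|w j|).
  by rewrite /t 2!normrM (gtr0_norm cp) (gtr0_norm sLp) mulrA.
case: W_tail => [|sg].
  move=> /(_ _ j Ww) h1; left; rewrite te; have := ler_wpM2l (ltW cp) h1.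
  by have := c_half; lra.
have [|th] := leP `|t| (1 / 2); [by left|right].
have tK : `|t| <= K%:R * h.
  have [_ _ AL _] := A_ge; have := Kh.
  have w1 : `|w j| <= 1 by apply: le_trans (coord_le_n2 w j) _; exact: W_n2.
  have sL : Num.sqrt L <= L.
    rewrite -[leRHS]ger0_norm ?(ltW Lp)// -sqrtr_sqr ler_wsqrtr// expr2 ler_peMr ?(ltW Lp)//.
    by have := L4; lra.
  have : Num.sqrt L * `|w j| <= L * 1 by apply: ler_pM => //; exact: ltW.
  have : fc * (Num.sqrt L * `|w j|) <= 1 * (Num.sqrt L * `|w j|).
    by rewrite ler_wpM2r ?mulr_ge0 ?(ltW sLp)//; have := c_half; lra.
  by rewrite te; lra.
have tp : 0 < `|t| by lra.
have := discrete_utail hp sym tp tK.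
have := sg `|t| (ltW th); rewrite real_normK ?num_real//.
move=> h1 h2; have : ((2 * expR (- (C1 * t ^+ 2)))%:E <= (2 * utail p val `|t|)%:E)%E.
  apply: le_trans h1 (le_trans _ h2); apply: le_measure; rewrite ?inE.
  - have -> : [set w | (`|t| + 1 < `|X w|)%R] = (fun w => `|t| + 1 < `|X w|) @^-1` [set true].
      by apply/seteqP; split.
    rewrite -[X in measurable X]setTI; apply: measurable_fun_ltr => //.
    exact: measurableT_comp.
  - have -> : [set w | (`|t| + h < `|X w|)%R] = (fun w => `|t| + h < `|X w|) @^-1` [set true].
      by apply/seteqP; split.
    rewrite -[X in measurable X]setTI; apply: measurable_fun_ltr => //.
    exact: measurableT_comp.
  - by move=> x /=; have := h4; have := hp; lra.
by rewrite lee_fin ler_pM2l.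
Qed.

Let good (M : {ffun 'I_m * 'I_N -> gint K}) : bool :=
  `[< width_prop val fk4 kap gam k M >] && `[< quotient_prop val fk4 fc L W M >].

Let good_prob : Pr (fun _ : 'I_m * 'I_N => p) (fun M => ~~ good M) <= 4 * expR (- (fdl * m%:R)).
Proof.
have pd := fdist_law law ('I_m * 'I_N)%type.
apply: le_trans (_ : Pr (fun _ : 'I_m * 'I_N => p) (fun M => ~~ `[< width_prop val fk4 kap gam k M >])
  + Pr (fun _ : 'I_m * 'I_N => p) (fun M => ~~ `[< quotient_prop val fk4 fc L W M >]) <= _).
  by apply: le_trans (PrU pd _ _); apply: (Pr_le pd) => M; rewrite negb_and.
have L1 : 1 <= L by have := L4; lra.
have w1 := width_whp law kap1 gam1 lN4 tailH m0 k0 L4 lNE LN mN mlN kL kL2 dlp dlH dlq dlL.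
have w2 := quotient_whp law m0 L1 LN cp C11 cC1 W_n2 W_small W_sg W_tail' YL.
apply: le_trans (lerD w1 w2) _.
have e1 : expR (- m%:R) <= expR (- (fdl * m%:R)).
  by rewrite ler_expR lerN2 ler_piMl ?ler0n//; have := dl1; lra.
have e2 : expR (- (q0 fk4 / 8 * m%:R)) <= expR (- (fdl * m%:R)).
  by rewrite ler_expR lerN2 ler_wpM2r ?ler0n//; have := dlq; have := dlp; lra.
lra.
Qed.

Section Matrix.
Variable w0 : T.
Let M : {ffun 'I_m * 'I_N -> gint K} := [ffun ji => qz K h (b ji.1 ji.2 w0)].
Hypotheses (gM : good M) (near_ : forall j i, `|b j i w0| < K%:R * h).
Let B (j : 'I_m) (i : 'I_N) : R := sm^-1 * b j i w0.

Let err j i : `|b j i w0 - val (M (j, i))| <= h.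
Proof. by rewrite ffunE; apply: qz_err. Qed.

(** Rounding the entries moves each coordinate of the image by at most [h * n1 u / sm], hence the
    image by [h * n1 u <= n1 u / sS], which has the form of the l1-term. *)
Lemma true_width u : n2 u <= frho * n1 u / sS + ftau * n2 (matvec B u).
Proof.
have /andP[/asboolP/(_ u) wd _] := gM.
have u0 := n1_ge0 u.
have skk : Num.sqrt (fdl / 2) * sS <= Num.sqrt k%:R.
  rewrite -sqrtrM; last by rewrite divr_ge0// ltW.
  by rewrite ler_wsqrtr//; have := k2; lra.
have kp : 0 < Num.sqrt k%:R :> R by rewrite sqrtr_gt0 ltr0n.
have a1 : n1 u / (we1 fk4 kap gam * Num.sqrt k%:R) <=
    (we1 fk4 kap gam * Num.sqrt (fdl / 2))^-1 * n1 u / sS.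
  have -> : (we1 fk4 kap gam * Num.sqrt (fdl / 2))^-1 * n1 u / sS =
     n1 u / (we1 fk4 kap gam * (Num.sqrt (fdl / 2) * sS)).
    by field; rewrite !gt_eqF.
  have h1 := mulr_gt0 e1p (mulr_gt0 dl2p sSp).
  by rewrite ler_wpM2l// lef_pV2 ?posrE ?(mulr_gt0 e1p kp)// ler_pM2l.
have a2 : n2 (fun j : 'I_m => sm^-1 * \sum_i val (M (j, i)) * u i) <= n2 (matvec B u) + n1 u / sS.
  apply: le_trans (n2B _ (matvec B u)) _; rewrite lerD2l.
  apply: (@le_trans _ _ (h * n1 u)); last first.
    by rewrite mulrC ler_wpM2l// -[leRHS]mul1r ler_pdivlMr.
  have -> : h * n1 u = Num.sqrt ((h * n1 u) ^+ 2).
    by rewrite sqrtr_sqr ger0_norm// mulr_ge0// ltW.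
  rewrite ler_wsqrtr//.
  apply: (@le_trans _ _ (\sum_(j < m) sm^-1 ^+ 2 * (h * n1 u) ^+ 2)).
    apply: ler_sum => j _.
    have -> : matvec B u j - sm^-1 * (\sum_i val (M (j, i)) * u i) =
        sm^-1 * \sum_i (b j i w0 - val (M (j, i))) * u i.
      rewrite /matvec !mulr_sumr -sumrB; apply: eq_bigr => i _.
      by rewrite /B; ring.
    rewrite exprMn ler_wpM2l ?sqr_ge0// -[leLHS]real_normK ?num_real//.
    rewrite lerXn2r ?nnegrE ?mulr_ge0 ?(ltW hp)//.
    apply: le_trans (ler_norm_sum _ _ _) _; rewrite /n1 mulr_sumr; apply: ler_sum => i _.
    by rewrite normrM ler_wpM2r.
  rewrite sumr_const card_ord -[leLHS]mulr_natl exprVn.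
  have -> : sm ^+ 2 = m%:R by rewrite /sm sqr_sqrtr// ltW.
  by rewrite mulrA mulfV ?gt_eqF// mul1r.
have := ler_wpM2l (ltW taup) a2 => a3.
apply: le_trans wd _; rewrite -/ftau -/sm.
apply: le_trans (lerD a1 a3) _; rewrite /frho.
by apply: eq_lexx; ring.
Qed.

(** Rounding enlarges the bound on the columns by [h * sm * n2 y], where [n2 y] is not known
    beforehand. The quotient property at a multiple of [y] itself bounds [n2 y] by [2 fKq B0], so
    the enlarged bound is at most [2 B0]. *)
Let quot_dual (y w : 'I_m -> R) (B0 : R) : W w -> 0 <= B0 ->
  (forall i, `|\sum_j b j i w0 * y j| <= B0) ->
  \sum_j y j * w j <= 2 * fKq / Num.sqrt L * B0.
Proof.
move=> Ww B00 yB; have /andP[_ /asboolP qt] := gM.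
have Kq0 : 0 <= fKq := ltW Kqp.
have [y0|yn0] := eqVneq (n2 y) 0.
  rewrite big1 => [|j _]; last by rewrite (n2_eq0 y0) mul0r.
  by apply: mulr_ge0 => //; apply: divr_ge0; [exact: mulr_ge0|exact: ltW].
have yp : 0 < n2 y by rewrite lt_neqAle eq_sym yn0 n2_ge0.
pose B1 := B0 + h * sm * n2 y.
have yB1 i : `|\sum_j val (M (j, i)) * y j| <= B1.
  have -> : \sum_j val (M (j, i)) * y j =
     \sum_j b j i w0 * y j - \sum_j (b j i w0 - val (M (j, i))) * y j.
    by rewrite -sumrB; apply: eq_bigr => j _; ring.
  apply: le_trans (ler_normB _ _) _; rewrite lerD//.
  apply: le_trans (ler_norm_sum _ _ _) _.
  apply: (@le_trans _ _ (h * n1 y)).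
    rewrite /n1 mulr_sumr; apply: ler_sum => j _.
    by rewrite normrM ler_wpM2r.
  by rewrite -mulrA ler_wpM2l ?(ltW hp)//; have := n1_le_n2 y; rewrite card_ord.
pose v0 j := ((Num.sqrt L)^-1 / n2 y) * y j.
have sLi : 0 <= (Num.sqrt L)^-1 by rewrite invr_ge0 ltW.
have Wv0 : W v0.
  apply: W_small; rewrite n2Z ger0_norm ?divr_ge0 ?n2_ge0// divfK// gt_eqF//.
have := qt y v0 B1 Wv0 yB1; rewrite -/fKq.
have -> : \sum_j y j * v0 j = n2 y / Num.sqrt L.
  rewrite /v0; under eq_bigr do rewrite mulrCA -expr2.
  by rewrite -mulr_sumr -n2_sqr; field; rewrite !gt_eqF.
have -> : fKq / Num.sqrt L * B1 = fKq * B1 / Num.sqrt L by ring.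
rewrite ler_pM2r ?invr_gt0// => h1.
have nB : n2 y <= 2 * fKq * B0.
  have := ler_wpM2r (n2_ge0 y) hq; move: h1; rewrite /B1; lra.
apply: le_trans (qt y w B1 Ww yB1) _; rewrite -/fKq.
have B12 : B1 <= 2 * B0.
  rewrite /B1; have hs0 : 0 <= h * sm by rewrite mulr_ge0// ltW.
  have := ler_wpM2l hs0 nB; have := ler_wpM2r B00 hq; lra.
have -> : 2 * fKq / Num.sqrt L * B0 = fKq / Num.sqrt L * (2 * B0) by ring.
by rewrite ler_wpM2l// divr_ge0// ltW.
Qed.

Lemma true_quotient w : exists2 u, (forall j, matvec B u j = w j) & n1 u <= 2 * fKq * sS * qn w.
Proof.
have [q00|qp'] := leP (qn w) 0.
  have w0' : n2 w = 0 by apply/eqP; rewrite eq_le n2_ge0 andbT; exact: le_trans (qn_ge w) q00.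
  exists (fun=> 0).
    by move=> j; rewrite (n2_eq0 w0') /matvec big1// => i _; rewrite mulr0.
  have q0' : qn w = 0 by apply/eqP; rewrite eq_le q00 -w0' qn_ge.
  by rewrite q0' mulr0 /n1 big1// => i _; rewrite normr0.
have r0 : 0 <= 2 * fKq * sS by apply: mulr_ge0; [apply: mulr_ge0 => //; exact: ltW Kqp|exact: ltW].
have [u Bu u1] : exists2 u : 'I_N -> R, (forall j, matvec B u j = (qn w)^-1 * w j) &
    n1 u <= 2 * fKq * sS.
  apply: solve_l1 => // y M0 M00 yM.
  have smM : 0 <= sm * M0 by rewrite mulr_ge0// ltW.
  have := @quot_dual y _ (sm * M0) (qnW qp') smM.
  have h1 i : `|\sum_j b j i w0 * y j| <= sm * M0.
    have -> : \sum_j b j i w0 * y j = sm * \sum_j B j i * y j.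
      by rewrite mulr_sumr; apply: eq_bigr => j _; rewrite /B; field; rewrite gt_eqF.
    by rewrite normrM (gtr0_norm smp) ler_pM2l.
  move=> /(_ h1) /le_trans; apply; rewrite smE; apply: eq_lexx.
  by field; rewrite gt_eqF.
exists (fun i => qn w * u i).
  by move=> j; rewrite matvecZ Bu mulrA mulfV ?mul1r// gt_eqF.
have -> : n1 (fun i => qn w * u i) = qn w * n1 u.
  by rewrite /n1 mulr_sumr; apply: eq_bigr => i _; rewrite normrM gtr0_norm.
by rewrite mulrC ler_pM2r.
Qed.

Lemma true_recovery (pp : R) (x : 'I_N -> R) (w : 'I_m -> R) (z : 'I_N -> R) :
  1 <= pp -> pp <= 2 ->
  is_l1_min B eta (fun j => matvec B x j + w j) z ->
  lpnorm pp (fun i => x i - z i) <=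
    8 * (1 + frho) / (s%:R `^ (1 - pp^-1)) * sigma_s1 s x
    + ss `^ (pp^-1 - 2^-1) *
      (4 * ftau * (5 + 4 * frho) * eta + 2 * (5 * (1 + frho) * (2 * fKq) + ftau) *
        (qn w / lpnorm 2 w) * Num.max (lpnorm 2 w - eta) 0).
Proof.
move=> p1 p2 mn.
exact: (recovery ssp frho_gt0 taup s1 (ltW fc2_gt0) c2_1 c2rho s_le true_width
  true_quotient qnZ qn_ge eta0 p1 p2 mn).
Qed.

End Matrix.

Lemma core_instance : exists G : set T, [/\ measurable G,
   (G `<=` [set omega | forall (p : R), 1 <= p -> p <= 2 ->
      forall (x : 'I_N -> R) (w : 'I_m -> R) (z : 'I_N -> R),
      is_l1_min (fun j i => (Num.sqrt m%:R)^-1 * b j i omega) eta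
        (fun j => matvec (fun j i => (Num.sqrt m%:R)^-1 * b j i omega) x j + w j) z ->
      lpnorm p (fun i => x i - z i) <=
        8 * (1 + frho) / (s%:R `^ (1 - p^-1)) * sigma_s1 s x
        + sstar m N `^ (p^-1 - 2^-1) *
          (4 * ftau * (5 + 4 * frho) * eta + 2 * (5 * (1 + frho) * (2 * fKq) + ftau) *
            (qn w / lpnorm 2 w) * Num.max (lpnorm 2 w - eta) 0)])
   & ((1 - 3 * expR (- (fdl / 2 * m%:R)))%:E <= P G)%E].
Proof.
have [G [mG Gg PG]] := matrix_event indep dist (ltn0Sn (Num.truncn (A / h))) hp X4 good.
exists G; split => // [w0 /Gg[gM nr] p' p1 p2 x w z|].
  exact: true_recovery.
apply: le_trans PG; rewrite lee_fin lerB//.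
apply: le_trans (lerD good_prob (lexx _)) _.
have [_ A2 _ A1] := A_ge.
have Ap : 0 < K%:R * h by have := Kh; lra.
have trunc_le : (m * N)%:R * (fk4 / (K%:R * h) ^+ 4) <= expR (- (fdl * m%:R)).
  apply: (@le_trans _ _ (expR (- m%:R))); last first.
    by rewrite ler_expR lerN2 ler_piMl ?ler0n//; have := dl1; lra.
  rewrite mulrA ler_pdivrMr ?exprn_gt0// expRN [leRHS]mulrC ler_pdivlMr ?expR_gt0//.
  apply: le_trans A2 (le_trans Kh _); rewrite -[leLHS]expr1.
  by apply: ler_weXn2l => //; have := Kh; lra.
(* Five terms of size [exp(-fdl m)] are collected: three for the width, one for the quotient
   property and one for saturation. Halving the rate gains a factor 2, and [5/2 <= 3]. *)
have e2 : expR (- (fdl * m%:R)) = expR (- (fdl / 2 * m%:R)) * expR (- (fdl / 2 * m%:R)).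
  by rewrite -expRD; congr expR; lra.
have e3 : expR (- (fdl / 2 * m%:R)) <= 1 / 2.
  rewrite expRN -[1 / 2]invf_div lef_pV2 ?posrE ?expR_gt0 ?divr_gt0//.
  by have := @expR_ge1Dx R (fdl / 2 * m%:R); have := dlm; lra.
have e4 := expR_ge0 (- (fdl / 2 * m%:R)).
have : expR (- (fdl * m%:R)) <= expR (- (fdl / 2 * m%:R)) / 2.
  by rewrite e2 ler_wpM2l//; lra.
by rewrite -/K; move: trunc_le e4; lra.
Qed.

End Instance.

Lemma fdl_gt0 : 0 < fdl. Proof. exact: dlp. Qed.
Lemma ftau_gt0 : 0 < ftau. Proof. exact: taup. Qed.

End Core.

(** * Homogeneity of the noise gauges *)

Section Norms.
Context {R : realType}.

Lemma linfnormZ (m : nat) (c : R) (w : 'I_m -> R) : 0 <= c ->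
  linfnorm (fun j => c * w j) = c * linfnorm w.
Proof.
move=> c0; rewrite /linfnorm; apply: (big_ind2 (fun x y => x = c * y)).
- by rewrite mulr0.
- by move=> x1 x2 y1 y2 -> ->; rewrite maxr_pMr.
- by move=> i _; rewrite normrM (ger0_norm c0).
Qed.

Lemma clipped_normZ (m : nat) (a c : R) (w : 'I_m -> R) : 0 <= c ->
  clipped_norm a (fun j => c * w j) = c * clipped_norm a w.
Proof.
move=> c0; rewrite /clipped_norm !lpnorm2E n2Z (ger0_norm c0) linfnormZ//.
by rewrite maxr_pMr// mulrCA.
Qed.

Lemma n2_sgr_norm (m : nat) (th w : 'I_m -> R) :
  n2 (fun j => Num.sg (th j) * `|w j|) <= n2 w.
Proof.
rewrite ler_wsqrtr//; apply: ler_sum => j _.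
rewrite exprMn real_normK ?num_real// ler_piMl ?sqr_ge0//.
by rewrite sqr_sg lern1 leq_b1.
Qed.

End Norms.

(** * A lower bound for Gaussian tails *)

Section Gaussian.
Context {R : realType}.
Variable sigma : R.
Hypotheses (sigma0 : 0 < sigma) (sigma1 : sigma <= 1).

(* [(t + 1) / sigma + 1 <= 5 t / sigma] for [t >= 1/2] gives the first term; the second absorbs
   the factor [2 / normal_peak 1]. *)
Definition gaussian_rate : R := 13 / sigma ^+ 2 + 8 / normal_peak 1.

Let pk0 : 0 < normal_peak 1 :> R. Proof. exact: normal_peak_gt0. Qed.
Let s1 : 1 <= (sigma ^+ 2)^-1.
Proof. by rewrite invf_ge1 ?exprn_gt0// exprn_ile1// ltW. Qed.

Lemma gaussian_rate_ge1 : 1 <= gaussian_rate.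
Proof.
have h : 0 < 8 / normal_peak 1 :> R by rewrite divr_gt0.
by rewrite /gaussian_rate; have := s1; lra.
Qed.

(** The tail contains a unit interval starting at [a = (t + 1) / sigma], on which the density is at
    least its value at [a + 1]. *)
Lemma normal_tail_ge t : 1 / 2 <= t ->
  ((2 * expR (- (gaussian_rate * t ^+ 2)))%:E <=
    normal_prob 0 1 [set x : R | (t + 1 < `|sigma * x|)%R])%E.
Proof.
move=> t2; set a := (t + 1) / sigma.
have a0 : 0 < a by rewrite divr_gt0//; lra.
pose c := normal_peak 1 * expR (- ((a + 1) ^+ 2 / 2)) : R.
have c0 : 0 <= c by rewrite mulr_ge0 ?expR_ge0// ltW.
pose D : set (measurableTypeR R) := `]a, a + 1]%classic.
have mD : measurable D by exact: measurable_itv.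
apply: (@le_trans _ _ (\int[lebesgue_measure]_(x in D) cst c%:E x)%E).
  rewrite integral_cst//= /D lebesgue_measure_itv/= lte_fin ltrDl ltr01 -EFinD.
  rewrite addrAC subrr add0r mule1 lee_fin /c.
  have h1 : a + 1 <= 5 * (t / sigma).
    have si : 1 <= sigma^-1 by rewrite invf_ge1.
    rewrite /a mulrDl; have : 1 <= 2 * (t / sigma).
      have := ler_wpM2l (_ : 0 <= t) si; rewrite mulr1 => /(_ ltac:(lra)); lra.
    have := ler_wpM2r (_ : 0 <= sigma^-1) t2; rewrite invr_ge0 => /(_ (ltW sigma0)); lra.
  have h2 : (a + 1) ^+ 2 <= 25 * (t ^+ 2 / sigma ^+ 2).
    apply: (@le_trans _ _ ((5 * (t / sigma)) ^+ 2)).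
      by rewrite lerXn2r ?nnegrE//; lra.
    by rewrite exprMn expr_div_n; have := sqr_ge0 (t / sigma); rewrite expr_div_n; lra.
  have h3 : 2 / normal_peak 1 <= 8 / normal_peak 1 * t ^+ 2 :> R.
    have : 1 / 4 <= t ^+ 2 by rewrite expr2; nra.
    have pi : 0 <= 8 / normal_peak 1 :> R by rewrite divr_ge0// ltW.
    by move=> /(ler_wpM2l pi); lra.
  have h4 : 2 * expR (- (2 / normal_peak 1)) <= normal_peak 1 :> R.
    rewrite expRN ler_pdivrMr ?expR_gt0// mulrC -ler_pdivrMr//.
    by have := @expR_ge1Dx R (2 / normal_peak 1); lra.
  apply: (@le_trans _ _ (2 * (expR (- (2 / normal_peak 1)) * expR (- ((a + 1) ^+ 2 / 2))))).
    rewrite ler_wpM2l// -expRD ler_expR /gaussian_rate mulrDl.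
    have -> : 13 / sigma ^+ 2 * t ^+ 2 = 13 * (t ^+ 2 / sigma ^+ 2) by ring.
    have : 0 <= t ^+ 2 / sigma ^+ 2 by rewrite divr_ge0 ?sqr_ge0.
    by move: h2 h3; lra.
  by rewrite mulrA ler_wpM2r// expR_ge0.
have mS : measurable [set x : R | (t + 1 < `|sigma * x|)%R].
  have -> : [set x : R | (t + 1 < `|sigma * x|)%R] = (fun x => t + 1 < `|sigma * x|) @^-1` [set true].
    by apply/seteqP; split.
  rewrite -[X in measurable X]setTI; apply: measurable_fun_ltr => //.
  by apply: measurableT_comp => //; exact: mulrl_measurable.
apply: (@le_trans _ _ (\int[lebesgue_measure]_(x in D) (normal_pdf 0 1 x)%:E)%E).
  apply: ge0_le_integral => //=.
  - by apply/measurable_EFinP; apply: measurable_funTS; exact: measurable_normal_pdf.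
  move=> x; rewrite /D /= in_itv/= => /andP[ax xa].
  rewrite lee_fin /normal_pdf oner_eq0 /normal_fun ler_wpM2l ?(ltW pk0)//.
  rewrite ler_expR subr0 expr1n mulNr lerN2.
  by rewrite ler_wpM2r// lerXn2r ?nnegrE//; lra.
apply: ge0_subset_integral => //.
- by apply/measurable_EFinP; apply: measurable_funTS; exact: measurable_normal_pdf.
- by move=> x _; rewrite lee_fin normal_pdf_ge0.
- move=> x; rewrite /D /= in_itv/= => /andP[ax _].
  have x0 : 0 < x by lra.
  by rewrite gtr0_norm ?mulr_gt0// mulrC -ltr_pdivrMr.
Qed.

End Gaussian.

(** * Derivation of both parts from the core *)

Lemma ln_ratio_ge1 (R : realType) (m N : nat) : (0 < m)%N -> (m <= N)%N ->
  1 <= ln (expR 1 * N%:R / m%:R) :> R.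
Proof.
move=> m0 mN; have N0 := leq_trans m0 mN.
rewrite -[leLHS]expRK ler_ln ?posrE ?expR_gt0 ?divr_gt0 ?mulr_gt0 ?expR_gt0 ?ltr0n//.
by rewrite -mulrA ler_peMr ?expR_ge0// ler_pdivlMr ?ltr0n// mul1r ler_nat.
Qed.

(** The set of good outcomes quantifies over all vectors, so the probability bound is stated for a
    measurable event contained in it. As [z] ranges over all minimisers, no choice of a decoder is
    involved. *)
Theorem theorem2p6 :
  (* (a) *)
  (forall (R : realType) (kappa1 gamma : R), 2^-1 <= gamma ->
   exists c1 c2 c3 Ct C D E : R,
     [/\ 0 < c1, 0 < c2, 0 < c3, 0 < Ct & [/\ 0 < C, 0 < D & 0 < E]] /\
   forall (d : measure_display) (T : measurableType d) (P : probability T R)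
     (m N : nat) (X : {RV P >-> R}) (b : 'I_m -> 'I_N -> {RV P >-> R})
     (eta : R) (s : nat),
     (0 < m)%N -> (m <= N)%N ->
     mutually_independent (fun ji : 'I_m * 'I_N => b ji.1 ji.2) ->
     (forall j i, same_distribution (b j i) X) ->
     symmetric_rv X -> centered_unit_variance X ->
     weak_moment X (Num.max 4 (ln N%:R)) kappa1 gamma ->
     0 <= eta ->
     Ct * m%:R <= N%:R ->
     c3 * (ln N%:R) `^ (Num.max (2 * gamma - 1) 1) <= m%:R ->
     (1 <= s)%N -> s%:R <= c2 * sstar m N ->
     exists G : set T, [/\ measurable G,
       (G `<=` [set omega | forall (p : R), 1 <= p -> p <= 2 ->
          forall (x : 'I_N -> R) (w : 'I_m -> R) (z : 'I_N -> R),
          is_l1_min (fun j i => (Num.sqrt m%:R)^-1 * b j i omega) eta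
            (fun j => matvec (fun j i => (Num.sqrt m%:R)^-1 * b j i omega) x j + w j) z ->
          lpnorm p (fun i => x i - z i) <=
            C / (s%:R `^ (1 - p^-1)) * sigma_s1 s x
            + sstar m N `^ (p^-1 - 2^-1) *
              (D * eta + E * (clipped_norm (Num.sqrt (ln (expR 1 * N%:R / m%:R))) w
                               / lpnorm 2 w)
                           * Num.max (lpnorm 2 w - eta) 0)])
       & ((1 - 3 * expR (- (c1 * m%:R)))%:E <= P G)%E])
  /\
  (* (b) *)
  (forall (R : realType) (kappa1 gamma sigma : R), 2^-1 <= gamma ->
   0 < sigma -> sigma <= 1 ->
   exists c1 c2 Ct C D E : R,
     [/\ 0 < c1, 0 < c2, 0 < Ct & [/\ 0 < C, 0 < D & 0 < E]] /\
   forall (d : measure_display) (T : measurableType d) (P : probability T R)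
     (m N : nat) (X : {RV P >-> R}) (b : 'I_m -> 'I_N -> {RV P >-> R})
     (eta : R) (s : nat),
     (0 < m)%N -> (m <= N)%N ->
     mutually_independent (fun ji : 'I_m * 'I_N => b ji.1 ji.2) ->
     (forall j i, same_distribution (b j i) X) ->
     symmetric_rv X -> centered_unit_variance X ->
     weak_moment X (Num.max 4 (ln N%:R)) kappa1 gamma ->
     super_gaussian X sigma ->
     0 <= eta ->
     Ct * m%:R <= N%:R ->
     (ln N%:R) `^ (Num.max (2 * gamma - 1) 1) <= m%:R ->
     (1 <= s)%N -> s%:R <= c2 * sstar m N ->
     exists G : set T, [/\ measurable G,
       (G `<=` [set omega | forall (p : R), 1 <= p -> p <= 2 ->
          forall (x : 'I_N -> R) (w : 'I_m -> R) (z : 'I_N -> R),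
          is_l1_min (fun j i => (Num.sqrt m%:R)^-1 * b j i omega) eta
            (fun j => matvec (fun j i => (Num.sqrt m%:R)^-1 * b j i omega) x j + w j) z ->
          lpnorm p (fun i => x i - z i) <=
            C / (s%:R `^ (1 - p^-1)) * sigma_s1 s x
            + sstar m N `^ (p^-1 - 2^-1) *
              (D * eta + E * Num.max (lpnorm 2 w - eta) 0)])
       & ((1 - 3 * expR (- (c1 * m%:R)))%:E <= P G)%E]).
Proof.
split.
  move=> R kappa1 gamma _.
  pose r := frho kappa1 gamma; pose t := ftau kappa1 gamma; pose q := fKq kappa1 gamma 1.
  have r0 : 0 < r := frho_gt0 _ _; have t0 : 0 < t := ftau_gt0 _ _.
  have q0 : 0 < q := fKq_gt0 kappa1 gamma (lexx 1).
  exists (fdl kappa1 gamma / 2), (fc2 kappa1 gamma), 1, (fCt kappa1 gamma 1),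
    (8 * (1 + r)), (4 * t * (5 + 4 * r)), (2 * (5 * (1 + r) * (2 * q) + t)).
  split.
    split=> //; [by apply: divr_gt0 => //; exact: fdl_gt0|exact: fc2_gt0|exact: fCt_gt0|].
    split; first by lra.
      by apply: mulr_gt0; lra.
    by have : 0 < (1 + r) * (2 * q) by [apply: mulr_gt0; lra]; lra.
  move=> d T P m N X b eta s m0 mN ind dist sym cu wm eta0 NC; rewrite mul1r => mln s1 sle.
  set a := Num.sqrt (ln _).
  have a1 : 1 <= a by rewrite -[leLHS]sqrtr1 ler_wsqrtr// ln_ratio_ge1.
  have ap : 0 < a by lra.
  (* [W] is the unit ball of the clipped norm, written as two conditions. Its coordinates are at
     most [1 / a], so the bounded alternative for the tails holds, and the rate is set to 1. *)
  apply: (core_instance (lexx 1) m0 mN ind dist sym cu wm eta0 NC mln s1 sle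
    (W := fun w => n2 w <= 1 /\ forall j, a * `|w j| <= 1) (qn := clipped_norm a)).
  - by move=> w [].
  - move=> w wa; split; first by apply: le_trans wa _; rewrite invf_le1.
    move=> j; rewrite mulrC -ler_pdivlMr// mul1r; exact: le_trans (coord_le_n2 w j) wa.
  - move=> th w [w1 wj]; split; first exact: le_trans (n2_sgr_norm _ _) w1.
    move=> j; apply: le_trans (wj j); rewrite ler_pM2l// normrM normr_id ler_piMl//.
    by rewrite normr_sg lern1 leq_b1.
  - by left => w j [].
  - by move=> w; rewrite /clipped_norm lpnorm2E le_max lexx.
  - by move=> c w c0; rewrite clipped_normZ.
  - move=> w qw.
    have qi : 0 <= (clipped_norm a w)^-1 by rewrite invr_ge0 ltW.
    split.
      rewrite n2Z (ger0_norm qi) mulrC ler_pdivrMr// mul1r.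
      by rewrite /clipped_norm lpnorm2E le_max lexx.
    move=> j; rewrite normrM (ger0_norm qi) mulrCA mulrC ler_pdivrMr// mul1r.
    rewrite /clipped_norm le_max; apply/orP; right.
    by rewrite ler_pM2l// linfnorm_ge.
move=> R kappa1 gamma sigma _ sg0 sg1.
have C11 := gaussian_rate_ge1 sg0 sg1.
set C1 := gaussian_rate sigma in C11.
pose r := frho kappa1 gamma; pose t := ftau kappa1 gamma; pose q := fKq kappa1 gamma C1.
have r0 : 0 < r := frho_gt0 _ _; have t0 : 0 < t := ftau_gt0 _ _.
have q0 : 0 < q := fKq_gt0 kappa1 gamma C11.
have E0 : 0 < 2 * (5 * (1 + r) * (2 * q) + t).
  by have : 0 < (1 + r) * (2 * q) by [apply: mulr_gt0; lra]; lra.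
exists (fdl kappa1 gamma / 2), (fc2 kappa1 gamma), (fCt kappa1 gamma C1),
  (8 * (1 + r)), (4 * t * (5 + 4 * r)), (2 * (5 * (1 + r) * (2 * q) + t)).
split.
  split=> //; [by apply: divr_gt0 => //; exact: fdl_gt0|exact: fc2_gt0|exact: fCt_gt0|].
  split => //; first by lra.
  by apply: mulr_gt0; lra.
move=> d T P m N X b eta s m0 mN ind dist sym cu wm sgX eta0 NC mln s1 sle.
have a1 : 1 <= Num.sqrt (ln (expR 1 * N%:R / m%:R)) :> R 
  by rewrite -[leLHS]sqrtr1 ler_wsqrtr// ln_ratio_ge1.
have [||||||| G [mG GG PG]] := core_instance C11 m0 mN ind dist sym cu wm eta0 NC mln s1 sle
  (W := fun w => n2 w <= 1) (qn := lpnorm 2).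
- by [].
- by move=> w /le_trans; apply; rewrite invf_le1//; lra.
- by move=> th w; exact: le_trans (n2_sgr_norm _ _).
- right => u u2; apply: le_trans (normal_tail_ge sg0 sg1 u2) _.
  by apply: sgX; lra.
- by move=> w; rewrite lpnorm2E.
- by move=> c w c0; rewrite !lpnorm2E n2Z ger0_norm.
- move=> w; rewrite lpnorm2E => w0.
  by rewrite n2Z ger0_norm ?invr_ge0 ?(ltW w0)// mulVf// gt_eqF.
exists G; split => // omega /GG H p p1 p2 x w z mn.
apply: le_trans (H p p1 p2 x w z mn) _.
rewrite lerD2l ler_wpM2l ?powR_ge0// lerD2l ler_wpM2r ?le_max ?lexx ?orbT//.
rewrite ler_piMr ?(ltW E0)//.
(* For the Euclidean gauge the ratio is 1, or 0 at [w = 0], where division by zero returns 0. *)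
have [->|w0] := eqVneq (lpnorm 2 w) 0; first by rewrite mul0r.
by rewrite mulfV.
Qed.
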